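(* Let $\mathbb{k}$ be an algebraically closed field, and let $\mathfrak{g}$ and $\mathfrak{h}$ be finite dimensional Lie algebras over $\mathbb{k}$ of the same dimension. The algebra $\mathfrak{h}$ is a degeneration of $\mathfrak{g}$ if and only if there exists a Gerstenhaber formal deformation $\mathcal{X}$ of $\mathfrak{h}$ such that $\mathcal{X}\otimes_{\mathbb{k}[[t]]}\mathbb{k}((t))$ is isomorphic to $\mathfrak{g}\otimes_{\mathbb{k}}\mathbb{k}((t))$ as Lie algebras over $\mathbb{k}((t))$.
   Context: Let $V$ be a $\mathbb{k}$-vector space of dimension $\dim_{\mathbb{k}}\mathfrak{g}=\dim_{\mathbb{k}}\mathfrak{h}$. $\mathsf{Lie}_{\mathbb{k}}(V)$ is the affine variety of maps $\varphi\in\operatorname{Hom}_{\mathbb{k}}(\Lambda^2V,V)$ satisfying the Jacobi identity $\varphi(u\wedge\varphi(v\wedge w))+\varphi(v\wedge\varphi(w\wedge u))+\varphi(w\wedge\varphi(u\wedge v))=0$ for all $u,v,w\in V$. The group $\operatorname{GL}(V)$ acts on it by $g\cdot\varphi=g\circ\varphi\circ(g^{-1}\wedge g^{-1})$, and orbits correspond to isomorphism classes of Lie algebras of dimension $\dim_{\mathbb{k}}V$. $\mathcal{O}_{\mathfrak{g}}$ is the orbit corresponding to $\mathfrak{g}$ and $\overline{\mathcal{O}_{\mathfrak{g}}}$ its Zariski closure in $\mathsf{Lie}_{\mathbb{k}}(V)$. $\mathfrak{h}$ is a degeneration of $\mathfrak{g}$ if $\mathcal{O}_{\mathfrak{h}}\subseteq\overline{\mathcal{O}_{\mathfrak{g}}}$.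 $\mathbb{k}[[t]]$ is the algebra of formal power series and $\mathbb{k}((t))$ its fraction field. A (Gerstenhaber) formal deformation of a Lie algebra $\mathfrak{h}$ is a pair $(\mathcal{X},\Psi)$ where $\mathcal{X}$ is a ($t$-adically) complete and torsion-free $\mathbb{k}[[t]]$-Lie algebra and $\Psi:\mathcal{X}\otimes_{\mathbb{k}[[t]]}\mathbb{k}\to\mathfrak{h}$ is an isomorphism of Lie algebras ($\mathbb{k}$ being a $\mathbb{k}[[t]]$-algebra via $t\mapsto0$). Equivalently, if $V$ is the underlying space of $\mathfrak{h}$, it is a $\mathbb{k}[[t]]$-Lie algebra structure on $V[[t]]$ (formal series with coefficients in $V$) for which there are maps $F_i\in\operatorname{Hom}_{\mathbb{k}}(V\wedge V,V)$, $i\geq1$, with $[v,w]_{\mathcal{X}}=[v,w]_{\mathfrak{h}}+F_1(v,w)t+F_2(v,w)t^2+\cdots$ for all $v,w\in V$. *)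

(* Defs.v *)
From HB Require Import structures.
From mathcomp Require Import all_boot all_algebra.
From mathcomp Require Import mpoly boolp classical_sets.

Set Implicit Arguments.
Unset Strict Implicit.
Unset Printing Implicit Defensive.

Import GRing.Theory.
Local Open Scope ring_scope.
Local Open Scope quotient_scope.

HB.mixin Record Lmodule_isLie (R : comNzRingType) (L : Type)
    of GRing.Lmodule R L := {
  lie_bracket : L -> L -> L;
  lie_linearl : forall y, linear (lie_bracket^~ y);
  lie_linearr : forall x, linear (lie_bracket x);
  lie_alternating : forall x, lie_bracket x x = 0;
  lie_jacobi : forall x y z,
    lie_bracket x (lie_bracket y z) + lie_bracket y (lie_bracket z x)
      + lie_bracket z (lie_bracket x y) = 0
}.

#[short(type="lieAlgType")]
HB.structure Definition LieAlgebra (R : comNzRingType) :=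
  { L of Lmodule_isLie R L & GRing.Lmodule R L }.

#[short(type="finLieAlgType")]
HB.structure Definition FinLieAlgebra (R : comNzRingType) :=
  { L of Lmodule_isLie R L & Vector R L }.

Notation "[ 'Lie' x , y ]" := (lie_bracket x y)
  (at level 0, x at level 99, y at level 99,
   format "[ 'Lie'  x ,  y ]") : ring_scope.

Section LieTheory.
Variables (R : comNzRingType) (L : lieAlgType R).
Implicit Types x y z : L.

Lemma lieDl x y z : [Lie x + y, z] = [Lie x, z] + [Lie y, z].
Proof. by have := lie_linearl z 1 x y; rewrite !scale1r. Qed.

Lemma lieDr x y z : [Lie x, y + z] = [Lie x, y] + [Lie x, z].
Proof. by have := lie_linearr x 1 y z; rewrite !scale1r. Qed.

Lemma lie0l x : [Lie 0, x] = 0.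
Proof. by apply: (addrI [Lie 0, x]); rewrite -lieDl !addr0. Qed.

Lemma lie0r x : [Lie x, 0] = 0.
Proof. by apply: (addrI [Lie x, 0]); rewrite -lieDr !addr0. Qed.

Lemma lieZl a x y : [Lie a *: x, y] = a *: [Lie x, y].
Proof. by have := lie_linearl y a x 0; rewrite lie0l !addr0. Qed.

Lemma lieZr a x y : [Lie x, a *: y] = a *: [Lie x, y].
Proof. by have := lie_linearr x a y 0; rewrite lie0r !addr0. Qed.

Lemma lie_anti x y : [Lie x, y] + [Lie y, x] = 0.
Proof.
have := lie_alternating (x + y).
by rewrite lieDl !lieDr !lie_alternating add0r addr0.
Qed.

End LieTheory.

Definition lie_isomorphism (R : comNzRingType) (L L' : lieAlgType R)
    (f : L -> L') : Prop :=
  bijective f /\ forall x y, f [Lie x, y] = [Lie f x, f y].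

Definition lie_isomorphic (R : comNzRingType) (L L' : lieAlgType R) : Prop :=
  exists f : {linear L -> L'}, lie_isomorphism f.

Record powser (R : Type) := Powser { pcoef : nat -> R }.

HB.instance Definition _ R := gen_eqMixin (powser R).
HB.instance Definition _ R := gen_choiceMixin (powser R).

Lemma powserP R (a b : powser R) : (forall n, pcoef a n = pcoef b n) -> a = b.
Proof. by case: a b => [a] [b] /= ab; congr Powser; apply/funext. Qed.

Section PowserRing.
Variable R : comNzRingType.
Implicit Types a b c : powser R.

Definition powser0 : powser R := Powser (fun=> 0).
Definition powserN a := Powser (fun n => - pcoef a n).
Definition powserD a b := Powser (fun n => pcoef a n + pcoef b n).
Definition powserC (r : R) : powser R := Powser (fun n => r *+ (n == 0%N)).
Definition powserM a b :=
  Powser (fun n => \sum_(i < n.+1) pcoef a i * pcoef b (n - i)).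

Fact powserDA : associative powserD.
Proof. by move=> a b c; apply: powserP => n /=; rewrite addrA. Qed.
Fact powserDC : commutative powserD.
Proof. by move=> a b; apply: powserP => n /=; rewrite addrC. Qed.
Fact powserD0 : left_id powser0 powserD.
Proof. by move=> a; apply: powserP => n /=; rewrite add0r. Qed.
Fact powserDN : left_inverse powser0 powserN powserD.
Proof. by move=> a; apply: powserP => n /=; rewrite addNr. Qed.

HB.instance Definition _ := GRing.isZmodule.Build (powser R)
  powserDA powserDC powserD0 powserDN.

Let trunc N a : {poly R} := \poly_(i < N) pcoef a i.

Let truncM N n a b : (n < N)%N -> pcoef (powserM a b) n = (trunc N a * trunc N b)`_n.
Proof.
move=> nN; rewrite coefM /=; apply: eq_bigr => i _.
rewrite !coef_poly (leq_ltn_trans (leq_subr _ _) nN).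
by rewrite (leq_ltn_trans _ nN) // -ltnS.
Qed.

Fact powserMA : associative powserM.
Proof.
move=> a b c; apply: powserP => n.
have tE d e i : (i <= n)%N ->
    (trunc n.+1 (powserM d e))`_i = (trunc n.+1 d * trunc n.+1 e)`_i.
  by move=> le_in; rewrite coef_poly ltnS le_in (@truncM n.+1).
rewrite !(@truncM n.+1) // [LHS]coefM.
transitivity ((trunc n.+1 a * (trunc n.+1 b * trunc n.+1 c))`_n).
  rewrite [RHS]coefM; apply: eq_bigr => i _; congr (_ * _).
  by rewrite tE // leq_subr.
rewrite mulrA coefM [RHS]coefM; apply: eq_bigr => i _; congr (_ * _).
by rewrite tE // -ltnS.
Qed.

Fact powserMC : commutative powserM.
Proof.
by move=> a b; apply: powserP => n; rewrite !(@truncM n.+1) // mulrC.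
Qed.

Fact powserM1 : left_id (powserC 1) powserM.
Proof.
move=> a; apply: powserP => n /=.
by rewrite big_ord_recl /= subn0 mul1r big1 ?addr0 // => i _; rewrite mul0r.
Qed.

Fact powserMDl : left_distributive powserM +%R.
Proof.
move=> a b c; apply: powserP => n /=.
by rewrite -big_split; apply: eq_bigr => i _; rewrite /= mulrDl.
Qed.

Fact powser1_neq0 : powserC 1 != 0.
Proof.
by apply/eqP => /(congr1 (fun a => pcoef a 0)) /eqP; rewrite /= oner_eq0.
Qed.

HB.instance Definition _ := GRing.Zmodule_isComNzRing.Build (powser R)
  powserMA powserMC powserM1 powserMDl powser1_neq0.

Fact powserC_zmod : zmod_morphism powserC.
Proof. by move=> r s; apply: powserP => n /=; rewrite mulrnBl. Qed.
Fact powserC_monoid : monoid_morphism powserC.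
Proof.
split=> // r s; apply: powserP => n /=.
rewrite big_ord_recl /= subn0 big1 ?addr0 ?mulrnAr // => i _.
by rewrite mul0r.
Qed.
HB.instance Definition _ := GRing.isZmodMorphism.Build R (powser R)
  powserC powserC_zmod.
HB.instance Definition _ := GRing.isMonoidMorphism.Build R (powser R)
  powserC powserC_monoid.

Definition powser_ev0 a : R := pcoef a 0.

Fact powser_ev0_zmod : zmod_morphism powser_ev0.
Proof. by []. Qed.
Fact powser_ev0_monoid : monoid_morphism powser_ev0.
Proof. by split=> // a b; rewrite /powser_ev0 /= big_ord1. Qed.
HB.instance Definition _ := GRing.isZmodMorphism.Build (powser R) R
  powser_ev0 powser_ev0_zmod.
HB.instance Definition _ := GRing.isMonoidMorphism.Build (powser R) R
  powser_ev0 powser_ev0_monoid.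

Definition powserX : powser R := Powser (fun n => (n == 1%N)%:R).

(* Units are the invertible series; the inverse of a unit is selected by
   choice, and inversion is the identity on non-units, as in every unitRingType. *)
Definition powser_unit : {pred powser R} := [pred a | `[< exists b, b * a = 1 >]].
Definition powserV a : powser R :=
  if pselect (exists b, b * a = 1) is left ex then projT1 (cid ex) else a.

Fact powserVM : {in powser_unit, left_inverse 1 powserV *%R}.
Proof.
move=> a /asboolP ua; rewrite /powserV; case: pselect => // ex.
by case: cid.
Qed.
Fact powser_unitPl a b : b * a = 1 -> powser_unit a.
Proof. by move=> ba; apply/asboolP; exists b. Qed.
Fact powserV_out : {in [predC powser_unit], powserV =1 id}.
Proof.
move=> a nua; rewrite /powserV; case: pselect => // ex.
by move: nua; rewrite !inE => /asboolPn; case.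
Qed.
HB.instance Definition _ := GRing.ComNzRing_hasMulInverse.Build (powser R)
  powserVM powser_unitPl powserV_out.

End PowserRing.

Section PowserDomain.
Variable R : idomainType.

Fact powser_integral : GRing.integral_domain_axiom (powser R).
Proof.
move=> a b ab0; apply/negPn; rewrite negb_or; apply/negP => /andP[a0 b0].
have low (c : powser R) : c != 0 ->
    exists2 n, pcoef c n != 0 & forall i, (i < n)%N -> pcoef c i = 0.
  move=> c0; have ex : exists n, pcoef c n != 0.
    apply: contrapT => nex; move/eqP: c0; apply; apply: powserP => n /=.
    by apply: contrapT => cn; apply: nex; exists n; apply/eqP.
  case: (ex_minnP ex) => n cn nmin; exists n => // i lt_in.
  by apply: contraTeq lt_in => ci; rewrite -leqNgt nmin.
have [m am ltm] := low a a0; have [n bn ltn_] := low b b0.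
have := congr1 (fun c => pcoef c (m + n)) ab0 => /=.
have lt_m : (m < (m + n).+1)%N by rewrite ltnS leq_addr.
rewrite (bigD1 (Ordinal lt_m)) //= addKn big1 ?addr0 => [/eqP|i ne_im].
  by rewrite mulf_eq0 (negPf am) (negPf bn).
case: (ltngtP i m) => [lt_im|lt_mi|eq_im].
- by rewrite ltm ?mul0r.
- rewrite ltn_ ?mulr0 // ltn_subLR ?ltn_add2r //.
  by rewrite -ltnS.
- by case/eqP: ne_im; apply: val_inj.
Qed.

HB.instance Definition _ :=
  GRing.ComUnitRing_isIntegral.Build (powser R) powser_integral.

End PowserDomain.

Definition laurent (R : idomainType) : fieldType := {fraction (powser R)}.

Definition powser_laurent (R : idomainType) :
  {rmorphism powser R -> laurent R} := @FracField.tofrac (powser R).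

Definition const_laurent (R : idomainType) : {rmorphism R -> laurent R} :=
  powser_laurent R \o @powserC R.

(* For a ring morphism f : R -> S and an R-module M, the S-module
   M (x)_R S: finite formal sums of pure tensors x (x) s, encoded as sequences
   of pairs (x, s), modulo the congruence generated by the tensor relations. *)
Section Tensor.
Variables (R S : comNzRingType) (f : {rmorphism R -> S}) (M : lmodType R).
Local Notation sums := (seq (M * S)).

Inductive tensor_cong : sums -> sums -> Prop :=
| TensRefl u : tensor_cong u u
| TensSym u v : tensor_cong u v -> tensor_cong v u
| TensTrans u v w : tensor_cong u v -> tensor_cong v w -> tensor_cong u w
| TensCat u u' v v' : tensor_cong u u' -> tensor_cong v v' ->
    tensor_cong (u ++ v) (u' ++ v')
| TensC u v : tensor_cong (u ++ v) (v ++ u)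
| Tens0 x : tensor_cong [:: (x, 0)] [::]
| TensDl x y s : tensor_cong [:: (x + y, s)] [:: (x, s); (y, s)]
| TensDr x s s' : tensor_cong [:: (x, s + s')] [:: (x, s); (x, s')]
| TensZ r x s : tensor_cong [:: (r *: x, s)] [:: (x, f r * s)].

Definition tensor_rel (u v : sums) : bool := `[< tensor_cong u v >].

Fact tensor_rel_refl : reflexive tensor_rel.
Proof. by move=> u; apply/asboolP/TensRefl. Qed.
Fact tensor_rel_sym : ssrbool.symmetric tensor_rel.
Proof. by move=> u v; apply/asboolP/asboolP; apply: TensSym. Qed.
Fact tensor_rel_trans : transitive tensor_rel.
Proof.
by move=> v u w /asboolP uv /asboolP vw; apply/asboolP; apply: TensTrans vw.
Qed.

Canonical tensor_equiv :=
  EquivRel tensor_rel tensor_rel_refl tensor_rel_sym tensor_rel_trans.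

Definition extension : Type := {eq_quot tensor_rel}.
HB.instance Definition _ : EqQuotient _ tensor_rel extension :=
  EqQuotient.on extension.
HB.instance Definition _ := Choice.on extension.

Definition tsum (u : sums) : extension := \pi_extension u.
Definition tens (x : M) (s : S) : extension := tsum [:: (x, s)].

Lemma tsumP u v : tsum u = tsum v <-> tensor_cong u v.
Proof.
split=> [/eqmodP/asboolP // | uv].
by apply/eqmodP/asboolP.
Qed.

Lemma tsum_repr z : tsum (repr z) = z.
Proof. exact: reprK. Qed.

Lemma cong_repr u : tensor_cong (repr (tsum u)) u.
Proof. by apply/tsumP; rewrite tsum_repr. Qed.

Definition ext_zero : extension := tsum [::].
Definition ext_add (z z' : extension) : extension := tsum (repr z ++ repr z').
Definition sums_scale (a : S) (u : sums) : sums := [seq (p.1, a * p.2) | p <- u].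
Definition ext_scale (a : S) (z : extension) : extension :=
  tsum (sums_scale a (repr z)).
Definition ext_opp : extension -> extension := ext_scale (-1).

Lemma sums_scale_cong a u v :
  tensor_cong u v -> tensor_cong (sums_scale a u) (sums_scale a v).
Proof.
elim=> {u v} /=.
- by move=> u; apply: TensRefl.
- by move=> u v _; apply: TensSym.
- by move=> u v w _ uv _; apply: TensTrans uv.
- by move=> u u' v v' _ uu _ vv; rewrite /sums_scale !map_cat; apply: TensCat.
- by move=> u v; rewrite /sums_scale !map_cat; apply: TensC.
- by move=> x; rewrite mulr0; apply: Tens0.
- by move=> x y s; apply: TensDl.
- by move=> x s s'; rewrite mulrDr; apply: TensDr.
- by move=> r x s; rewrite mulrCA; apply: TensZ.
Qed.

Lemma ext_addE u v : ext_add (tsum u) (tsum v) = tsum (u ++ v).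
Proof. by apply/tsumP/TensCat; apply: cong_repr. Qed.

Lemma ext_scaleE a u : ext_scale a (tsum u) = tsum (sums_scale a u).
Proof. by apply/tsumP/sums_scale_cong/cong_repr. Qed.

Lemma tsum_ind (P : extension -> Prop) :
  (forall u, P (tsum u)) -> forall z, P z.
Proof. by move=> Pu z; rewrite -(tsum_repr z). Qed.

Fact ext_addA : associative ext_add.
Proof.
elim/tsum_ind=> u; elim/tsum_ind=> v; elim/tsum_ind=> w.
by rewrite !ext_addE catA.
Qed.
Fact ext_addC : commutative ext_add.
Proof.
elim/tsum_ind=> u; elim/tsum_ind=> v.
by rewrite !ext_addE; apply/tsumP/TensC.
Qed.
Fact ext_add0 : left_id ext_zero ext_add.
Proof. by elim/tsum_ind=> u; rewrite ext_addE. Qed.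
Fact ext_addN : left_inverse ext_zero ext_opp ext_add.
Proof.
elim/tsum_ind=> u; rewrite /ext_opp ext_scaleE ext_addE; apply/tsumP.
elim: u => [|[x s] u IHu] /=; first exact: TensRefl.
rewrite -cat1s -[(x, s) :: u]cat1s catA.
apply: (@TensTrans _ (([:: (x, -1 * s)] ++ [:: (x, s)]) ++ (sums_scale (-1) u ++ u))).
  rewrite -!catA; apply: TensCat; first exact: TensRefl.
  rewrite !catA; apply: TensCat; last exact: TensRefl.
  exact: TensC.
rewrite -[[::]]/([::] ++ [::]); apply: TensCat => //.
apply: TensTrans (Tens0 x); apply: TensSym.
by have := TensDr x (-1 * s) s; rewrite mulN1r addNr.
Qed.

HB.instance Definition _ := GRing.isZmodule.Build extension
  ext_addA ext_addC ext_add0 ext_addN.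

Lemma tsum_cat u v : tsum (u ++ v) = tsum u + tsum v.
Proof. by rewrite -ext_addE. Qed.

Lemma tsum_cons x s u : tsum ((x, s) :: u) = tens x s + tsum u.
Proof. by rewrite -tsum_cat. Qed.

Fact ext_scaleA a b z : ext_scale a (ext_scale b z) = ext_scale (a * b) z.
Proof.
elim/tsum_ind: z => u; rewrite !ext_scaleE /sums_scale -map_comp.
by congr tsum; apply: eq_map => p /=; rewrite mulrA.
Qed.
Fact ext_scale1 : left_id 1 ext_scale.
Proof.
elim/tsum_ind=> u; rewrite ext_scaleE; congr tsum.
by elim: u => //= -[x s] u ->; rewrite mul1r.
Qed.
Fact ext_scaleDr : right_distributive ext_scale +%R.
Proof.
move=> a; elim/tsum_ind=> u; elim/tsum_ind=> v.
by rewrite -tsum_cat !ext_scaleE /sums_scale map_cat tsum_cat.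
Qed.
Fact ext_scaleDl z : {morph ext_scale^~ z : a b / a + b}.
Proof.
move=> a b; elim/tsum_ind: z => u; rewrite !ext_scaleE.
elim: u => [|[x s] u IHu] /=; first by rewrite -tsum_cat.
rewrite !tsum_cons IHu addrACA; congr (_ + _).
by rewrite -tsum_cat; apply/tsumP; rewrite mulrDl; apply: TensDr.
Qed.

HB.instance Definition _ := GRing.Zmodule_isLmodule.Build S extension
  ext_scaleA ext_scale1 ext_scaleDr ext_scaleDl.

Lemma tensDl x y s : tens (x + y) s = tens x s + tens y s.
Proof. by rewrite -tsum_cat; apply/tsumP/TensDl. Qed.
Lemma tensDr x s s' : tens x (s + s') = tens x s + tens x s'.
Proof. by rewrite -tsum_cat; apply/tsumP/TensDr. Qed.
Lemma tensZl r x s : tens (r *: x) s = tens x (f r * s).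
Proof. exact/tsumP/TensZ. Qed.
Lemma tensZr a x s : a *: tens x s = tens x (a * s).
Proof. exact: ext_scaleE. Qed.
Lemma tens0l s : tens 0 s = 0.
Proof. by apply: (addrI (tens 0 s)); rewrite -tensDl !addr0. Qed.
Lemma tens0r x : tens x 0 = 0.
Proof. by apply: (addrI (tens x 0)); rewrite -tensDr !addr0. Qed.

Lemma tsumE u : tsum u = \sum_(p <- u) tens p.1 p.2.
Proof.
elim: u => [|[x s] u IHu]; first by rewrite big_nil.
by rewrite big_cons -IHu tsum_cons.
Qed.

Lemma tensor_ind (P : extension -> Prop) :
  P 0 -> (forall x s z, P z -> P (tens x s + z)) -> forall z, P z.
Proof.
move=> P0 PD; elim/tsum_ind; elim=> // -[x s] u Pu.
by rewrite tsum_cons; apply: PD.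
Qed.

Lemma tensor_universal (N : lmodType S) (g : {additive M -> N}) :
  (forall r x, g (r *: x) = f r *: g x) ->
  exists! h : extension -> N, linear h /\ forall x s, h (tens x s) = s *: g x.
Proof.
move=> gZ; pose ev (u : sums) := \sum_(p <- u) p.2 *: g p.1.
have evP u v : tensor_cong u v -> ev u = ev v.
  rewrite /ev; elim=> {u v} //.
  - by move=> u v w _ -> _ ->.
  - by move=> u u' v v' _ uu _ vv; rewrite !big_cat /= uu vv.
  - by move=> u v; rewrite !big_cat /= addrC.
  - by move=> x; rewrite big_seq1 big_nil scale0r.
  - by move=> x y s; rewrite !big_cons !big_nil /= raddfD scalerDr !addr0.
  - by move=> x s s'; rewrite !big_cons !big_nil /= scalerDl !addr0.
  - by move=> r x s; rewrite !big_seq1 /= gZ scalerA mulrC.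
pose h (z : extension) := ev (repr z).
have hE u : h (tsum u) = ev u by apply/evP/cong_repr.
have hD z z' : h (z + z') = h z + h z'.
  elim/tsum_ind: z => u; elim/tsum_ind: z' => v.
  by rewrite -tsum_cat !hE /ev big_cat.
have hZ a z : h (a *: z) = a *: h z.
  elim/tsum_ind: z => u; rewrite [a *: _]ext_scaleE !hE /ev big_map scaler_sumr.
  by apply: eq_bigr => p _; rewrite /= scalerA.
have ht x s : h (tens x s) = s *: g x by rewrite hE /ev big_seq1.
exists h; split=> [|h' [h'L h't]]; first by split=> // a z z'; rewrite hD hZ.
have h'D z z' : h' (z + z') = h' z + h' z'.
  by have := h'L 1 z z'; rewrite !scale1r.
apply/funext => z; elim/tensor_ind: z => [|x s z hz]; last first.
  by rewrite hD h'D ht h't hz.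
have h'0 : h' 0 = 0 by apply: (addrI (h' 0)); rewrite -h'D !addr0.
by have h0 : h 0 = 0 by [apply: (addrI (h 0)); rewrite -hD !addr0]; rewrite h0 h'0.
Qed.

End Tensor.

Arguments tens {R S} f {M} x s.

Section TensorLie.
Variables (R S : comNzRingType) (f : {rmorphism R -> S}) (L : lieAlgType R).
Local Notation ext := (extension f L).
Implicit Types u v w : seq (L * S).

Definition pair_bracket (p q : L * S) : L * S := ([Lie p.1, q.1], p.2 * q.2).

Definition ext_bracket (z z' : ext) : ext :=
  \sum_(p <- repr z) \sum_(q <- repr z') tsum f [:: pair_bracket p q].

Let rawb u v : ext := \sum_(p <- u) \sum_(q <- v) tsum f [:: pair_bracket p q].

Let rawb_congr u v v' : tensor_cong f v v' -> rawb u v = rawb u v'.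
Proof.
move=> vv; apply: eq_bigr => -[x s] _.
elim: vv => {v v'} //.
- by move=> v v' v'' _ -> _ ->.
- by move=> v v' w w' _ vv _ ww; rewrite !big_cat /= vv ww.
- by move=> v w; rewrite !big_cat /= addrC.
- by move=> y; rewrite big_seq1 big_nil /pair_bracket mulr0 -/(tens _ _ _) tens0r.
- move=> y y' s'; rewrite !big_cons !big_nil /pair_bracket /= -!/(tens _ _ _).
  by rewrite lieDr tensDl !addr0.
- move=> y s1 s2; rewrite !big_cons !big_nil /pair_bracket /= -!/(tens _ _ _).
  by rewrite mulrDr tensDr !addr0.
- move=> r y s'; rewrite !big_seq1 /pair_bracket /= -!/(tens _ _ _).
  by rewrite lieZr tensZl mulrCA.
Qed.

Let rawb_congl u u' v : tensor_cong f u u' -> rawb u v = rawb u' v.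
Proof.
move=> uu; rewrite /rawb exchange_big [RHS]exchange_big /=.
apply: eq_bigr => -[y s] _.
elim: uu => {u u'} //.
- by move=> u u' u'' _ -> _ ->.
- by move=> u u' w w' _ uu _ ww; rewrite !big_cat /= uu ww.
- by move=> u w; rewrite !big_cat /= addrC.
- by move=> x; rewrite big_seq1 big_nil /pair_bracket mul0r -/(tens _ _ _) tens0r.
- move=> x x' s'; rewrite !big_cons !big_nil /pair_bracket /= -!/(tens _ _ _).
  by rewrite lieDl tensDl !addr0.
- move=> x s1 s2; rewrite !big_cons !big_nil /pair_bracket /= -!/(tens _ _ _).
  by rewrite mulrDl tensDr !addr0.
- move=> r x s'; rewrite !big_seq1 /pair_bracket /= -!/(tens _ _ _).
  by rewrite lieZl tensZl mulrA.
Qed.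

Let ext_bracketE u v : ext_bracket (tsum f u) (tsum f v) = rawb u v.
Proof.
rewrite -(rawb_congl _ (cong_repr f u)).
by rewrite -(rawb_congr _ (cong_repr f v)).
Qed.

Lemma ext_bracket_tens x y s s' :
  ext_bracket (tens f x s) (tens f y s') = tens f [Lie x, y] (s * s').
Proof. by rewrite ext_bracketE /rawb !big_seq1. Qed.

Let ext_bracketDl z1 z2 z :
  ext_bracket (z1 + z2) z = ext_bracket z1 z + ext_bracket z2 z.
Proof.
elim/tsum_ind: z => w; elim/tsum_ind: z1 => u; elim/tsum_ind: z2 => v.
by rewrite -tsum_cat !ext_bracketE /rawb big_cat.
Qed.

Let ext_bracketDr z1 z2 z :
  ext_bracket z (z1 + z2) = ext_bracket z z1 + ext_bracket z z2.
Proof.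
elim/tsum_ind: z => w; elim/tsum_ind: z1 => u; elim/tsum_ind: z2 => v.
rewrite -tsum_cat !ext_bracketE /rawb -big_split.
by apply: eq_bigr => p _; rewrite big_cat.
Qed.

Let ext_bracket0l z : ext_bracket 0 z = 0.
Proof. by apply: (addrI (ext_bracket 0 z)); rewrite -ext_bracketDl !addr0. Qed.
Let ext_bracket0r z : ext_bracket z 0 = 0.
Proof. by apply: (addrI (ext_bracket z 0)); rewrite -ext_bracketDr !addr0. Qed.

Fact ext_linearl z : linear (ext_bracket^~ z).
Proof.
move=> a z1 z2; rewrite ext_bracketDl; congr (_ + _).
elim/tensor_ind: z1 => [|x s z1 IH]; first by rewrite scaler0 ext_bracket0l scaler0.
rewrite scalerDr !ext_bracketDl scalerDr {}IH; congr (_ + _).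
elim/tensor_ind: z => [|y s' z IHz]; first by rewrite !ext_bracket0r scaler0.
by rewrite !ext_bracketDr scalerDr IHz tensZr !ext_bracket_tens tensZr mulrA.
Qed.

Fact ext_linearr z : linear (ext_bracket z).
Proof.
move=> a z1 z2; rewrite ext_bracketDr; congr (_ + _).
elim/tensor_ind: z1 => [|x s z1 IH]; first by rewrite scaler0 ext_bracket0r scaler0.
rewrite scalerDr !ext_bracketDr scalerDr {}IH; congr (_ + _).
elim/tensor_ind: z => [|y s' z IHz]; first by rewrite !ext_bracket0l scaler0.
by rewrite !ext_bracketDl scalerDr IHz tensZr !ext_bracket_tens tensZr mulrCA.
Qed.

Let ext_anti z z' : ext_bracket z z' + ext_bracket z' z = 0.
Proof.
elim/tensor_ind: z => [|x s z IH]; first by rewrite ext_bracket0l ext_bracket0r addr0.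
rewrite ext_bracketDl ext_bracketDr addrACA {}IH addr0.
elim/tensor_ind: z' => [|y s' z' IH']; first by rewrite ext_bracket0l ext_bracket0r addr0.
rewrite ext_bracketDl ext_bracketDr addrACA IH' addr0 !ext_bracket_tens.
by rewrite [s' * s]mulrC -tensDl lie_anti tens0l.
Qed.

Fact ext_alternating z : ext_bracket z z = 0.
Proof.
elim/tensor_ind: z => [|x s z IH]; first by rewrite ext_bracket0l.
rewrite ext_bracketDl !ext_bracketDr IH addr0 -addrA ext_anti addr0.
by rewrite ext_bracket_tens lie_alternating tens0l.
Qed.

Fact ext_jacobi z1 z2 z3 :
  ext_bracket z1 (ext_bracket z2 z3) + ext_bracket z2 (ext_bracket z3 z1)
    + ext_bracket z3 (ext_bracket z1 z2) = 0.
Proof.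
have AC3 (a b c a' b' c' : ext) :
    a + b + c = 0 -> a' + b' + c' = 0 -> (a + a') + (b + b') + (c + c') = 0.
  by move=> e e'; rewrite (addrACA a a' b b') (addrACA (a + b)) e e' addr0.
elim/tensor_ind: z1 => [|x s z1 IH].
  by rewrite !(ext_bracket0l, ext_bracket0r) !addr0.
rewrite !(ext_bracketDl, ext_bracketDr); refine (AC3 _ _ _ _ _ _ _ IH) => {IH}.
elim/tensor_ind: z2 => [|y s' z2 IH].
  by rewrite !(ext_bracket0l, ext_bracket0r) !addr0.
rewrite !(ext_bracketDl, ext_bracketDr); refine (AC3 _ _ _ _ _ _ _ IH) => {IH}.
elim/tensor_ind: z3 => [|z s'' z3 IH].
  by rewrite !(ext_bracket0l, ext_bracket0r) !addr0.
rewrite !(ext_bracketDl, ext_bracketDr); refine (AC3 _ _ _ _ _ _ _ IH) => {IH}.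
rewrite !ext_bracket_tens [s'' * s]mulrC [s' * (s * _)]mulrCA.
rewrite [s'' * (s * _)]mulrCA [s'' * s']mulrC -!tensDl.
by rewrite lie_jacobi tens0l.
Qed.

HB.instance Definition _ := Lmodule_isLie.Build S (extension f L)
  ext_linearl ext_linearr ext_alternating ext_jacobi.

End TensorLie.

Section Deformation.
Variable k : idomainType.
Local Notation t := (powserX k).

Definition torsion_free (A : idomainType) (X : lmodType A) : Prop :=
  forall (a : A) (x : X), a *: x = 0 -> a = 0 \/ x = 0.

Definition congr_tn (X : lmodType (powser k)) (n : nat) (x y : X) : Prop :=
  exists z, x - y = t ^+ n *: z.

(* The canonical map X -> lim_n X / t^n X is injective and surjective. *)
Definition t_complete (X : lmodType (powser k)) : Prop :=
  (forall x : X, (forall n, congr_tn n x 0) -> x = 0) /\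
  (forall u : nat -> X, (forall n, congr_tn n (u n.+1) (u n)) ->
     exists x, forall n, congr_tn n x (u n)).

Record formal_deformation (h : lieAlgType k) := FormalDeformation {
  deformed :> lieAlgType (powser k);
  deformed_complete : t_complete deformed;
  deformed_torsion_free : torsion_free deformed;
  special_fiber : {linear extension (@powser_ev0 k) deformed -> h};
  special_fiber_iso : lie_isomorphism special_fiber
}.

End Deformation.

Section Zariski.
Variables (k : fieldType) (W : vectType k).

(* Polynomial functions are read off in the basis vbasis {:W}; a linear change
   of coordinates preserves them, so zero loci do not depend on this basis. *)
Definition poly_eval (p : {mpoly k[\dim {:W}]}) (w : W) : k :=
  p.@[fun i => coord (vbasis {:W}) i w].

Definition zero_locus (P : set {mpoly k[\dim {:W}]}) : set W :=
  [set w | forall p, P p -> poly_eval p w = 0].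

Definition zariski_closed_in (X Z : set W) : Prop :=
  exists P, Z = (X `&` zero_locus P)%classic.

Definition zariski_closure (X A : set W) : set W :=
  smallest (zariski_closed_in X) A.

End Zariski.

Section LieVariety.
Variables (k : fieldType) (V : vectType k).
Local Notation bilin := ('Hom(V, 'Hom(V, V))).

(* Hom (Lambda^2 V, V) is realised as the space of alternating bilinear maps,
   inside Hom (V, Hom (V, V)). *)
Definition lie_variety : set bilin := [set phi : bilin |
  (forall u, phi u u = 0) /\
  (forall u v w, phi u (phi v w) + phi v (phi w u) + phi w (phi u v) = 0)].

Definition gl_act (g : 'End(V)) (phi : bilin) : bilin :=
  linfun (fun u => (g \o phi (g^-1%VF u) \o g^-1)%VF).

Lemma gl_actE g phi u v :
  gl_act g phi u v = g (phi (g^-1%VF u) (g^-1%VF v)).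
Proof.
pose F0 u := (g \o phi (g^-1%VF u) \o g^-1)%VF.
have lin : linear F0.
  move=> a x y; apply/lfunP => z; rewrite /F0.
  by rewrite add_lfunE scale_lfunE !comp_lfunE !linearP add_lfunE scale_lfunE linearP.
pose Fl := GRing.isLinear.Build _ _ _ _ F0 lin.
pose F : {linear V -> 'End(V)} := HB.pack F0 Fl.
by rewrite /gl_act -[linfun _]/(linfun F) lfunE /= !comp_lfunE.
Qed.

Definition gl_orbit (phi : bilin) : set bilin :=
  [set psi : bilin | exists2 g : 'End(V), lker g == 0%VS & psi = gl_act g phi].

(* The orbit O_L, as the union of the GL(V)-orbits of the structures phi such
   that (V, phi) is isomorphic to L; there is exactly one such orbit when
   dim V = dim L, and none otherwise. *)
Definition orbit_of (L : finLieAlgType k) : set bilin :=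
  [set psi : bilin | exists phi : bilin, [/\ lie_variety phi,
     exists2 f : {linear L -> V}, bijective f &
       forall x y, f [Lie x, y] = phi (f x) (f y)
   & gl_orbit phi psi]].

Definition degeneration (g h : finLieAlgType k) : Prop :=
  (orbit_of h `<=` zariski_closure lie_variety (orbit_of g))%classic.

End LieVariety.

(* Main.v *)
Require Import Defs.
From HB Require Import structures.
From mathcomp Require Import all_boot all_algebra.
From mathcomp Require Import zify ring mpoly boolp classical_sets.

(** Once bases are fixed, a Lie algebra of dimension [n] is a family [mu] of structure
    constants, and the orbit of [g] consists of the families [act B mu], the structure
    constants of [g] in the bases given by the invertible matrices [B].

    A deformation [X] of [h] is free over k[[t]], with a basis lifting one of [h]
    ([deformation_basis]). Its structure constants [c] are power series with constant
    terms those of [h], and an isomorphism over k((t)) says that [c = act A mu] for an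
    invertible matrix [A] over k((t)). A polynomial [P] that vanishes on the orbit of [g]
    vanishes at [act A mu] as well: up to a power of the determinant, [P (act B mu)] is a
    polynomial in the entries of [B], and it is zero because [k] is infinite
    ([orbit_poly_extension]). So [P] vanishes at [c], and at [t = 0] it vanishes at [h].

    Conversely let [h] be a degeneration of [g], and let [X] be the generic matrix, over
    the field [K] of rational functions in its entries. Every polynomial relation between
    the coordinates of [act X mu] holds at [h], so by Chevalley's theorem
    ([place_extension]) some place of [K] sends [act X mu] to [h]. This place picks an
    affine chart of the closure of the graph of [B |-> act B mu], in which the projective
    point [(1 : X)] has finite coordinates; it is a point of an affine variety, and the
    invertible matrices form a nonempty open subset. A power series arc through that point
    that meets the open subset is a matrix [B] over k((t)) for which [act B mu] has power
    series entries with constant terms the structure constants of [h]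
    ([degeneration_arc]); these entries are the structure constants of the deformation
    ([build_deformation]).

    Arcs exist in all characteristics ([power_series_arc]). By Noether normalization the
    coordinate ring is integral over a polynomial ring k[y]. Choose a line in the affine
    space with coordinates [y], through the image of the point and not contained in the
    image of the complement of the open subset. By going down, which rests on the
    normality of k[y], there is a curve through the point above this line. A place of its
    function field [L] at the point is discrete, because [L] has finite degree over k(t);
    its residue field is [k], so expanding in powers of a uniformizer embeds the
    coordinate ring of the curve in a ring of power series ([place_expansion]). *)

Set Implicit Arguments.
Unset Strict Implicit.
Unset Printing Implicit Defensive.

Import GRing.Theory.
Local Open Scope ring_scope.
Local Open Scope quotient_scope.

(** * Polynomial rings, fractions and quotients by primes *)

Lemma mpoly_hom_ext (R S : comNzRingType) n (f g : {rmorphism {mpoly R[n]} -> S}) :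
  (forall c, f c%:MP = g c%:MP) -> (forall i, f 'X_i = g 'X_i) -> f =1 g.
Proof.
move=> fgC fgX p; rewrite (mpolyE p) !rmorph_sum /=; apply: eq_bigr => m _.
rewrite -mul_mpolyC !rmorphM /= fgC mpolyXE_id !rmorph_prod /=; congr (_ * _).
by apply: eq_bigr => i _; rewrite !rmorphXn /= fgX.
Qed.

Section SplitLastVariable.
Variables (R : comNzRingType) (n : nat).
Local Notation widen := (widen_ord (leqnSn n)).

Lemma muniX (m : 'X_{1..n.+1}) : muni ('X_[m] : {mpoly R[n.+1]}) =
  'X_[[multinom (m (widen i)) | i < n]] *: 'X^(m ord_max).
Proof. by rewrite muniE msuppX big_seq1 mcoeffX eqxx scale1r. Qed.

Lemma muniX_max : muni ('X_ord_max : {mpoly R[n.+1]}) = 'X.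
Proof.
rewrite muniX mnm1E eqxx (_ : [multinom _ | i < n] = 0%MM) ?mpolyX0 ?scale1r //.
apply/mnmP => i; rewrite mnmE mnm0E mnm1E; apply/eqP; rewrite eqb0.
by apply/eqP => /(congr1 val) /= e; have := ltn_ord i; rewrite -e ltnn.
Qed.

Lemma muniX_widen i : muni ('X_(widen i) : {mpoly R[n.+1]}) = ('X_i)%:P.
Proof.
rewrite muniX mnm1E (_ : widen i == ord_max = false); last first.
  by apply/eqP => /(congr1 val) /= e; have := ltn_ord i; rewrite e ltnn.
rewrite expr0 alg_polyC; congr ('X_[_])%:P; apply/mnmP => j.
by rewrite mnmE !mnm1E -[LHS]/((val i == val j) : nat).
Qed.

(** the inverse of [muni] *)
Definition mmerge (p : {poly {mpoly R[n]}}) : {mpoly R[n.+1]} :=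
  (map_poly (@mwiden n R) p).['X_ord_max].

Lemma mmerge_zmod : zmod_morphism mmerge.
Proof. by move=> p q; rewrite /mmerge rmorphB hornerD hornerN. Qed.
Lemma mmerge_monoid : monoid_morphism mmerge.
Proof. by split=> [|p q]; rewrite /mmerge ?rmorph1 ?hornerC // rmorphM hornerM. Qed.
HB.instance Definition _ := GRing.isZmodMorphism.Build _ _ mmerge mmerge_zmod.
HB.instance Definition _ := GRing.isMonoidMorphism.Build _ _ mmerge mmerge_monoid.

Lemma muniK : cancel (@muni n R) mmerge.
Proof.
apply: (@mpoly_hom_ext _ _ _ (mmerge \o @muni n R) idfun) => [c|i] /=.
  by rewrite muniC /mmerge map_polyC hornerC /= mwidenC.
case: (unliftP ord_max i) => [j ->|->]; last first.
  by rewrite muniX_max /mmerge map_polyX hornerX.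
rewrite (_ : lift ord_max j = widen j); last first.
  by apply: val_inj; rewrite /= /bump leqNgt ltn_ord.
by rewrite muniX_widen /mmerge map_polyC hornerC /= mwidenX mnmwiden1.
Qed.

Lemma muniK_mwiden p : muni (mwiden p) = p%:P :> {poly {mpoly R[n]}}.
Proof.
move: p; apply: (@mpoly_hom_ext _ _ _ (@muni n R \o @mwiden n R) polyC) => [c|i] /=.
  by rewrite mwidenC muniC.
by rewrite mwidenX mnmwiden1 muniX_widen.
Qed.

Lemma mmergeK : cancel mmerge (@muni n R).
Proof.
move=> p; rewrite /mmerge -horner_map /= muniX_max -map_poly_comp.
rewrite (eq_map_poly muniK_mwiden) -[RHS]comp_polyXr.
by [].
Qed.

Lemma meval_muni (v : 'I_n.+1 -> R) (p : {mpoly R[n.+1]}) :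
  p.@[v] = (map_poly (meval (v \o widen)) (muni p)).[v ord_max].
Proof.
rewrite -{1}(muniK p); move: (muni p) => {}p.
rewrite /mmerge -horner_map /= mevalXU -map_poly_comp.
congr (_.[_]); apply: eq_map_poly => q.
apply: (@mpoly_hom_ext _ _ _ (meval v \o @mwiden n R) (meval (v \o widen))) => [c|i] /=.
  by rewrite mwidenC !mevalC.
by rewrite mwidenX mnmwiden1 !mevalXU.
Qed.

End SplitLastVariable.

(** The field is infinite, so one variable can be specialized at a time. *)
Lemma mpoly_nonroot (k : closedFieldType) n (p : {mpoly k[n]}) :
  p != 0 -> exists v, p.@[v] != 0.
Proof.
elim: n p => [|n IHn] p p0.
  exists (fun=> 0); move: p0; rewrite [p]nvar0_mpolyC mevalC.
  by apply: contraNneq => ->.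
have q0 : muni p != 0.
  by apply: contraNneq p0 => q0; rewrite -(muniK p) q0 raddf0.
have [v' v'0] := IHn (lead_coef (muni p)) ltac:(by rewrite lead_coef_eq0).
have q'0 : map_poly (meval v') (muni p) != 0.
  apply: contraNneq v'0 => /(congr1 (fun q : {poly k} => q`_(size (muni p)).-1)).
  by rewrite coef_map coef0 => /= ->.
have /closed_nonrootP[x] := q'0.
rewrite /root => x0.
pose v (i : 'I_n.+1) := if unlift ord_max i is Some j then v' j else x.
exists v; rewrite meval_muni {2}/v unlift_none.
rewrite (_ : map_poly _ _ = map_poly (meval v') (muni p)) //.
apply: eq_map_poly => q; apply: meval_eq => i /=; rewrite /v.
rewrite (_ : widen_ord _ i = lift ord_max i) ?liftK //.
by apply: val_inj; rewrite /= /bump leqNgt ltn_ord.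
Qed.

(** ** Fractions *)

Lemma fractionP (R : idomainType) (x : {fraction R}) :
  exists n d : R, d != 0 /\ x = FracField.tofrac n / FracField.tofrac d.
Proof.
rewrite -[x]reprK; move: (repr x) => y.
exists (frac y).1, (frac y).2; split; first exact: denom_ratioP.
unlock FracField.tofrac.
rewrite -[X in _ * X]FracField.pi_inv -[RHS]FracField.pi_mul.
rewrite /FracField.mulf /FracField.invf /= !numden_Ratio ?oner_neq0 ?denom_ratioP //.
by rewrite mulr1 mul1r Ratio_numden.
Qed.

Lemma fraction_lift (R : idomainType) (K : fieldType) (f : {rmorphism R -> K}) :
  injective f ->
  exists g : {rmorphism {fraction R} -> K}, forall r, g (FracField.tofrac r) = f r.
Proof.
move=> f_inj; pose tf := @FracField.tofrac R.
have f0 d : d != 0 -> f d != 0 by rewrite -(rmorph0 f) (inj_eq f_inj).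
have tf0 d : d != 0 -> tf d != 0 by rewrite tofrac_eq0.
have ex (x : {fraction R}) :
    exists nd : R * R, nd.2 != 0 /\ x = tf nd.1 / tf nd.2.
  by have [n [d []]] := fractionP x; exists (n, d).
pose nd x := projT1 (cid (ex x)).
have nd0 x : (nd x).2 != 0 by rewrite /nd; case: cid => ? [].
have ndE x : x = tf (nd x).1 / tf (nd x).2 by rewrite /nd; case: cid => ? [].
pose g x := f (nd x).1 / f (nd x).2.
have gE n d : d != 0 -> g (tf n / tf d) = f n / f d.
  move=> d0; rewrite /g; apply/eqP; rewrite eqr_div ?f0 ?nd0 // -!rmorphM.
  apply/eqP; congr (f _); apply/eqP; rewrite -tofrac_eq !tofracM -eqr_div ?tf0 ?nd0 //.
  by rewrite -/tf -ndE.
have gz : zmod_morphism g.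
  move=> x y.
  have -> : x - y = tf ((nd x).1 * (nd y).2 - (nd y).1 * (nd x).2)
                    / tf ((nd x).2 * (nd y).2).
    rewrite {1}(ndE x) {1}(ndE y) -mulNr addf_div ?tf0 ?nd0 //.
    by rewrite /tf tofracB !tofracM mulNr.
  rewrite gE ?mulf_neq0 ?nd0 // rmorphB !rmorphM -mulNr -addf_div ?f0 ?nd0 //.
  by rewrite mulNr.
have gm : monoid_morphism g.
  split=> [|x y].
    by have := gE 1 1 (oner_neq0 _); rewrite /tf tofrac1 !rmorph1 !divr1.
  rewrite {1}(ndE x) {1}(ndE y) mulf_div /tf -!tofracM gE ?mulf_neq0 ?nd0 //.
  by rewrite !rmorphM -mulf_div.
pose gz' := GRing.isZmodMorphism.Build _ _ g gz.
pose gm' := GRing.isMonoidMorphism.Build _ _ g gm.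
pose G : {rmorphism {fraction R} -> K} := HB.pack g gz' gm'.
exists G => r; have := gE r 1 (oner_neq0 _).
by rewrite /tf tofrac1 !rmorph1 !divr1.
Qed.

Definition prime_ideal (M : comNzRingType) (I : M -> Prop) : Prop :=
  [/\ I 0, ~ I 1, forall x y, I x -> I y -> I (x + y),
      forall x y, I y -> I (x * y)
    & forall x y, I (x * y) -> I x \/ I y].

Lemma domain_in_field (D : comNzRingType) :
  (forall x y : D, x * y = 0 -> x = 0 \/ y = 0) ->
  exists (L : fieldType) (f : {rmorphism D -> L}), injective f /\
    forall x, exists n d, f d != 0 /\ x = f n / f d.
Proof.
move=> domD.
pose unit : {pred D} := [pred a | `[< exists b, b * a = 1 >]].
pose inv a : D := if pselect (exists b, b * a = 1) is left ex then projT1 (cid ex) else a.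
have invM : {in unit, left_inverse 1 inv *%R}.
  by move=> a /asboolP ua; rewrite /inv; case: pselect => // ex; case: cid.
have unitPl a b : b * a = 1 -> unit a by move=> ba; apply/asboolP; exists b.
have inv_out : {in [predC unit], inv =1 id}.
  move=> a nua; rewrite /inv; case: pselect => // ex.
  by move: nua; rewrite !inE => /asboolPn; case.
pose U : comUnitRingType := HB.pack D
  (@GRing.ComNzRing_hasMulInverse.Build D unit inv invM unitPl inv_out).
have integral : GRing.integral_domain_axiom U.
  by move=> x y /domD[->|->]; rewrite eqxx ?orbT.
pose A : idomainType := HB.pack D U (GRing.ComUnitRing_isIntegral.Build U integral).
pose F : {rmorphism A -> {fraction A}} := @FracField.tofrac A.
exists {fraction A}, F; split=> [x y /eqP|x]; first by rewrite tofrac_eq => /eqP.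
by have [n [d [d0 ->]]] := fractionP x; exists n, d; rewrite tofrac_eq0.
Qed.

(** The field is the field of fractions of the quotient. *)
Lemma prime_ideal_kernel (M : comNzRingType) (I : M -> Prop) : prime_ideal I ->
  exists (L : fieldType) (f : {rmorphism M -> L}), (forall x, f x = 0 <-> I x) /\
    forall x, exists n d, f d != 0 /\ x = f n / f d.
Proof.
move=> [I0 I1 ID IM Iprime].
pose J : {pred M} := [pred x | `[< I x >]].
have JP x : reflect (I x) (x \in J) by rewrite inE; apply: asboolP.
have Jid : idealr_closed J.
  split; [exact/JP|by apply/JP|move=> a x y /JP Ix /JP Iy; apply/JP].
  by apply: ID => //; apply: IM.
have Jpr : prime_idealr_closed J.
  by move=> x y /JP /Iprime[] /JP ->; rewrite ?orbT.
pose J' : prime_idealr M := HB.pack (J : M -> bool)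
   (isIdealr.Build M J Jid) (isPrimeIdealrClosed.Build M J Jpr).
have dom (x y : {ideal_quot J'}) : x * y = 0 -> x = 0 \/ y = 0.
  by move=> /Quotient.rquot_IdomainAxiom/orP[]/eqP; [left|right].
have [L [f [f_inj f_frac]]] := domain_in_field dom.
pose pr (x : M) : {ideal_quot J'} := \pi x.
have przm : zmod_morphism pr by move=> x y; rewrite /pr !piE.
have prm : monoid_morphism pr by split=> [|x y]; rewrite /pr !piE.
pose Pr : {rmorphism M -> {ideal_quot J'}} := HB.pack pr
  (GRing.isZmodMorphism.Build _ _ pr przm) (GRing.isMonoidMorphism.Build _ _ pr prm).
exists L, (f \o Pr); split=> [x|x] /=; last first.
  have [n [d [d0 ->]]] := f_frac x; exists (repr n), (repr d).
  by rewrite /= /pr !reprK.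
split=> [|Ix].
  rewrite -(rmorph0 f) => /f_inj /eqP.
  by rewrite -(rmorph0 Pr) /= /pr -Quotient.idealrBE subr0 => /JP.
apply/eqP; rewrite -(rmorph0 f) (inj_eq f_inj) -(rmorph0 Pr) /= /pr.
by rewrite -Quotient.idealrBE subr0; apply/JP.
Qed.

(** * Places *)

(** Partial ring morphisms from [K] to [k], defined on a subring. They are given by
    their graphs, for which extension is inclusion and the union of a chain is again a
    partial morphism. *)
Record partial_hom (K k : fieldType) (G : K -> k -> Prop) : Prop := PartialHom {
  ph_fun0 : forall c, G 0 c -> c = 0;
  ph_1 : G 1 1;
  ph_B : forall x y c d, G x c -> G y d -> G (x - y) (c - d);
  ph_M : forall x y c d, G x c -> G y d -> G (x * y) (c * d) }.

(** The domain of a place is a valuation ring, and the elements [x] outside of it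
    are sent to infinity: their inverses have value 0. *)
Definition place (K k : fieldType) (G : K -> k -> Prop) : Prop :=
  partial_hom G /\ forall x, (exists c, G x c) \/ G x^-1 0.

Section PartialHom.
Variables (K k : fieldType) (G : K -> k -> Prop).
Hypothesis hG : partial_hom G.

Lemma ph_fun x c d : G x c -> G x d -> c = d.
Proof.
move=> xc xd; apply/eqP; rewrite -subr_eq0; apply/eqP.
by apply: (ph_fun0 hG); rewrite -(subrr x); apply: ph_B.
Qed.

Lemma ph_0 : G 0 0.
Proof. by rewrite -(subrr 1) -[X in G _ X](subrr 1); apply: (ph_B hG) => //; apply: (ph_1 hG). Qed.

Lemma ph_N x c : G x c -> G (- x) (- c).
Proof. by move=> xc; rewrite -sub0r -[X in G _ X]sub0r; apply: (ph_B hG) => //; apply: ph_0. Qed.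

Lemma ph_D x y c d : G x c -> G y d -> G (x + y) (c + d).
Proof. by move=> xc /ph_N yd; rewrite -(opprK y) -(opprK d); apply: ph_B. Qed.

Lemma ph_sum I (r : seq I) (P : pred I) (F : I -> K) (f : I -> k) :
  (forall i, P i -> G (F i) (f i)) -> G (\sum_(i <- r | P i) F i) (\sum_(i <- r | P i) f i).
Proof. by move=> FG; elim/big_ind2: _ => //; [apply: ph_0 | move=> *; apply: ph_D]. Qed.

Lemma ph_prod I (r : seq I) (P : pred I) (F : I -> K) (f : I -> k) :
  (forall i, P i -> G (F i) (f i)) -> G (\prod_(i <- r | P i) F i) (\prod_(i <- r | P i) f i).
Proof. by move=> FG; elim/big_ind2: _ => //; [apply: (ph_1 hG) | move=> *; apply: (ph_M hG)]. Qed.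

Lemma ph_X x c n : G x c -> G (x ^+ n) (c ^+ n).
Proof.
move=> xc; elim: n => [|n IHn]; first by rewrite !expr0; apply: (ph_1 hG).
by rewrite !exprS; apply: (ph_M hG).
Qed.

Lemma ph_det n (A : 'M[K]_n) (B : 'M[k]_n) :
  (forall i j, G (A i j) (B i j)) -> G (\det A) (\det B).
Proof.
move=> AB; rewrite /determinant; apply: ph_sum => s _; apply: (ph_M hG).
  by apply/ph_X/ph_N/(ph_1 hG).
by apply: ph_prod.
Qed.

Definition ph_poly (p : {poly K}) (q : {poly k}) : Prop := forall i, G p`_i q`_i.

Definition ph_relations (x : K) (q : {poly k}) : Prop :=
  exists p : {poly K}, ph_poly p q /\ p.[x] = 0.

Lemma ph_polyB p q p' q' : ph_poly p q -> ph_poly p' q' -> ph_poly (p - p') (q - q').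
Proof. by move=> pq pq' i; rewrite !coefB; apply: ph_B. Qed.

Lemma ph_polyM p q p' q' : ph_poly p q -> ph_poly p' q' -> ph_poly (p * p') (q * q').
Proof. by move=> pq pq' i; rewrite !coefM; apply: ph_sum => j _; apply: (ph_M hG). Qed.

Lemma ph_polyC x c : G x c -> ph_poly x%:P c%:P.
Proof. by move=> xc i; rewrite !coefC; case: eqP => // _; apply: ph_0. Qed.

Lemma ph_polyX : ph_poly 'X 'X.
Proof. by move=> i; rewrite !coefX; case: eqP => _; [apply: (ph_1 hG) | apply: ph_0]. Qed.

(** A relation with image 1 reads [1 + sum of m_i x ^ i = 0] with all [m_i] of value 0.
    If there were one for [x] and one for its inverse, the first powers of [x] would span
    a nonzero module equal to its product by the maximal ideal. The matrix [A] of these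
    relations reduces to the identity and kills the vector of powers, which is absurd. *)
Lemma ph_relations_inv x : x != 0 -> ph_relations x 1 -> ph_relations x^-1 1 -> False.
Proof.
move=> x0 [p [p1 px]] [q [q1 qx]].
pose n := size p; pose m := size q.
pose N := (n + m).+1.
(* row i is the coefficient vector of a relation of the form x ^ i = ... *)
pose P (i : nat) := if (i < m)%N then 'X^i * p else \poly_(j < i.+1) q`_(i - j).
pose A : 'M[K]_N := \matrix_(i, j) (P i)`_j.
have AG i j : G (A i j) ((1%:M : 'M[k]_N) i j).
  rewrite !mxE /P -val_eqE /=; case: ifP => im.
    rewrite coefXnM; case: ltnP => [|ij].
      by rewrite ltn_neqAle eq_sym => /andP[/negPf -> _]; apply: ph_0.
    by have := p1 (j - i)%N; rewrite coef1 subn_eq0 eqn_leq ij.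
  rewrite coef_poly ltnS; case: leqP => [ji|].
    by have := q1 (i - j)%N; rewrite coef1 subn_eq0 eqn_leq ji andbT.
  by rewrite ltn_neqAle => /andP[/negPf -> _]; apply: ph_0.
have P0 i : (P i).[x] = 0.
  rewrite /P; case: ifPn => [_|]; first by rewrite hornerM px mulr0.
  rewrite -leqNgt => mi; rewrite horner_poly (reindex_inj rev_ord_inj) /=.
  transitivity (x ^+ i * q.[x^-1]); last by rewrite qx mulr0.
  rewrite (@horner_coef_wide _ i.+1) ?(leq_trans mi) //.
  rewrite mulr_sumr; apply: eq_bigr => j _; rewrite subSS.
  have ji : (j <= i)%N by rewrite -ltnS.
  rewrite subKn // exprVn mulrCA; congr (_ * _).
  by apply: expfB_cond; rewrite (negPf x0).
have szP (i : 'I_N) : (size (P i) <= N)%N.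
  rewrite /P; case: ifP => [im|_]; last exact: leq_trans (size_poly _ _) _.
  rewrite (leq_trans (size_polyMleq _ _)) // size_polyXn /= addnC.
  by apply: leq_trans (leqnSn _); rewrite leq_add2l ltnW.
have Av : A *m (\col_j x ^+ j) = 0 :> 'cV_N.
  apply/matrixP => i j; rewrite !mxE; transitivity (P i).[x]; last exact: P0.
  rewrite (horner_coef_wide _ (szP i)).
  by apply: eq_bigr => l _; rewrite !mxE.
have detA : \det A = 0.
  rewrite -det_tr; apply/eqP/det0P; exists (\row_j x ^+ j).
    by apply/eqP => /rowP/(_ ord0); rewrite !mxE expr0 => /eqP; rewrite oner_eq0.
  apply: trmx_inj; rewrite trmx_mul trmxK trmx0 -Av; congr (_ *m _).
  by apply/matrixP => i j; rewrite !mxE.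
have := ph_det AG; rewrite detA det1 => /(ph_fun0 hG) /eqP.
by rewrite oner_eq0.
Qed.
End PartialHom.

(** Extending a partial morphism to [x] amounts to choosing a common root of the
    relations of [x]: they form an ideal of [k[T]], generated by one polynomial. *)
Lemma ph_extend (K : fieldType) (k : closedFieldType) (G : K -> k -> Prop) x :
  partial_hom G -> (forall c, exists y, G y c) -> ~ ph_relations G x 1 ->
  exists G', [/\ partial_hom G', forall y c, G y c -> G' y c & exists c, G' x c].
Proof.
move=> hG surG n1.
have lift r : exists p, ph_poly G p r.
  elim/poly_ind: r => [|r c [p pr]].
    by exists 0 => i; rewrite !coef0; apply: ph_0.
  have [y yc] := surG c; exists (p * 'X + y%:P) => i; rewrite !coefD.
  by apply: (ph_D hG); [apply: ph_polyM => //; apply: ph_polyX|apply: ph_polyC].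
have relB q q' : ph_relations G x q -> ph_relations G x q' -> ph_relations G x (q - q').
  move=> [p [pq px]] [p' [pq' px']]; exists (p - p'); split; first exact: ph_polyB.
  by rewrite hornerD hornerN px px' subrr.
have relM q r : ph_relations G x q -> ph_relations G x (r * q).
  move=> [p [pq px]]; have [u ur] := lift r.
  exists (u * p); split; first exact: ph_polyM.
  by rewrite hornerM px mulr0.
have [a roota] : exists a, forall q, ph_relations G x q -> q.[a] = 0.
  have [[g0 [relg0 g00]]|no] := pselect (exists q, ph_relations G x q /\ q != 0);
    last first.
    exists 0 => q qx; have [->|q0] := eqVneq q 0; first by rewrite horner0.
    by case: no; exists q.
  have ex : exists n, `[< exists q, [/\ ph_relations G x q, q != 0 & size q = n] >].
    by exists (size g0); apply/asboolP; exists g0.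
  case: (ex_minnP ex) => n /asboolP[g [relg g0n0 szg]] minn {g0 relg0 g00 ex}.
  have szg1 : size g != 1.
    apply/negP => /size_poly1P[c c0 gE]; apply: n1.
    by have := relM _ c^-1%:P relg; rewrite gE -polyCM mulVf.
  have [a ra] := closed_rootP g szg1.
  exists a => q relq; rewrite (divp_eq q g) hornerD hornerM (rootP ra) mulr0 add0r.
  have [->|r0] := eqVneq (q %% g) 0; first by rewrite horner0.
  have : (n <= size (q %% g)%R)%N.
    apply/minn/asboolP; exists (q %% g); split => //.
    have -> : q %% g = q - q %/ g * g by rewrite {2}(divp_eq q g) addrC addKr.
    by apply: relB => //; apply: relM.
  by rewrite -szg leqNgt ltn_modp g0n0.
pose G' y c := exists p q, [/\ ph_poly G p q, p.[x] = y & q.[a] = c].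
exists G'; split=> [|y c yc|].
- split=> [c [p [q [pq px <-]]]| |y z c d [p [q [pq <- <-]]] [p' [q' [pq' <- <-]]]|
           y z c d [p [q [pq <- <-]]] [p' [q' [pq' <- <-]]]].
  + by apply: roota; exists p.
  + by exists 1%:P, 1%:P; rewrite !hornerC; split=> //; apply: (ph_polyC hG (ph_1 hG)).
  + by exists (p - p'), (q - q'); rewrite !hornerD !hornerN; split=> //; apply: ph_polyB.
  + by exists (p * p'), (q * q'); rewrite !hornerM; split=> //; apply: ph_polyM.
- by exists y%:P, c%:P; rewrite !hornerC; split=> //; apply: ph_polyC.
- by exists a, 'X, 'X; rewrite !hornerX; split=> //; apply: ph_polyX.
Qed.

(** Chevalley's extension theorem. A maximal extension is a place: if [x] had no value,
    1 would be a relation of [x], and by [ph_relations_inv] not one of its inverse; so the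
    inverse has a value, and clearing denominators in the relation of [x] shows that this
    value is 0. *)
Theorem place_extension (K : fieldType) (k : closedFieldType) (G0 : K -> k -> Prop) :
  partial_hom G0 -> (forall c, exists y, G0 y c) ->
  exists G, place G /\ forall y c, G0 y c -> G y c.
Proof.
move=> hG0 sur0.
pose good (A : set (K * k)) :=
  A = set0 \/ partial_hom (fun x c => A (x, c)) /\ (forall y c, G0 y c -> A (y, c)).
have [F Fgood tot|A [goodA maxA]] := @Zorn_bigcup _ good.
  have [allE|[B FB B0]] : (forall B, F B -> B = set0) \/ exists2 B, F B & B <> set0.
    have [[B [FB B0]]|no] := pselect (exists B, F B /\ B <> set0).
      by right; exists B.
    by left=> B FB; apply: contrapT => B0; apply: no; exists B.
    left; rewrite -subset0 => z [B FB]; rewrite (allE B FB).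
    by [].
  have goodne C : F C -> C <> set0 ->
     partial_hom (fun x c => C (x, c)) /\ (forall y c, G0 y c -> C (y, c)).
    by move=> FC C0; case: (Fgood C FC).
  right; have [hB G0B] := goodne B FB B0.
  have dir x y : (\bigcup_(X in F) X)%classic x -> (\bigcup_(X in F) X)%classic y ->
      exists C, [/\ F C, C x, C y & partial_hom (fun x c => C (x, c))].
    move=> [C FC Cx] [D FD Dy].
    have C0 : C <> set0 by move=> C0; rewrite C0 in Cx.
    have D0 : D <> set0 by move=> D0; rewrite D0 in Dy.
    have [CD|DC] := tot C D FC FD.
      by exists D; split=> //; [apply: CD | apply: (goodne D FD D0).1].
    by exists C; split=> //; [apply: DC | apply: (goodne C FC C0).1].
  split=> [|y c /G0B yc]; last by exists B.
  split=> [c Uc| |x y c d Ux Uy|x y c d Ux Uy].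
  - by have [C [FC C0 _ hC]] := dir _ _ Uc Uc; apply: (ph_fun0 hC).
  - by exists B => //; apply: (ph_1 hB).
  - by have [C [FC Cx Cy hC]] := dir _ _ Ux Uy; exists C => //; apply: (ph_B hC).
  - by have [C [FC Cx Cy hC]] := dir _ _ Ux Uy; exists C => //; apply: (ph_M hC).
have {goodA} [hA G0A] : partial_hom (fun x c => A (x, c)) /\ (forall y c, G0 y c -> A (y, c)).
  case: goodA => // A0; exfalso.
  apply: (maxA (fun xc => G0 xc.1 xc.2)); last by right; split.
  rewrite A0; split; first exact: sub0set.
  by move=> /(_ (1, 1) (ph_1 hG0)).
pose G x c := A (x, c); have {}hA : partial_hom G := hA.
exists G; split=> //; split=> // x.
have surG c : exists y, G y c.
  by have [y yc] := sur0 c; exists y; apply: G0A.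
have mem y : ~ ph_relations G y 1 -> exists c, G y c.
  move=> y1; have [G' [hG' GG' [c yc]]] := ph_extend hA surG y1.
  apply: contrapT => ny; apply: (maxA (fun xc => G' xc.1 xc.2)).
    split=> [[z d] /GG' //|/(_ (y, c) yc) Ayc].
    by apply: ny; exists c.
  by right; split=> // z d /G0A /GG'.
have [->|x0] := eqVneq x 0; first by left; exists 0; apply: (ph_0 hA).
have [x1|/mem] := pselect (ph_relations G x 1); last by left.
right; have [|c xVc] := mem x^-1; first by move=> x1'; apply: (ph_relations_inv hA x0 x1 x1').
suff c0 : c = 0 by rewrite -c0.
(* clear the denominators of the relation of x in terms of its inverse *)
have [p [p1 px]] := x1; pose n := (size p).+1.
have pE : \sum_(i < n) p`_i * x^-1 ^+ (n.-1 - i) = 0.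
  transitivity (x^-1 ^+ n.-1 * p.[x]); last by rewrite px mulr0.
  rewrite (@horner_coef_wide _ n) ?leqnSn // mulr_sumr.
  apply: eq_bigr => i _; rewrite mulrCA; congr (_ * _).
  have i_n : (i <= n.-1)%N by rewrite -ltnS.
  by rewrite -{2}(subnK i_n) exprD -mulrA -exprMn mulVf // expr1n mulr1.
have : G 0 (\sum_(i < n) (1 : {poly k})`_i * c ^+ (n.-1 - i)).
  by rewrite -pE; apply: (ph_sum hA) => i _; apply: (ph_M hA) => //; apply: (ph_X hA).
move=> /(ph_fun0 hA); rewrite big_ord_recl /= big1 => [|i _]; last by rewrite coef1 mul0r.
by rewrite coef1 /= mul1r addr0 subn0 => /eqP; rewrite expf_eq0 => /andP[_ /eqP].
Qed.

(** * Completely integrally closed domains and minimal polynomials *)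

(** Complete integral closedness: a fraction [P / Q] whose powers have a common
    denominator [g] lies in [R]. Unlike integral closedness, it passes to polynomial rings
    by looking at leading coefficients only. *)
Definition cic (R : idomainType) : Prop := forall P Q g : R, Q != 0 -> g != 0 ->
  (forall n, exists r, g * P ^+ n = r * Q ^+ n) -> exists r, P = r * Q.

Lemma dvdp_powers (F : fieldType) (P Q g : {poly F}) : Q != 0 -> g != 0 ->
  (forall n, Q ^+ n %| g * P ^+ n) -> Q %| P.
Proof.
move=> Q0 g0 QP; pose d := gcdp P Q.
have d0 : d != 0 by rewrite gcdp_eq0 negb_and Q0 orbT.
have PE : P = P %/ d * d by rewrite divpK ?dvdp_gcdl.
have QE : Q = Q %/ d * d by rewrite divpK ?dvdp_gcdr.
have cop : coprimep (P %/ d) (Q %/ d) by rewrite coprimep_div_gcd ?Q0 ?orbT.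
have Qg n : (Q %/ d) ^+ n %| g.
  have := QP n; rewrite {1}QE [in g * _]PE !exprMn mulrA dvdp_mul2r ?expf_neq0 //.
  by rewrite Gauss_dvdpl // coprimep_expl // coprimep_expr // coprimep_sym.
have sz1 : size (Q %/ d) == 1.
  rewrite eqn_leq size_poly_gt0 andbC; apply/andP; split.
    by apply: contraNneq Q0 => e; rewrite QE e mul0r.
  rewrite leqNgt; apply/negP => sz.
  have := dvdp_leq g0 (Qg (size g)).
  have n0 : Q %/ d != 0 by rewrite -size_poly_gt0 ltnW.
  rewrite leqNgt; move/negP; apply.
  have sz0 : (0 < size ((Q %/ d) ^+ size g))%N by rewrite size_poly_gt0 expf_neq0.
  rewrite -(prednK sz0) size_exp ltnS.
  by rewrite leq_pmull // -subn1 subn_gt0.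
have /size_poly1P[c c0 Qc] := sz1.
by rewrite QE Qc mul_polyC dvdpZl // dvdp_gcdl.
Qed.

Section Fractions.
Variables (R : idomainType) (F : fieldType) (f : {rmorphism R -> F}).
Hypothesis f_inj : injective f.
Hypothesis f_frac : forall x : F, exists n d : R, d != 0 /\ x = f n / f d.

(** The leading coefficient of [p] is a fraction whose powers have the common
    denominator [lead_coef g]; subtract the leading term and repeat. *)
Lemma cic_poly_coef (p : {poly F}) (g : {poly R}) : cic R -> g != 0 ->
  (forall n, exists q, map_poly f g * p ^+ n = map_poly f q) ->
  exists q, p = map_poly f q.
Proof.
move=> cicR g0; have [m] := ubnP (size p); elim: m p => // m IHm p.
rewrite ltnS => szp pow; have [->|p0] := eqVneq p 0; first by exists 0; rewrite rmorph0.
have f0 d : d != 0 -> f d != 0 by rewrite -(rmorph0 f) (inj_eq f_inj).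
have [a [b [b0 lcE]]] := f_frac (lead_coef p).
have [r ar] : exists r, a = r * b.
  apply: (cicR a b (lead_coef g)) => //; first by rewrite lead_coef_eq0.
  move=> n; have [q /(congr1 lead_coef) e] := pow n; exists (lead_coef q).
  move: e; rewrite lead_coefM lead_coef_exp !lead_coef_map_inj ?rmorph0 // lcE => e.
  apply: f_inj; rewrite !rmorphM !rmorphXn -e expr_div_n -mulrA divfK //.
  by rewrite expf_neq0 ?f0.
have lcr : lead_coef p = f r by rewrite lcE ar rmorphM mulfK ?f0.
pose s := map_poly f (- r *: 'X^((size p).-1)).
have [q' q'E] : exists q, p + s = map_poly f q.
  apply: IHm.
    rewrite /s map_polyZ map_polyXn rmorphN scaleNr -lcr.
    apply: leq_trans szp; rewrite -(prednK (_ : 0 < size p)%N) ?size_poly_gt0 // ltnS.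
    apply/leq_sizeP => j; rewrite leq_eqVlt => /orP[/eqP <-|lt_j].
      by rewrite coefB coefZ coefXn eqxx mulr1 lead_coefE subrr.
    rewrite coefB coefZ coefXn gtn_eqF // mulr0 subr0 nth_default //.
    by rewrite (leq_trans (leqSpred _)).
  move=> n; pose w i := projT1 (cid (pow i)).
  have wE i : map_poly f g * p ^+ i = map_poly f (w i) by rewrite /w; case: cid.
  exists (\sum_(i < n.+1) (w (n - i)%N * (- r *: 'X^((size p).-1)) ^+ i) *+ 'C(n, i)).
  rewrite exprDn mulr_sumr rmorph_sum; apply: eq_bigr => i _.
  by rewrite rmorphMn rmorphM rmorphXn /= -/s -wE mulrnAr mulrA.
exists (q' - (- r *: 'X^((size p).-1))).
by rewrite rmorphB /= -q'E addrK.
Qed.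

End Fractions.

(** Over the field of fractions of [R], [Q] divides [P], since otherwise all powers of a
    nonconstant factor of [Q] would divide [g]; the quotient has its coefficients in [R]
    by [cic_poly_coef]. *)
Lemma cic_poly (R : idomainType) : cic R -> cic {poly R}.
Proof.
move=> cicR P Q g Q0 g0 pow; pose f : {rmorphism R -> {fraction R}} := @FracField.tofrac R.
have f_inj : injective f by move=> x y /eqP; rewrite tofrac_eq => /eqP.
have map_inj : injective (map_poly f) by apply: map_inj_poly => //; apply: rmorph0.
have m0 p : p != 0 -> map_poly f p != 0.
  by rewrite -(rmorph0 (map_poly f)) (inj_eq map_inj).
have /dvdpP[p pE] : map_poly f Q %| map_poly f P.
  apply: (@dvdp_powers _ _ _ (map_poly f g)); rewrite ?m0 // => n.
  have [r rE] := pow n; apply/dvdpP; exists (map_poly f r).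
  by rewrite -!rmorphXn -!rmorphM rE.
have [q qE] : exists q, p = map_poly f q.
  apply: (cic_poly_coef f_inj (@fractionP R) cicR g0) => n.
  have [r rE] := pow n; exists r.
  apply: (mulIf (_ : map_poly f Q ^+ n != 0)); first by rewrite expf_neq0 ?m0.
  by rewrite -mulrA -exprMn -pE -!rmorphXn -!rmorphM rE.
by exists q; apply: map_inj; rewrite rmorphM /= -qE.
Qed.

Lemma cic_mpoly (F : fieldType) n : cic {mpoly F[n]}.
Proof.
elim: n => [|n IHn] P Q g Q0 g0 pow.
  have Qc : Q@_0%MM != 0.
    by apply: contraNneq Q0 => Q0; rewrite [Q]nvar0_mpolyC Q0.
  exists ((P@_0%MM / Q@_0%MM)%:MP); rewrite {2}[Q]nvar0_mpolyC -mpolyCM.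
  by rewrite divfK // -nvar0_mpolyC.
have m0 (p : {mpoly F[n.+1]}) : p != 0 -> muni p != 0.
  by move=> p0; rewrite -(muni0 n F) (can_eq (@muniK F n)).
have [r rE] : exists r, muni P = r * muni Q.
  apply: (cic_poly IHn (m0 _ Q0) (m0 _ g0)) => m.
  have [r /(congr1 (@muni n F)) rE] := pow m; exists (muni r); move: rE.
  rewrite !muniM.
  by rewrite (rmorphXn (@muni n F) m P) (rmorphXn (@muni n F) m Q).
by exists (mmerge r); apply: (can_inj (@muniK F n)); rewrite rmorphM /= mmergeK.
Qed.

Lemma common_denominator (R : idomainType) (F : fieldType) (f : {rmorphism R -> F})
    (J : finType) (x : J -> F) :
  injective f -> (forall x : F, exists n d : R, d != 0 /\ x = f n / f d) ->
  exists2 g : R, g != 0 & forall j, exists r, f g * x j = f r.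
Proof.
move=> f_inj f_frac.
have f0 d : d != 0 -> f d != 0 by rewrite -(rmorph0 f) (inj_eq f_inj).
have ex j : exists nd : R * R, nd.2 != 0 /\ x j = f nd.1 / f nd.2.
  by have [n [d []]] := f_frac (x j); exists (n, d).
pose nd j := projT1 (cid (ex j)).
have ndP j : (nd j).2 != 0 /\ x j = f (nd j).1 / f (nd j).2 by rewrite /nd; case: cid.
exists (\prod_j (nd j).2).
  by apply/prodf_neq0 => j _; have [] := ndP j.
move=> j; exists ((\prod_(i | i != j) (nd i).2) * (nd j).1).
have [d0 ->] := ndP j.
by rewrite (bigD1 j) //= !rmorphM mulrC -!mulrA mulKf ?f0 // mulrC.
Qed.

(** The characteristic polynomial of a matrix that is integral over a completely
    integrally closed domain has its coefficients there: the powers of the matrix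
    have a common denominator, hence so have those of ['X - A] and of its
    determinant. *)
Lemma char_poly_integral (R : idomainType) (F : fieldType) (f : {rmorphism R -> F})
    n (A : 'M[F]_n.+1) (P : {poly R}) :
  injective f -> (forall x : F, exists n d : R, d != 0 /\ x = f n / f d) -> cic R ->
  P \is monic -> horner_mx A (map_poly f P) = 0 ->
  exists q, char_poly A = map_poly f q.
Proof.
move=> f_inj f_frac cicR monP PA.
pose int g := forall j : nat, exists B : 'M[R]_n.+1, f g *: A ^+ j = map_mx f B.
have [g g0 gA] : exists2 g, g != 0 & int g.
  pose x (t : 'I_(size P) * ('I_n.+1 * 'I_n.+1)) := (A ^+ t.1) t.2.1 t.2.2.
  have [g g0 gx] := common_denominator x f_inj f_frac.
  exists g => // j.
  have gA (i : 'I_(size P)) : exists B : 'M[R]_n.+1, f g *: A ^+ i = map_mx f B.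
    pose B := \matrix_(a, b) projT1 (cid (gx (i, (a, b)))).
    by exists B; apply/matrixP => a b; rewrite !mxE; case: cid => r /=.
  pose r := Pdiv.CommonRing.rmodp 'X^j P.
  have rE : A ^+ j = \sum_(i < size P) f r`_i *: A ^+ i.
    have XE : horner_mx A (map_poly f 'X^j) = A ^+ j.
      by rewrite map_polyXn rmorphXn /= horner_mx_X.
    rewrite -XE (Pdiv.RingMonic.rdivp_eq monP 'X^j) rmorphD rmorphM /=.
    rewrite rmorphD rmorphM /= PA mulr0 add0r -/r.
    have szr : (size (map_poly f r) <= size P)%N.
      by rewrite size_map_inj_poly ?rmorph0 // ltnW // Pdiv.CommonRing.ltn_rmodpN0 // monic_neq0.
    rewrite -[map_poly f r]coefK (poly_def) rmorph_sum /=.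
    rewrite (big_ord_widen _ (fun i => horner_mx A ((map_poly f r)`_i *: 'X^i)) szr).
    rewrite big_mkcond /=; apply: eq_bigr => i _.
    rewrite -mul_polyC rmorphM /= horner_mx_C rmorphXn /= horner_mx_X -mulmxE mul_scalar_mx coef_map.
    by case: ltnP => // szi; rewrite -(coef_map f) nth_default // scale0r.
  pose B i := projT1 (cid (gA i)).
  exists (\sum_(i < size P) r`_i *: B i).
  rewrite rE scaler_sumr map_mx_sum; apply: eq_bigr => i _.
  rewrite scalerA mulrC -scalerA map_mxZ; congr (_ *: _).
  by rewrite /B; case: cid.
apply: (cic_poly_coef f_inj f_frac cicR (_ : (g ^+ n.+1)%:P != 0)) => [|j].
  by rewrite polyC_eq0 expf_neq0.
have [B BE] : exists B, (f g)%:P *: char_poly_mx A ^+ j = map_mx (map_poly f) B.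
  pose C i := projT1 (cid (gA i)).
  have CE i : f g *: A ^+ i = map_mx f (C i) by rewrite /C; case: cid.
  exists (\sum_(i < j.+1) (((-1) ^+ i * 'X^(j - i)) *: map_mx polyC (C i)) *+ 'C(j, i)).
  rewrite /char_poly_mx exprBn_comm; last exact: comm_scalar_mx.
  rewrite scaler_sumr map_mx_sum; apply: eq_bigr => i _.
  rewrite -scalerMnr raddfMn /= map_mxZ; congr (_ *+ _).
  have -> : (-1) ^+ i * 'X%:M ^+ (j - i) = ((-1) ^+ i * 'X^(j - i))%:M :> 'M[{poly F}]_n.+1.
    by rewrite [RHS]rmorphM /= !rmorphXn /= rmorphN1.
  rewrite -[_%:M * _]/(_%:M *m _) mul_scalar_mx scalerA mulrC -scalerA.
  congr (_ *: _).
    by rewrite rmorphM /= rmorphXn rmorphN1 map_polyXn.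
  transitivity (map_mx polyC (map_mx f (C i))); last first.
    by apply/matrixP => a b; rewrite !mxE /= map_polyC.
  by rewrite -CE map_mxZ rmorphXn.
exists (\det B); rewrite -det_map_mx -BE detZ map_polyC; congr (_ * _).
  by rewrite -polyC_exp; congr (_%:P); apply: rmorphXn.
by elim: j {B BE} => [|j IHj]; rewrite ?expr0 ?det1 // !exprS det_mulmx IHj.
Qed.

(** An integral element over a completely integrally closed domain has a minimal
    polynomial with coefficients there: the one over the field of fractions is the
    characteristic polynomial of its companion matrix, which is integral because
    it is a zero of any monic relation. *)
Lemma integral_minpoly (R : idomainType) (K : fieldType) (f : {rmorphism R -> K}) s :
  injective f -> cic R -> integralOver f s ->
  exists X : {poly R}, [/\ X \is monic, root (map_poly f X) s &
    forall P, root (map_poly f P) s -> exists Q, P = X * Q].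
Proof.
move=> f_inj cicR [P0 monP0 rootP0].
pose tf : {rmorphism R -> {fraction R}} := @FracField.tofrac R.
have tf_inj : injective tf by move=> x y /eqP; rewrite tofrac_eq => /eqP.
have [F FE] := fraction_lift f_inj.
have mapE P : map_poly F (map_poly tf P) = map_poly f P.
  by rewrite -map_poly_comp; apply: eq_map_poly => x /=; rewrite FE.
pose rel (m : {poly {fraction R}}) := root (map_poly F m) s.
have ex : exists n, `[< exists m, [/\ m \is monic, rel m & size m = n] >].
  exists (size (map_poly tf P0)); apply/asboolP; exists (map_poly tf P0).
  by rewrite /rel mapE monic_map.
case: (ex_minnP ex) => n /asboolP[m [monm relm szm]] minn {ex}.
have m0 : m != 0 by rewrite monic_neq0.
have dvd P : rel P -> m %| P.
  move=> relP; rewrite /dvdp; apply: contraT => r0.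
  have relr : rel (P %% m).
    move: relP; rewrite /rel {1}(divp_eq P m) rmorphD rmorphM /= /root hornerD hornerM.
    by rewrite (eqP relm) mulr0 add0r.
  have lc0 : (lead_coef (P %% m))^-1 != 0 by rewrite invr_eq0 lead_coef_eq0.
  have : (n <= size (P %% m)%R)%N.
    apply/minn/asboolP; exists ((lead_coef (P %% m))^-1 *: (P %% m)); split.
    - by rewrite monicE lead_coefZ mulVf // lead_coef_eq0.
    - by rewrite /rel map_polyZ /root hornerZ (eqP relr) mulr0.
    - by rewrite size_scale.
  by rewrite -szm leqNgt ltn_modp m0.
have [n' [A charA]] : exists n' (A : 'M[{fraction R}]_n'.+1), char_poly A = m.
  have szm1 : (1 < size m)%N.
    rewrite ltn_neqAle eq_sym size_poly_gt0 m0 andbT; apply/eqP => sz1.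
    have /size_poly1P[c c0 mE] : size m == 1 by rewrite sz1.
    move: relm; rewrite /rel mE map_polyC rootC fmorph_eq0; exact/negP.
  have := companionmxK monm; move: (companionmx m).
  rewrite -(prednK (_ : 0 < (size m).-1)%N) => [A <-|]; first by exists _, A.
  by rewrite -subn1 subn_gt0.
have [X XE] : exists q, char_poly A = map_poly tf q.
  apply: (char_poly_integral tf_inj (@fractionP R) cicR monP0).
  have /dvdpP[q ->] : m %| map_poly tf P0 by apply: dvd; rewrite /rel mapE.
  by rewrite rmorphM /= -charA Cayley_Hamilton mulr0.
rewrite charA in XE.
have monX : X \is monic by rewrite monicE -(inj_eq tf_inj) -lead_coef_map_inj ?rmorph0 // -XE rmorph1 -monicE.
exists X; split => //; first by rewrite -mapE -XE.
move=> P rootP; exists (Pdiv.CommonRing.rdivp P X).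
rewrite {1}(Pdiv.RingMonic.rdivp_eq monX P) mulrC.
suff -> : Pdiv.CommonRing.rmodp P X = 0 by rewrite addr0.
apply: (map_inj_poly tf_inj (rmorph0 _)); rewrite rmorph0.
apply/eqP; apply: contraT => r0.
have /dvdp_leq : m %| map_poly tf (Pdiv.CommonRing.rmodp P X).
  have -> : map_poly tf (Pdiv.CommonRing.rmodp P X) = map_poly tf P - map_poly tf (Pdiv.CommonRing.rdivp P X) * m.
    by rewrite {2}(Pdiv.RingMonic.rdivp_eq monX P) XE rmorphD rmorphM addrC addKr.
  by rewrite dvdp_sub ?dvdp_mull //; apply: dvd; rewrite /rel mapE.
move/(_ r0); rewrite XE !size_map_inj_poly ?rmorph0 // leqNgt.
by rewrite Pdiv.CommonRing.ltn_rmodpN0 // monic_neq0.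
Qed.

(** * Finite modules and integral dependence *)

(** Integrality by the determinant trick: [x] multiplies the [R]-span of the finite
    family [v] into itself. Control of the entries of the matrix, through [I], is what
    gives control of the coefficients of the monic relation of [x]. *)
Definition stabilizes (R : comNzRingType) (K : fieldType) (f : R -> K) (J : finType)
    (v : J -> K) (I : R -> Prop) (x : K) : Prop :=
  exists B : J -> J -> R, (forall a b, I (B a b)) /\
    forall a, x * v a = \sum_b f (B a b) * v b.

Section Stable.
Variables (R : comNzRingType) (K : fieldType) (f : {rmorphism R -> K}).
Variables (J : finType) (v : J -> K).
Local Notation stable := (stabilizes f v (fun=> True)).

Lemma stabilizesD (I : R -> Prop) x y : (forall a b, I a -> I b -> I (a + b)) ->
  stabilizes f v I x -> stabilizes f v I y -> stabilizes f v I (x + y).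
Proof.
move=> ID [B [IB xB]] [C [IC yC]]; exists (fun a b => B a b + C a b).
split=> [a b|a]; first exact: ID.
by rewrite mulrDl xB yC -big_split; apply: eq_bigr => b _; rewrite rmorphD mulrDl.
Qed.

Lemma stabilizesM x y : stable x -> stable y -> stable (x * y).
Proof.
move=> [B [_ xB]] [C [_ yC]]; exists (fun a b => \sum_c C a c * B c b).
split=> // a; rewrite -mulrA yC mulr_sumr.
transitivity (\sum_c \sum_b f (C a c) * (f (B c b) * v b)).
  by apply: eq_bigr => c _; rewrite mulrCA xB mulr_sumr.
rewrite exchange_big; apply: eq_bigr => b _; rewrite rmorph_sum mulr_suml.
by apply: eq_bigr => c _; rewrite rmorphM mulrA.
Qed.

Lemma stabilizesZ (I : R -> Prop) r x : (forall a b, I a -> I (a * b)) ->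
  I r -> stable x -> stabilizes f v I (f r * x).
Proof.
move=> IM Ir [B [_ xB]]; exists (fun a b => r * B a b); split=> [a b|a]; first exact: IM.
by rewrite -mulrA xB mulr_sumr; apply: eq_bigr => b _; rewrite rmorphM mulrA.
Qed.

Lemma stabilizes1 : stable 1.
Proof.
exists (fun a b => (a == b)%:R); split=> // a; rewrite mul1r (bigD1 a) //= eqxx rmorph1 mul1r.
by rewrite big1 ?addr0 // => b /negPf; rewrite eq_sym => ->; rewrite rmorph0 mul0r.
Qed.

Lemma stabilizes_scalar r : stable (f r).
Proof. by rewrite -[f r]mulr1; apply: stabilizesZ => //; apply: stabilizes1. Qed.

Lemma stabilizes_char_poly (S : comNzRingType) (e : {rmorphism R -> S}) j0 x :
  v j0 != 0 -> stabilizes f v (fun r => e r = 0) x ->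
  exists n P, [/\ root (map_poly f P) x & map_poly e P = 'X^n].
Proof.
move=> v0 [B [eB xB]].
pose A : 'M[R]_#|J| := \matrix_(i, j) B (enum_val j) (enum_val i).
exists #|J|, (char_poly A); split.
  rewrite map_char_poly -eigenvalue_root_char; apply/eigenvalueP.
  exists (\row_j v (enum_val j)).
    apply/rowP => j; rewrite !mxE xB (reindex_onto (@enum_val J J) enum_rank) /=.
      by apply: eq_big => [i|i _]; rewrite ?enum_valK ?eqxx // !mxE mulrC.
    by move=> i _; rewrite enum_rankK.
  apply: contraNneq v0 => /rowP/(_ (enum_rank j0)); rewrite !mxE enum_rankK.
  by move=> ->.
have A0 : map_mx e A = 0 by apply/matrixP => i j; rewrite !mxE eB.
rewrite map_char_poly A0 char_poly_trig ?mx0_is_trig //.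
rewrite (eq_bigr (fun=> 'X)) ?prodr_const ?card_ord // => i _.
by rewrite mxE subr0.
Qed.

End Stable.

(** The products of powers of the elements of [s], with exponents below the degrees of
    their monic relations, span a module stable under all of them. *)
Lemma integral_stabilizes (R : comNzRingType) (K : fieldType) (f : {rmorphism R -> K})
    (s : seq K) : (forall z, z \in s -> integralOver f z) ->
  exists (J : finType) (v : J -> K) (j0 : J), v j0 = 1 /\
    forall z, z \in s -> stabilizes f v (fun=> True) z.
Proof.
elim: s => [|z s IHs] ints.
  by exists unit, (fun=> 1), tt.
have [y ys|J [v [j0 [v0 vs]]]] := IHs; first by apply: ints; rewrite inE ys orbT.
have [P monP rootP] := ints z (mem_head _ _).
have szP : (1 < size P)%N.
  rewrite ltn_neqAle eq_sym size_poly_gt0 monic_neq0 // andbT.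
  apply: contraTneq rootP => /eqP/size_poly1P[c c0 PE].
  have c1 : c = 1 by apply/eqP; rewrite -(monicP monP) PE lead_coefC.
  by rewrite PE c1 rmorph1 rootC oner_eq0.
pose m := (size P).-2; have mE : size P = m.+2 by rewrite /m; case: (size P) szP => [|[]].
exists (J * 'I_m.+1)%type, (fun ji : J * 'I_m.+1 => v ji.1 * z ^+ ji.2), (j0, ord0).
rewrite v0 expr0 mulr1; split=> // y; rewrite inE => /orP[/eqP -> {y}|ys]; last first.
  have [B [_ yB]] := vs y ys.
  exists (fun a b : J * 'I_m.+1 => if a.2 == b.2 then B a.1 b.1 else 0); split=> // -[a i] /=.
  rewrite mulrA yB mulr_suml.
  rewrite -(pair_bigA _ (fun b j => f (if i == j then B a b else 0) * (v b * z ^+ j))) /=.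
  apply: eq_bigr => b _; rewrite (bigD1 i) //= eqxx -mulrA big1 ?addr0 //.
  by move=> j /negPf; rewrite eq_sym => ->; rewrite rmorph0 mul0r.
have zm : z ^+ m.+1 = \sum_(j < m.+1) f (- P`_j) * z ^+ j.
  move: rootP; rewrite /root horner_coef size_map_poly_id0 ?mE; last first.
    by rewrite (monicP monP) rmorph1 oner_eq0.
  rewrite big_ord_recr /= coef_map /= (_ : P`_m.+1 = 1); last first.
    by rewrite -(monicP monP) lead_coefE mE.
  rewrite rmorph1 mul1r addrC addr_eq0 => /eqP ->; rewrite -sumrN.
  by apply: eq_bigr => j _; rewrite coef_map rmorphN mulNr.
pose C (i j : 'I_m.+1) := if (i < m)%N then (nat_of_ord j == i.+1)%:R else - P`_j.
exists (fun a b : J * 'I_m.+1 => if a.1 == b.1 then C a.2 b.2 else 0); split=> // -[a i] /=.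
rewrite -(pair_bigA _ (fun b j => f (if a == b then C i j else 0) * (v b * z ^+ j))) /=.
rewrite (bigD1 a) //= [X in _ + X]big1 ?addr0; last first.
  by move=> b /negPf ab; apply: big1 => j _; rewrite eq_sym ab rmorph0 mul0r.
rewrite eqxx mulrCA -exprS.
transitivity (v a * \sum_j f (C i j) * z ^+ j); last first.
  by rewrite mulr_sumr; apply: eq_bigr => j _; rewrite mulrCA.
congr (_ * _); rewrite /C; case: ltnP => im.
  rewrite (bigD1 (Ordinal (im : i.+1 < m.+1)%N)) //= eqxx rmorph1 mul1r big1 ?addr0 //.
  by move=> j /eqP ji; rewrite (_ : _ == _ = false) ?rmorph0 ?mul0r //;
     apply/eqP => e; apply: ji; apply: val_inj.
by rewrite -zm; congr (_ ^+ _.+1); apply/eqP; rewrite eqn_leq im -ltnS ltn_ord.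
Qed.

(** * Noether normalization *)

Lemma mpoly_ind_hom (k : comNzRingType) n (P : {mpoly k[n]} -> Prop) :
  (forall c, P c%:MP) -> (forall i, P 'X_i) ->
  (forall p q, P p -> P q -> P (p + q)) -> (forall p q, P p -> P q -> P (p * q)) ->
  forall p, P p.
Proof.
move=> PC PX PD PM p; rewrite (mpolyE p).
elim/big_ind: _ => [||m _]; [by rewrite -mpolyC0; apply: PC|by []|].
rewrite -mul_mpolyC; apply: (PM) => //; rewrite mpolyXE_id.
elim/big_ind: _ => [||i _]; [by rewrite -mpolyC1; apply: PC|exact: PM|].
elim: (m i) => [|e IHe]; first by rewrite expr0 -mpolyC1; apply: PC.
by rewrite exprS; apply: PM.
Qed.

Lemma mpoly_hom (R S : comNzRingType) n (f : {rmorphism R -> S}) (x : 'I_n -> S) :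
  exists g : {rmorphism {mpoly R[n]} -> S},
    (forall c, g c%:MP = f c) /\ (forall i, g 'X_i = x i).
Proof.
by exists (mmap f x); split=> [c|i]; rewrite /= ?mmapC // mmapX mmap1U.
Qed.

Definition has_top (R : nzRingType) (P : {poly R}) n a : Prop :=
  (size P <= n.+1)%N /\ P`_n = a.

Lemma has_topM (R : comNzRingType) (P Q : {poly R}) n m a b :
  has_top P n a -> has_top Q m b -> has_top (P * Q) (n + m) (a * b).
Proof.
move=> [szP <-] [szQ <-]; split.
  by rewrite (leq_trans (size_polyMleq _ _)) //; lia.
have nm : (n < (n + m).+1)%N by rewrite ltnS leq_addr.
rewrite coefM (bigD1 (Ordinal nm)) //= addKn big1 ?addr0 // => i /eqP i_n.
case: (ltngtP i n) => [lt_in|lt_ni|e]; last by case: i_n; apply: val_inj.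
  by rewrite [Q`__]nth_default ?mulr0 // (leq_trans szQ) //; lia.
by rewrite nth_default ?mul0r // (leq_trans szP).
Qed.

Lemma has_top_monom (R : comNzRingType) n r (u : 'I_r -> {poly R}) (c : 'I_r -> R)
    (m : 'X_{1..r}) : (forall i, has_top (u i) 1 (c i)) -> n = mdeg m ->
  has_top (\prod_i u i ^+ m i) n (\prod_i c i ^+ m i).
Proof.
move=> uc ->; rewrite mdegE.
elim/big_ind3: _ => [|P n1 a Q n2 b|i _]; [|exact: has_topM|].
  by split; rewrite ?size_poly1 ?coef1.
elim: (m i) => [|e IHe]; first by split; rewrite ?size_poly1 ?coef1.
by rewrite !exprS -add1n; apply: has_topM.
Qed.

(** A relation [F] between the variables makes one of them integral over the others
    after a shear of coordinates: in [F (u + c T)], where [u] omits one coordinate,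
    the coefficient of the top power of [T] is the value at [c] of the homogeneous
    part of [F] of top degree, nonzero for a suitable [c]. *)
Lemma shear_top (k : closedFieldType) r (F : {mpoly k[r.+1]}) : F != 0 ->
  exists (c : 'I_r.+1 -> k) (a : k), [/\ c ord0 != 0, a != 0 &
    forall th : {rmorphism {mpoly k[r.+1]} -> {poly {mpoly k[r]}}},
      (forall b, th b%:MP = b%:MP%:P) ->
      (forall i, has_top (th 'X_i) 1 (c i)%:MP) ->
      has_top (th F) (msize F).-1 a%:MP].
Proof.
move=> F0; pose D := (msize F).-1.
pose T := \sum_(m <- msupp F | mdeg m == D) F@_m *: 'X_[m].
have T0 : T != 0.
  apply: contraNneq (F0) => /(congr1 (mcoeff (mlead F))).
  rewrite raddf_sum /= mcoeff0 big_mkcond (bigD1_seq (mlead F)) ?mlead_supp ?msupp_uniq //=.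
  rewrite /D -(mlead_deg F0) eqxx mcoeffZ mcoeffX eqxx mulr1 big1 ?addr0 => [/eqP|m /negPf mF].
    by rewrite mleadc_eq0.
  by case: ifP => // _; rewrite mcoeffZ mcoeffX mF mulr0.
have X0 : ('X_ord0 : {mpoly k[r.+1]}) != 0 by rewrite -msupp_eq0 msuppX.
have [c] := mpoly_nonroot (mulf_neq0 T0 X0).
rewrite mevalM mulf_eq0 negb_or mevalXU => /andP[Tc c0].
exists c, T.@[c]; split=> // th thC thX.
pose top m := if mdeg m == D then F@_m * \prod_i c i ^+ m i else 0.
have -> : T.@[c] = \sum_(m <- msupp F) top m.
  rewrite /T big_mkcond raddf_sum; apply: eq_bigr => m _.
  by rewrite /top; case: eqP => //= _; rewrite ?meval0 // mevalZ mevalX.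
rewrite [X in has_top _ _ X]raddf_sum /=.
rewrite {1}(mpolyE F) rmorph_sum /= -/D.
have topm m : m \in msupp F -> has_top (th (F@_m *: 'X_[m])) D (top m)%:MP.
  move=> mF; rewrite -mul_mpolyC rmorphM /= thC mpolyXE_id rmorph_prod /=.
  under eq_bigr do rewrite rmorphXn /=.
  have [szm cm] := has_top_monom thX (erefl (mdeg m)).
  have mD : (mdeg m <= D)%N.
    by have := msize_mdeg_lt mF; rewrite /D; case: (msize F).
  split; first by rewrite mul_polyC (leq_trans (size_scale_leq _ _)) // (leq_trans szm).
  rewrite coefCM /top; case: eqP => [<-|/eqP ne].
    by rewrite cm mpolyCM rmorph_prod; congr (_ * _); apply: eq_bigr => i _; rewrite rmorphXn.
  by rewrite nth_default ?mulr0 ?mpolyC0 // (leq_trans szm) // ltn_neqAle ne.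
rewrite !big_seq; elim/big_ind2: _ => [|P a Q b [sP <-] [sQ <-]|m mF]; last exact: topm.
  by split; rewrite ?size_poly0 ?coef0.
by split; rewrite ?coefD // (leq_trans (size_polyD _ _)) // geq_max sP.
Qed.

Lemma integral_mpoly (k R : comNzRingType) (K : fieldType) r
    (zeta : {rmorphism {mpoly k[r]} -> K}) (f : {rmorphism R -> K}) :
  (forall c, integralOver f (zeta c%:MP)) -> (forall i, integralOver f (zeta 'X_i)) ->
  forall p, integralOver f (zeta p).
Proof.
move=> intC intX; apply: mpoly_ind_hom => // p q intp intq.
  by rewrite rmorphD; apply: integral_add.
by rewrite rmorphM; apply: integral_mul.
Qed.

(** By induction on the number of variables: when [zeta] is not injective, a shear makes
    one variable integral over the [r] others, whose values generate the image of
    [zeta']. *)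
Theorem noether_normalization (k : closedFieldType) (K : fieldType) r
    (zeta : {rmorphism {mpoly k[r]} -> K}) :
  exists d (eta : {rmorphism {mpoly k[d]} -> {mpoly k[r]}}),
    [/\ forall c, eta c%:MP = c%:MP, injective (zeta \o eta) &
        forall p, integralOver (zeta \o eta) (zeta p)].
Proof.
elim: r zeta => [|r IHr] zeta.
  exists 0%N, idfun; split=> // [p q|p]; last exact: integral_id.
  have zi : injective (zeta \o @mpolyC 0 k) by apply: fmorph_inj.
  move=> e; rewrite (nvar0_mpolyC p) (nvar0_mpolyC q); congr (_%:MP); apply: zi.
  by rewrite /= -!nvar0_mpolyC.
have [inj|/existsNP[F /not_implyP[zF F0]]] := pselect (forall F, zeta F = 0 -> F = 0).
  exists r.+1, idfun; split=> // [p q|p]; last exact: integral_id.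
  by move=> /= e; apply/eqP; rewrite -subr_eq0; apply/eqP/inj; rewrite rmorphB /= e subrr.
have {}F0 : F != 0 by apply/eqP.
have [c [a [c0 a0 top]]] := shear_top F0.
have [sg [sgC sgX]] := @mpoly_hom k {mpoly k[r.+1]} r (@mpolyC _ _)
  (fun j => 'X_(lift ord0 j) - (c (lift ord0 j) / c ord0)%:MP * 'X_ord0).
pose u i := if unlift ord0 i is Some j then 'X_j else 0 : {mpoly k[r]}.
have [th [thC thX]] := @mpoly_hom k {poly {mpoly k[r]}} r.+1 (polyC \o @mpolyC _ _)
  (fun i => (u i)%:P + (c i)%:MP *: 'X).
pose zeta' : {rmorphism {mpoly k[r]} -> K} := zeta \o sg.
pose tau := zeta ((c ord0)^-1%:MP * 'X_ord0).
have thE p : (map_poly zeta' (th p)).[tau] = zeta p.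
  pose ev : {rmorphism {mpoly k[r.+1]} -> K} := horner_eval tau \o map_poly zeta' \o th.
  apply: (@mpoly_hom_ext _ _ _ ev zeta) => [b|i].
    by rewrite /= thC /= map_polyC /= /horner_eval hornerC /= sgC.
  rewrite /= thX /horner_eval rmorphD /= map_polyC map_polyZ map_polyX /= !hornerE /=.
  rewrite sgC -rmorphM -rmorphD /=; congr (zeta _).
  rewrite mulrA -mpolyCM /u; case: unliftP => [j ->|->].
    by rewrite sgX subrK.
  by rewrite rmorph0 add0r divff // mpolyC1 mul1r.
have [szF cF] : has_top (th F) (msize F).-1 a%:MP.
  apply: top => // i; rewrite thX; split; last first.
    by rewrite coefD coefC coefZ coefX mulr1 add0r.
  by rewrite (leq_trans (size_polyD _ _)) // geq_max (leq_trans (size_polyC_leq1 _)) //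
     (leq_trans (size_scale_leq _ _)) // size_polyX.
have aV : a%:MP_[r] * (a^-1)%:MP = 1 by rewrite -mpolyCM divff // mpolyC1.
have szE : size (th F) = (msize F).-1.+1.
  apply/eqP; rewrite eqn_leq szF ltnNge; apply/negP => sz.
  by move/eqP: cF; rewrite nth_default // eq_sym mpolyC_eq0 (negPf a0).
have int_tau : integralOver zeta' tau.
  exists ((a^-1)%:MP *: th F); last first.
    by rewrite map_polyZ /root hornerZ thE zF mulr0.
  rewrite monicE lead_coefE.
  have -> : (size (a^-1%:MP *: th F)).-1 = (msize F).-1.
    by rewrite size_scale ?szE // mpolyC_eq0 invr_eq0.
  by rewrite coefZ cF mulrC aV.
have [d [eta [etaC eta_inj eta_int]]] := IHr zeta'.
exists d, (sg \o eta); split=> [b||] //; first by rewrite /= etaC sgC.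
have intC b : integralOver (zeta \o (sg \o eta)) (zeta b%:MP).
  have -> : zeta b%:MP = (zeta \o (sg \o eta)) b%:MP by rewrite /= etaC sgC.
  exact: integral_id.
have int0 : integralOver (zeta \o (sg \o eta)) (zeta 'X_ord0).
  have -> : zeta 'X_ord0 = zeta (c ord0)%:MP * tau.
    by rewrite -rmorphM mulrA -mpolyCM divff // mpolyC1 mul1r.
  apply: integral_mul; first exact: intC.
  have [P monP rootP] := int_tau.
  apply: (integral_root_monic (monic_map zeta' monP) rootP).
  by apply/integral_poly => i; rewrite coef_map; apply: eta_int.
apply: integral_mpoly => // i; case: (unliftP ord0 i) => [j ->|-> //].
have -> : zeta 'X_(lift ord0 j) = zeta' 'X_j + zeta (c (lift ord0 j) / c ord0)%:MP * zeta 'X_ord0.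
  by rewrite /zeta' /= -rmorphM -rmorphD /= sgX subrK.
by apply: integral_add; [exact: eta_int | apply: integral_mul; [exact: intC|]].
Qed.

(** * Discrete places and power series expansions *)

Lemma poly_family_lowest (k : fieldType) N (p : 'I_N -> {poly k}) :
  (exists i, p i != 0) ->
  exists e (q : 'I_N -> {poly k}), (forall i, p i = 'X^e * q i) /\ exists i, (q i).[0] != 0.
Proof.
move=> [i0 pi0]; have [m] := ubnP (size (p i0)); elim: m p pi0 => // m IHm p pi0.
rewrite ltnS => szp; have [[i qi]|no] := pselect (exists i, (p i).[0] != 0).
  by exists 0%N, p; split=> [j|]; [rewrite expr0 mul1r | exists i].
have pX i : p i = 'X * (p i %/ 'X).
  rewrite mulrC divpK // -['X]subr0 -polyC0 dvdp_XsubCl; apply/rootP.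
  by apply: contrapT => /eqP pi; apply: no; exists i.
have qi0 : p i0 %/ 'X != 0 by apply: contraNneq pi0 => e; rewrite pX e mulr0.
have [||e [q [qE ex]]] := IHm (fun i => p i %/ 'X) => //.
  by rewrite (leq_trans _ szp) // {2}(pX i0) mulrC size_mulX.
by exists e.+1, q; split=> // i; rewrite pX qE mulrA exprS.
Qed.

(** A place of a field of degree at most [N] over k(t), centered at [t = 0]. *)
Section DiscretePlace.
Variables (k : closedFieldType) (L : fieldType) (G : L -> k -> Prop).
Variables (tau : {rmorphism {poly k} -> L}) (N : nat).
Hypothesis placeG : place G.
Hypothesis tau_inj : injective tau.
Hypothesis G_tau : forall p, G (tau p) p.[0].
Hypothesis dep : forall x : 'I_N.+1 -> L, exists p : 'I_N.+1 -> {poly k},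
  (exists i, p i != 0) /\ \sum_i tau (p i) * x i = 0.

Let hG : partial_hom G := proj1 placeG.
Let t0 : L := tau 'X.
Let O x := exists c, G x c.

Lemma placeV y c : G y c -> c != 0 -> G y^-1 c^-1.
Proof.
move=> yc c0; have y0 : y != 0.
  by apply: contraNneq c0 => y0; rewrite y0 in yc; rewrite (ph_fun0 hG yc).
have [[d yd]|] := (proj2 placeG) y^-1; last first.
  by rewrite invrK => y_0; rewrite (ph_fun hG yc y_0) eqxx in c0.
have e : c * d = 1.
  by apply: (ph_fun hG (ph_M hG yc yd)); rewrite divff //; apply: (ph_1 hG).
by rewrite -[c^-1]mulr1 -e mulKf.
Qed.

Lemma place_mul0 x y c : G x c -> G y 0 -> G (x * y) 0.
Proof. by move=> xc y0; rewrite -(mulr0 c); apply: (ph_M hG). Qed.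

Lemma G1N0 : ~ G 1 0.
Proof. by move=> /(ph_fun hG (ph_1 hG)) /eqP; rewrite oner_eq0. Qed.

(* y has strictly larger valuation than x; leaving 0 out makes this transitive *)
Let lt x y := [/\ x != 0, y != 0 & G (y / x) 0].

Let lt_trans y x z : lt x y -> lt y z -> lt x z.
Proof.
move=> [x0 y0 xy] [_ z0 yz]; split=> //.
by have := ph_M hG yz xy; rewrite mulrA divfK // mulr0.
Qed.

Let t00 : t0 != 0.
Proof. by rewrite -(rmorph0 tau) (inj_eq tau_inj) polyX_eq0. Qed.

(** Elements of distinct valuations in the interval from 0 to that of [t], the upper end
    excluded, are independent over k(t). Indeed in a relation whose coefficients do not
    all vanish at 0, the first term whose coefficient does not vanish there has strictly
    smaller valuation than all the others. *)
Lemma no_long_chain (x : nat -> L) : x 0%N = 1 -> x N.+1 = t0 ->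
  (forall i, (i <= N)%N -> lt (x i) (x i.+1)) -> False.
Proof.
move=> x0 xN chain.
have ltx i j : (i < j)%N -> (j <= N.+1)%N -> lt (x i) (x j).
  elim: j => // j IHj; rewrite ltnS leq_eqVlt => /orP[/eqP <-|ij] jN; first exact: chain.
  by apply: lt_trans (chain j jN); apply: IHj => //; apply: leqW.
have Ox i : (i <= N)%N -> O (x i).
  case: i => [_|i iN]; first by rewrite x0; exists 1; apply: (ph_1 hG).
  have [_ _] := @ltx 0%N i.+1 isT (leqW iN).
  by rewrite x0 divr1; exists 0.
have xn0 i : (i <= N)%N -> x i != 0 by move=> /chain[].
have [p [p0 sum0]] := dep (fun i => x i).
have [e [q [pE exq]]] := poly_family_lowest p0.
have {}sum0 : \sum_(i < N.+1) tau (q i) * x i = 0.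
  apply: (mulfI (_ : t0 ^+ e != 0)); first exact: expf_neq0.
  rewrite mulr0 -[RHS]sum0 mulr_sumr; apply: eq_bigr => i _.
  by rewrite pE rmorphM rmorphXn mulrA.
have exi : exists n, [exists i : 'I_N.+1, (nat_of_ord i == n) && ((q i).[0] != 0)].
  by have [i qi] := exq; exists (nat_of_ord i); apply/existsP; exists i; rewrite eqxx.
case: (ex_minnP exi) => n /existsP[i /andP[/eqP <- qi]] mini {exi exq}.
have iN : (i <= N)%N by rewrite -ltnS.
suff : G (tau (q i)) 0 by move=> /(ph_fun hG (G_tau _)) /eqP; rewrite (negPf qi).
have -> : tau (q i) = - (\sum_(j < N.+1 | j != i) tau (q j) * (x j / x i)).
  apply: (mulIf (xn0 i iN)); rewrite mulNr mulr_suml; apply/eqP; rewrite -addr_eq0.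
  move/eqP: sum0; rewrite (bigD1 i) //=; congr (_ + _ == 0).
  by apply: eq_bigr => j _; rewrite mulrA divfK // xn0.
suff sG : G (\sum_(j < N.+1 | j != i) tau (q j) * (x j / x i)) 0.
  by have := ph_N hG sG; rewrite oppr0.
have -> : 0 = \sum_(j < N.+1 | j != i) 0 :> k by rewrite big1.
apply: (ph_sum hG) => j ji.
have jN : (j <= N)%N by rewrite -ltnS.
case: (ltngtP j i) => [lt_ji|lt_ij|e']; last by rewrite (val_inj e') eqxx in ji.
  have qj0 : (q j).[0] = 0.
    apply/eqP; apply: contraLR lt_ji => qj; rewrite -leqNgt; apply: mini.
    by apply/existsP; exists j; rewrite eqxx.
  have /dvdpP[r rE] : 'X %| q j by rewrite -['X]subr0 -polyC0 dvdp_XsubCl; apply/rootP.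
  have [c xjc] := Ox j jN.
  have [_ _] := @ltx i N.+1 (ltn_ord i) (leqnn _); rewrite xN => tx.
  rewrite rE rmorphM -/t0 (_ : _ * _ * _ = tau r * x j * (t0 / x i)); last by ring.
  exact: place_mul0 (ph_M hG (G_tau r) xjc) tx.
have [_ _ xx] := ltx i j lt_ij (leqW jN).
exact: place_mul0 (G_tau _) xx.
Qed.

(** Otherwise there would be arbitrarily long chains of valuations below that of [t]. *)
Lemma uniformizer : exists s, [/\ s != 0, G s 0 & forall x, G x 0 -> O (x / s)].
Proof.
apply: contrapT => nos.
have smaller s : s != 0 -> G s 0 -> exists s', lt s' s /\ G s' 0.
  move=> s0 sG; apply: contrapT => no; apply: nos; exists s; split=> // x xG.
  have [->|x0] := eqVneq x 0; first by exists 0; rewrite mul0r; apply: (ph_0 hG).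
  have [//|sx] := (proj2 placeG) (x / s).
  by case: no; exists x; split=> //; split=> //; rewrite invf_div in sx.
have chains m : exists x : nat -> L, [/\ x 0%N = 1, x m.+1 = t0 &
    forall i, (i <= m)%N -> lt (x i) (x i.+1)].
  elim: m => [|m [x [x0 xm chain]]].
    exists (fun i => if i == 0%N then 1 else t0); split=> // -[|//] _.
    split; rewrite ?oner_neq0 // divr1.
    by have := G_tau 'X; rewrite hornerX.
  have [_ x10 x1G] := chain 0%N isT; rewrite x0 divr1 in x1G.
  have [s [sx1 sG]] := smaller _ x10 x1G.
  exists (fun i => if i is i'.+1 then (if i' is 0 then s else x i') else 1).
  split=> // -[|[|i]] im //; last exact: chain.
  by split; rewrite ?oner_neq0 ?divr1 //; case: sx1.
have [x [x0 xN chain]] := chains N.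
exact: (no_long_chain x0 xN chain).
Qed.

Section Uniformizer.
Variable s : L.
Hypotheses (s0 : s != 0) (sG : G s 0) (sO : forall x, G x 0 -> O (x / s)).

(** [t] is a unit times a power of the uniformizer. *)
Lemma valuation_t : exists b w c, [/\ t0 = s ^+ b * w, G w c & c != 0].
Proof.
have [n nO] : exists n, ~ O (t0 / s ^+ n).
  exists N.+1 => -[c tc].
  apply: (@no_long_chain (fun i => if (i <= N)%N then s ^+ i else t0)).
  - by rewrite expr0.
  - by rewrite ltnn.
  move=> i iN; rewrite iN; split; rewrite ?expf_neq0 //; first by case: ifP; rewrite ?expf_neq0.
  case: ltnP => [_|Ni]; first by rewrite exprS mulfK ?expf_neq0.
  have -> : i = N by lia.
  have := place_mul0 tc sG.
  by rewrite exprSr invfM mulrA divfK.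
have ex : exists n, `[< ~ O (t0 / s ^+ n) >] by exists n; apply/asboolP.
case: (ex_minnP ex) => -[|b] /asboolP nOb minb.
  by case: nOb; exists 0; rewrite expr0 divr1; have := G_tau 'X; rewrite hornerX.
have [c wc] : O (t0 / s ^+ b).
  apply: contrapT => nO'; have := minb b; rewrite ltnn => H.
  by have : false by apply: H; apply/asboolP.
exists b, (t0 / s ^+ b), c; split=> //; first by rewrite mulrC divfK ?expf_neq0.
apply/eqP => c0; apply: nOb; rewrite c0 in wc.
by have := sO wc; rewrite exprSr invfM mulrA.
Qed.

(** [x] divides the lowest nonzero coefficient of a relation between its powers, hence
    a power of [t], hence a power of [s]. *)
Lemma place_separated x : x != 0 -> O x -> exists n, ~ O (x / s ^+ n).
Proof.
move=> x0 [cx xc]; apply: contrapT => /forallNP div.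
have {}div n : O (x / s ^+ n) by apply: contrapT; apply: div.
have [p [p0 sum0]] := dep (fun i => x ^+ i).
have exi : exists n, [exists i : 'I_N.+1, (nat_of_ord i == n) && (p i != 0)].
  by have [i pi] := p0; exists (nat_of_ord i); apply/existsP; exists i; rewrite eqxx.
case: (ex_minnP exi) => n /existsP[i /andP[/eqP <- pi]] mini {exi p0}.
have p_small (j : 'I_N.+1) : (j < i)%N -> p j = 0.
  move=> lt_ji; apply/eqP; apply: contraLR lt_ji => pj; rewrite -leqNgt; apply: mini.
  by apply/existsP; exists j; rewrite eqxx.
have [o Oo pio] : exists2 o, O o & tau (p i) = x * o.
  exists (- (\sum_(j < N.+1 | (i < j)%N) tau (p j) * x ^+ (j - i.+1))).
    exists (- (\sum_(j < N.+1 | (i < j)%N) (p j).[0] * cx ^+ (j - i.+1))).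
    apply/(ph_N hG)/(ph_sum hG) => j _; apply: (ph_M hG) => //.
    exact: (ph_X hG).
  apply: (mulIf (expf_neq0 i x0)); rewrite mulrN mulNr; apply/eqP; rewrite -addr_eq0.
  apply/eqP; rewrite -[RHS]sum0 [RHS](bigD1 i) //=; congr (_ + _).
  rewrite mulr_sumr mulr_suml.
  rewrite [RHS](bigID (fun j : 'I_N.+1 => (i < j)%N)) /= [X in _ = _ + X]big1 ?addr0.
    apply: eq_big => [j|j ij].
      by case: (ltngtP i j) => [||/val_inj ->] //; rewrite ?andbF // andbT => /gtn_eqF ij;
         rewrite -val_eqE /= ij.
    by rewrite mulrCA -!mulrA -exprD -exprS; congr (_ * _ ^+ _); lia.
  move=> j /andP[ji]; rewrite -leqNgt leq_eqVlt => /orP[/eqP/val_inj e|/p_small ->].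
    by rewrite e eqxx in ji.
  by rewrite rmorph0 mul0r.
have [|e [q [pE [j qj]]]] := @poly_family_lowest k 1 (fun=> p i); first by exists ord0.
have [b [w [c [tE wc c0]]]] := valuation_t.
have [d xd] : O (x * o / s ^+ (b * e).+1).
  have [[d1 xd1] [d2 od2]] := (div (b * e).+1, Oo).
  by exists (d1 * d2); rewrite mulrAC; apply: (ph_M hG).
pose y := w ^+ e * tau (q j).
have yG : G y (c ^+ e * (q j).[0]) by apply: (ph_M hG) => //; apply: (ph_X hG).
have yE : x * o / s ^+ (b * e).+1 = y / s.
  rewrite -pio (pE j) rmorphM rmorphXn /= -/t0 tE exprMn -exprM exprS invfM /y.
  have S0 : s ^+ (b * e) != 0 by rewrite expf_neq0.
  by move: (s ^+ (b * e)) S0 => S S0; field; rewrite s0 S0.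
have y0 : c ^+ e * (q j).[0] != 0 by rewrite mulf_neq0 ?expf_neq0.
have yn0 : y != 0 by apply: contraNneq y0 => e0; rewrite e0 in yG; rewrite (ph_fun0 hG yG).
apply: G1N0; have := place_mul0 (ph_M hG xd (placeV yG y0)) sG.
rewrite yE (_ : _ * _ = 1) //.
by field; rewrite yn0 s0.
Qed.

Local Notation iota c := (tau c%:P).

Let Giota c : G (iota c) c.
Proof. by have := G_tau c%:P; rewrite hornerC. Qed.

Definition pval (x : L) : k := xget 0 [set c | G x c].

Let pvalP x c : G x c -> pval x = c.
Proof. by move=> xc; apply: (ph_fun hG _ xc); apply: (@xgetPex _ _ [set c | G x c]); exists c. Qed.

Let GO x : O x -> G x (pval x).
Proof. by move=> [c xc]; rewrite (pvalP xc). Qed.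

Definition pshift (x : L) : L := (x - iota (pval x)) / s.
(** The digits of [x] in base [s], read off one after the other. *)
Definition expansion (x : L) : powser k := Powser (fun n => pval (iter n pshift x)).

Let O_shift x : O x -> O (pshift x).
Proof. by move=> /GO xc; apply: sO; rewrite -(subrr (pval x)); apply: (ph_B hG). Qed.

Let OM x y : O x -> O y -> O (x * y).
Proof. by move=> [c xc] [d yd]; exists (c * d); apply: (ph_M hG). Qed.

Let pvalB x y : O x -> O y -> pval (x - y) = pval x - pval y.
Proof. by move=> /GO xc /GO yc; apply: pvalP; apply: (ph_B hG). Qed.

Let pvalM x y : O x -> O y -> pval (x * y) = pval x * pval y.
Proof. by move=> /GO xc /GO yc; apply: pvalP; apply: (ph_M hG). Qed.

Let shiftB x y : O x -> O y -> pshift (x - y) = pshift x - pshift y.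
Proof.
move=> Ox Oy; by rewrite /pshift pvalB // polyCB rmorphB -mulrBl; congr (_ / _); ring.
Qed.

Let O_iter n x : O x -> O (iter n pshift x).
Proof. by move=> Ox; elim: n => //= n; apply: O_shift. Qed.

Let iter_shiftB n x y : O x -> O y ->
  iter n pshift (x - y) = iter n pshift x - iter n pshift y.
Proof. by move=> Ox Oy; elim: n => //= n ->; apply: shiftB; apply: O_iter. Qed.

Let shiftM x y : O x -> O y -> pshift (x * y) = pshift x * y + iota (pval x) * pshift y.
Proof.
move=> Ox Oy; rewrite /pshift pvalM // polyCM rmorphM.
by field.
Qed.

Lemma expansion_coef0 x c : G x c -> pcoef (expansion x) 0 = c.
Proof. exact: pvalP. Qed.

Lemma expansionB x y : O x -> O y -> expansion (x - y) = expansion x - expansion y.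
Proof.
move=> Ox Oy; apply: powserP => n /=.
by rewrite iter_shiftB // pvalB //; apply: O_iter.
Qed.

Lemma expansionC c : expansion (iota c) = powserC c.
Proof.
have D0 : pshift (iota c) = 0 by rewrite /pshift (pvalP (Giota c)) subrr mul0r.
have iter0 n : iter n pshift 0 = 0.
  elim: n => //= n ->; rewrite /pshift (pvalP (ph_0 hG)) polyC0 rmorph0 subrr mul0r.
  by [].
apply: powserP => -[|n] /=; first by rewrite (pvalP (Giota c)).
by rewrite -iterS iterSr D0 iter0 (pvalP (ph_0 hG)).
Qed.

Let iotaO c : O (iota c).
Proof. by exists c; apply: Giota. Qed.

(** [pshift] is a twisted derivation: see [shiftM]. *)
Lemma expansionM x y : O x -> O y -> expansion (x * y) = expansion x * expansion y.
Proof.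
move=> Ox Oy; apply: powserP => n /=.
elim: n x y Ox Oy => [|n IHn] x y Ox Oy; first by rewrite big_ord1 /= pvalM.
have OD u v : O u -> O v -> O (u + v).
  by move=> [c uc] [d vd]; exists (c + d); apply: (ph_D hG).
have pvalD u v : O u -> O v -> pval (u + v) = pval u + pval v.
  by move=> /GO uc /GO vc; apply: pvalP; apply: (ph_D hG).
have iterD m u v : O u -> O v -> iter m pshift (u + v) = iter m pshift u + iter m pshift v.
  move=> Ou Ov; have := iter_shiftB m (OD u v Ou Ov) Ov; rewrite addrK => ->.
  by rewrite subrK.
rewrite iterSr shiftM // iterD //; [|exact: OM (O_shift Ox) Oy|exact: OM (iotaO _) (O_shift Oy)].
rewrite pvalD //; [|apply: O_iter; exact: OM (O_shift Ox) Oy|apply: O_iter; exact: OM (iotaO _) (O_shift Oy)].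
rewrite IHn //; last exact: O_shift.
have -> : iter n pshift (iota (pval x) * pshift y) = iota (pval x) * iter n.+1 pshift y.
  elim: n {IHn} => // n IHn; rewrite iterS IHn shiftM //; last exact: O_iter.
  have -> : pshift (iota (pval x)) = 0 by rewrite /pshift (pvalP (Giota _)) subrr mul0r.
  by rewrite mul0r add0r (pvalP (Giota _)).
rewrite pvalM //; last exact: O_iter.
rewrite (pvalP (Giota _)) [RHS]big_ord_recl /= addrC; congr (_ + _).
by apply: eq_bigr => i _; rewrite -iterS -iterSr.
Qed.

Lemma expansion_eq0 x : O x -> expansion x = 0 -> x = 0.
Proof.
move=> Ox ex0; have digit n : pval (iter n pshift x) = 0.
  exact: (congr1 (fun a => pcoef a n) ex0).
have xE n : x = s ^+ n * iter n pshift x.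
  elim: n => [|n IHn]; first by rewrite mul1r.
  rewrite {1}IHn exprSr -mulrA; congr (_ * _); rewrite /= {2}/pshift digit.
  by rewrite polyC0 rmorph0 subr0 mulrC divfK.
apply/eqP; apply: contraT => x0; have [n []] := place_separated x0 Ox.
by rewrite {1}(xE n) mulrC mulKf ?expf_neq0 //; apply: O_iter.
Qed.

End Uniformizer.

(** The power series are in the uniformizer, not in [t]: the extension may be
    ramified. *)
Theorem place_expansion (M : comNzRingType) (pi : {rmorphism M -> L}) (a : M -> k) :
  (forall m, G (pi m) (a m)) ->
  exists psi : {rmorphism M -> powser k},
    [/\ forall m, pcoef (psi m) 0 = a m, forall m, psi m = 0 <-> pi m = 0 &
        forall m c, pi m = tau c%:P -> psi m = powserC c].
Proof.
move=> piG; have [s [s0 sG sO]] := uniformizer.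
have piO m : O (pi m) by exists (a m).
pose psi m := expansion s (pi m).
have psiB : zmod_morphism psi by move=> x y; rewrite /psi rmorphB expansionB.
have psiM : monoid_morphism psi.
  split=> [|x y]; last by rewrite /psi rmorphM expansionM.
  by rewrite /psi rmorph1 -(rmorph1 tau) expansionC rmorph1.
pose Psi : {rmorphism M -> powser k} := HB.pack psi
  (GRing.isZmodMorphism.Build _ _ psi psiB) (GRing.isMonoidMorphism.Build _ _ psi psiM).
exists Psi; split=> [m|m|m c piE] /=.
- exact: expansion_coef0 (piG m).
- split=> [|pi0]; first exact: (expansion_eq0 s0 sG sO).
  by rewrite -[LHS]/(psi m) -[m]subr0 psiB /psi pi0 rmorph0 subrr.
- by rewrite -[LHS]/(psi m) /psi piE expansionC.
Qed.

End DiscretePlace.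

(** * Arcs through a point of an affine variety *)

(** An ideal maximal among those that contain [I] and avoid the multiplicative set [S]
    is prime. *)
Lemma prime_avoiding (M : comNzRingType) (I S : M -> Prop) :
  I 0 -> (forall x y, I x -> I y -> I (x + y)) -> (forall x y, I y -> I (x * y)) ->
  S 1 -> (forall x y, S x -> S y -> S (x * y)) -> (forall x, I x -> S x -> False) ->
  exists q, [/\ prime_ideal q, forall x, I x -> q x & forall x, q x -> S x -> False].
Proof.
move=> I0 ID IM S1 SM IS.
pose ideal (A : set M) := [/\ forall x, I x -> A x, forall x y, A x -> A y -> A (x + y),
  forall x y, A y -> A (x * y) & forall x, A x -> S x -> False].
pose good (A : set M) := A = set0 \/ ideal A.
have idI : ideal I by split.
have [F Fgood tot|A [goodA maxA]] := @Zorn_bigcup _ good.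
  have [allE|[B FB B0]] : (forall B, F B -> B = set0) \/ exists2 B, F B & B <> set0.
    have [[B [FB B0]]|no] := pselect (exists B, F B /\ B <> set0).
      by right; exists B.
    by left=> B FB; apply: contrapT => B0; apply: no; exists B.
    by left; rewrite -subset0 => z [B FB]; rewrite (allE B FB).
  have idne C x : F C -> C x -> ideal C.
    by move=> FC Cx; case: (Fgood C FC) => // C0; rewrite C0 in Cx.
  right; split=> [x Ix|x y [C FC Cx] [D FD Dy]|x y [C FC Cy]|x [C FC Cx] Sx].
  - by exists B => //; case: (Fgood B FB) => // -[IB _ _ _]; apply: IB.
  - have [_ DD _ _] := idne D y FD Dy; have [_ CD _ _] := idne C x FC Cx.
    have [CsD|DsC] := tot C D FC FD.
      by exists D => //; apply: DD => //; apply: CsD.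
    by exists C => //; apply: CD => //; apply: DsC.
  - by have [_ _ CM _] := idne C y FC Cy; exists C => //; apply: CM.
  - by have [_ _ _ CS] := idne C x FC Cx; apply: CS Cx Sx.
have [IA AD AM AS] : ideal A.
  case: goodA => // A0; exfalso; apply: (maxA I); last by right.
  rewrite A0; split; first exact: sub0set.
  by move=> /(_ 0 I0).
have meets x : ~ A x -> exists m u, A m /\ S (m + u * x).
  move=> nAx; apply: contrapT => no; pose B y := exists m u, A m /\ y = m + u * x.
  apply: (maxA B).
    split=> [y Ay|/(_ x) nB]; first by exists y, 0; rewrite mul0r addr0.
    by apply/nAx/nB; exists 0, 1; rewrite mul1r add0r; split=> //; apply: IA.
  right; split=> [y Iy|y z|y z|y].
  - by exists y, 0; rewrite mul0r addr0; split=> //; apply: IA.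
  - move=> [m [u [Am ->]]] [n [w [An ->]]]; exists (m + n), (u + w).
    by rewrite mulrDl addrACA; split=> //; apply: AD.
  - move=> [m [u [Am ->]]]; exists (y * m), (y * u).
    by rewrite mulrDr mulrA; split=> //; apply: AM.
  - by move=> [m [u [Am ->]]] Sy; apply: no; exists m, u.
exists A; split=> //; split=> // [|A1|x y Axy]; [exact: IA|exact: AS A1 S1|].
apply: contrapT => /not_orP[nAx nAy].
have [m [u [Am Sx]]] := meets x nAx; have [n [w [An Sy]]] := meets y nAy.
apply: (AS _ _ (SM _ _ Sx Sy)).
have -> : (m + u * x) * (n + w * y) = n * m + w * y * m + (u * x * n + u * w * (x * y)) by ring.
by apply: (AD); apply: (AD); apply: (AM).
Qed.

(** Divide a relation of [x] by the largest possible power of [x]; its constant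
    coefficient is then a nonzero multiple of [x]. *)
Lemma integral_multiple (R : comNzRingType) (K : fieldType) (f : {rmorphism R -> K}) x
    (P : {poly R}) : P != 0 -> root (map_poly f P) x -> x != 0 ->
  exists c Q, c != 0 /\ f c = x * (map_poly f Q).[x].
Proof.
elim/poly_ind: P => [|P c IHP]; first by rewrite eqxx.
rewrite /root rmorphD rmorphM /= map_polyX map_polyC !hornerE => P0 /eqP e x0.
have {}e : (map_poly f P).[x] * x + f c = 0 by [].
have [c0|c0] := eqVneq c 0; last first.
  exists c, (- P); split=> //; rewrite rmorphN hornerN mulrN mulrC.
  by apply/eqP; rewrite -addr_eq0 addrC e.
rewrite c0 rmorph0 addr0 in e; rewrite c0 addr0 in P0; apply: IHP (x0).
  by apply: contraNneq P0 => ->; rewrite mul0r.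
by move/eqP: e; rewrite mulf_eq0 (negPf x0) orbF.
Qed.

Lemma span_dependent (R : idomainType) (L : fieldType) (f : {rmorphism R -> L})
    (J : finType) (v : J -> L) (x : 'I_#|J|.+1 -> L) :
  (forall i, exists B : J -> R, x i = \sum_b f (B b) * v b) ->
  exists p : 'I_#|J|.+1 -> R, (exists i, p i != 0) /\ \sum_i f (p i) * x i = 0.
Proof.
move=> xB; pose B i := projT1 (cid (xB i)).
have BE i : x i = \sum_b f (B i b) * v b by rewrite /B; case: cid.
(* a zero column makes the matrix of coordinates square *)
pose A : 'M[R]_#|J|.+1 := \matrix_(i, j) if unlift ord0 j is Some l then B i (enum_val l) else 0.
have /det0P[p p0 pA] : \det A == 0.
  rewrite -det_tr; apply/det0P; exists (delta_mx 0 ord0).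
    by apply/eqP => /matrixP/(_ 0 ord0); rewrite !mxE !eqxx => /eqP; rewrite oner_eq0.
  by rewrite -rowE; apply/rowP => j; rewrite !mxE unlift_none.
exists (p 0); split.
  by have /rV0Pn[i pi] := p0; exists i.
transitivity (\sum_b (\sum_i f (p 0 i) * f (B i b)) * v b).
  under [RHS]eq_bigr do rewrite mulr_suml.
  rewrite exchange_big; apply: eq_bigr => i _; rewrite BE mulr_sumr.
  by apply: eq_bigr => b _; rewrite mulrA.
apply: big1 => b _.
have /rowP/(_ (lift ord0 (enum_rank b))) := pA; rewrite !mxE => pb.
transitivity (f 0 * v b); last by rewrite rmorph0 mul0r.
rewrite -pb rmorph_sum; congr (_ * _); apply: eq_bigr => i _.
by rewrite rmorphM !mxE liftK enum_rankK.
Qed.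

Lemma finite_stabilizes (k R : comNzRingType) (K : fieldType) r
    (zeta : {rmorphism {mpoly k[r]} -> K}) (f : {rmorphism R -> K}) :
  (forall c, exists b, zeta c%:MP = f b) -> (forall i, integralOver f (zeta 'X_i)) ->
  exists (J : finType) (v : J -> K) (j0 : J), v j0 = 1 /\
    forall m, stabilizes f v (fun=> True) (zeta m).
Proof.
move=> zC zX; pose s := [seq zeta 'X_i | i <- enum 'I_r].
have [z /mapP[i _ ->] //|J [v [j0 [v0 vs]]]] := @integral_stabilizes R K f s.
exists J, v, j0; split=> //; apply: mpoly_ind_hom => [c|i|p q pst qst|p q pst qst].
- by have [b ->] := zC c; apply: stabilizes_scalar.
- by apply: vs; apply/mapP; exists i; rewrite ?mem_enum.
- by rewrite rmorphD; apply: stabilizesD.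
- by rewrite rmorphM; apply: stabilizesM.
Qed.

Section Arc.
Variables (k : closedFieldType) (K : fieldType) (r : nat).
Local Notation M := {mpoly k[r]}.
Variables (zeta : {rmorphism M -> K}) (a : {rmorphism M -> k}).
Hypothesis aC : forall c, a c%:MP = c.
Hypothesis za : forall p, zeta p = 0 -> a p = 0.

(** [eta] is a Noether normalization of [M / ker zeta], and [e] a parametrized line in
    affine space that passes at time 0 through the image of the point [a]. *)
Section GoingDown.
Variables (d : nat) (eta : {rmorphism {mpoly k[d]} -> M}).
Hypothesis etaC : forall c, eta c%:MP = c%:MP.
Hypothesis eta_inj : injective (zeta \o eta).
Hypothesis eta_int : forall p, integralOver (zeta \o eta) (zeta p).
Variable e : {rmorphism {mpoly k[d]} -> {poly k}}.
Hypothesis e0 : forall P, (e P).[0] = a (eta P).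

(** The ideal generated by [ker zeta] and [eta (ker e)], whose zero locus is the part of
    the variety [M / ker zeta] that lies above the line [e]. *)
Definition fiber_ideal (m : M) : Prop := exists l : seq ({mpoly k[d]} * M),
  all (fun t => e t.1 == 0) l /\ zeta m = zeta (\sum_(t <- l) eta t.1 * t.2).

(** Going down for the integral extension [M / ker zeta] of the normal domain
    [k[y]]: an element [eta P * s] of the extension of [ker e] satisfies a monic
    relation that reduces to a power of ['X] modulo [ker e], hence so does the
    minimal polynomial of [s] when [e P] is nonzero. So [s] vanishes at [a]. *)
Lemma going_down P s : e P != 0 -> a s != 0 -> ~ fiber_ideal (eta P * s).
Proof.
move=> eP as0 [l [le sl]].
pose R2K : {rmorphism {mpoly k[d]} -> K} := zeta \o eta.
have [J [v [j0 [v0 vst]]]] : exists (J : finType) (v : J -> K) (j0 : J), v j0 = 1 /\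
    forall m, stabilizes R2K v (fun=> True) (zeta m).
  apply: finite_stabilizes => [c|i]; last exact: eta_int.
  by exists c%:MP; rewrite /R2K /= etaC.
have [n [Q [rootQ eQ]]] : exists n Q,
    [/\ root (map_poly R2K Q) (zeta (eta P * s)) & map_poly e Q = 'X^n].
  apply: (@stabilizes_char_poly _ _ R2K _ v _ e j0); first by rewrite v0 oner_eq0.
  rewrite sl; elim: l le {sl} => [_|[p m] l IHl /= /andP[/eqP ep le]].
    rewrite big_nil rmorph0; exists (fun _ _ => 0); split=> [? ?|b]; first exact: rmorph0.
    by rewrite mul0r big1 // => ? _; rewrite rmorph0 mul0r.
  rewrite big_cons rmorphD rmorphM /= -[zeta (eta p)]/(R2K p).
  apply: stabilizesD; last exact: IHl.
    by move=> x y x0 y0; rewrite rmorphD x0 y0 addr0.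
  apply: stabilizesZ => //.
  by move=> x y x0; rewrite rmorphM x0 mul0r.
have [X [monX rootX minX]] := integral_minpoly eta_inj (@cic_mpoly k d) (eta_int s).
have [H HE] : exists H, Q \Po (P *: 'X) = X * H.
  apply: minX; rewrite map_comp_poly map_polyZ /= map_polyX /root horner_comp hornerZ hornerX.
  by move: rootQ; rewrite rmorphM.
have [m eX] : exists m, map_poly e X = 'X^m.
  have mon_eX : map_poly e X \is monic by apply: monic_map.
  have := congr1 (map_poly e) HE; rewrite map_comp_poly map_polyZ map_polyX eQ rmorphM /=.
  rewrite comp_Xn_poly exprZn => XH.
  have : map_poly e X %| ('X - 0%:P) ^+ n.
    by rewrite subr0 -(@dvdpZr _ (e P ^+ n)) ?expf_neq0 // XH dvdp_mulr.
  case/dvdp_exp_XsubCP => m _; rewrite subr0 eqp_monic ?monicXn // => /eqP Xm.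
  by exists m.
have : (map_poly (a \o eta) X).[a s] = 0.
  rewrite (map_poly_comp a) horner_map /=; apply: za.
  by rewrite -horner_map -map_poly_comp; apply/eqP.
rewrite (@eq_map_poly _ _ _ (horner_eval 0 \o e)) => [|p]; last by rewrite /= /horner_eval e0.
rewrite (map_poly_comp (horner_eval 0)) eX map_polyXn hornerXn => /eqP.
by rewrite expf_eq0 (negPf as0) andbF.
Qed.

Lemma fiber_ideal0 : fiber_ideal 0.
Proof. by exists [::]; rewrite big_nil. Qed.

Lemma fiber_ideal_ker m : zeta m = 0 -> fiber_ideal m.
Proof. by move=> m0; exists [::]; rewrite big_nil m0 rmorph0. Qed.

Lemma fiber_ideal_e P : e P = 0 -> fiber_ideal (eta P).
Proof. by move=> P0; exists [:: (P, 1)]; rewrite big_seq1 /= P0 eqxx mulr1. Qed.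

Lemma fiber_idealD x y : fiber_ideal x -> fiber_ideal y -> fiber_ideal (x + y).
Proof.
move=> [l [le xl]] [l' [le' yl']]; exists (l ++ l').
by rewrite all_cat le le' big_cat /= !rmorphD xl yl'.
Qed.

Lemma fiber_idealM x y : fiber_ideal y -> fiber_ideal (x * y).
Proof.
move=> [l [le yl]]; exists [seq (t.1, x * t.2) | t <- l]; rewrite all_map; split=> //.
rewrite rmorphM yl -rmorphM big_map mulr_sumr; congr (zeta _).
by apply: eq_bigr => t _; rewrite mulrCA.
Qed.

(** The prime [q], which contains [fiber_ideal] and avoids the products [eta P * s] with
    [e P] and [a s] nonzero, defines a curve through [a] finite above the line; the place
    is taken on its function field. *)
Lemma curve_arc (sg : {rmorphism {poly k} -> {mpoly k[d]}}) :
  (forall c, sg c%:P = c%:MP) -> (forall p, e (sg p) = p) ->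
  exists psi : {rmorphism M -> powser k},
  [/\ forall c, psi c%:MP = powserC c, forall p, pcoef (psi p) 0 = a p,
      forall p, zeta p = 0 -> psi p = 0 &
      forall P, psi (eta P) = 0 -> e P = 0].
Proof.
move=> sgC eK.
pose S m := exists P s, [/\ m = eta P * s, e P != 0 & a s != 0].
have S1 : S 1 by exists 1, 1; rewrite !rmorph1 mulr1 !oner_neq0.
have SM x y : S x -> S y -> S (x * y).
  move=> [P [s [-> P0 s0]]] [Q [u [-> Q0 u0]]]; exists (P * Q), (s * u).
  by rewrite !rmorphM mulrACA !mulf_neq0.
have IS m : fiber_ideal m -> S m -> False.
  by move=> Im [P [s [mE P0 s0]]]; rewrite mE in Im; apply: going_down Im.
have [q [primeq Iq Sq]] :=
  prime_avoiding fiber_ideal0 fiber_idealD fiber_idealM S1 SM IS.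
have [L [pi [pi0 pi_frac]]] := prime_ideal_kernel primeq.
have pi_ker m : zeta m = 0 -> pi m = 0 by move=> /fiber_ideal_ker/Iq/pi0.
have pi_eq m m' : fiber_ideal (m - m') -> pi m = pi m'.
  by move=> /Iq/pi0 e'; apply/eqP; rewrite -subr_eq0 -rmorphB e'.
have pia m : pi m = 0 -> a m = 0.
  move=> /pi0 qm; apply/eqP; apply: contraT => am.
  by case: (Sq m qm); exists 1, m; rewrite !rmorph1 mul1r oner_neq0.
have pie P : pi (eta P) = 0 -> e P = 0.
  move=> /pi0 qP; apply/eqP; apply: contraT => eP.
  by case: (Sq _ qP); exists P, 1; rewrite mulr1 rmorph1 oner_neq0.
pose tau : {rmorphism {poly k} -> L} := pi \o eta \o sg.
have tau_inj : injective tau.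
  move=> x y /eqP; rewrite -subr_eq0 -rmorphB => /eqP /pie.
  by rewrite eK => /eqP; rewrite subr_eq0 => /eqP.
have tauE P : tau (e P) = pi (eta P).
  by apply: pi_eq; rewrite -rmorphB; apply: fiber_ideal_e; rewrite rmorphB /= eK subrr.
pose G0 x c := exists m, pi m = x /\ a m = c.
have hG0 : partial_hom G0.
  split=> [c [m [/pia -> ->]] //||x y c d' [m [<- <-]] [m' [<- <-]]|
           x y c d' [m [<- <-]] [m' [<- <-]]].
  - by exists 1; rewrite !rmorph1.
  - by exists (m - m'); rewrite !rmorphB.
  - by exists (m * m'); rewrite !rmorphM.
have [G [placeG G0G]] := place_extension hG0 (fun c => ex_intro _ (pi c%:MP)
   (ex_intro _ c%:MP (conj erefl (aC c)))).
have piG m : G (pi m) (a m) by apply: G0G; exists m.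
have G_tau p : G (tau p) p.[0] by rewrite -[in p.[0]](eK p) e0; apply: piG.
have [J [v [j0 [v0 vst]]]] : exists (J : finType) (v : J -> L) (j0 : J), v j0 = 1 /\
    forall m, stabilizes tau v (fun=> True) (pi m).
  apply: finite_stabilizes => [c|i].
    by exists c%:P; rewrite /tau /= sgC etaC.
  have [P monP rootP] := eta_int 'X_i; exists (map_poly e P); first exact: monic_map.
  rewrite -map_poly_comp (@eq_map_poly _ _ _ (pi \o eta)) => [|p]; last exact: tauE.
  rewrite (map_poly_comp pi) /root horner_map pi_ker //.
  by rewrite -horner_map -map_poly_comp; apply/eqP.
have dep (x : 'I_#|J|.+1 -> L) : exists p : 'I_#|J|.+1 -> {poly k},
    (exists i, p i != 0) /\ \sum_i tau (p i) * x i = 0.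
  have fracx i : exists nd, pi nd.2 != 0 /\ x i = pi nd.1 / pi nd.2.
    by have [n [m [m0 xi]]] := pi_frac (x i); exists (n, m).
  pose nd i := projT1 (cid (fracx i)).
  have ndP i : pi (nd i).2 != 0 /\ x i = pi (nd i).1 / pi (nd i).2 by rewrite /nd; case: cid.
  pose D := \prod_i pi (nd i).2.
  have D0 : D != 0 by apply/prodf_neq0 => i _; have [] := ndP i.
  have [i|p [p0 sum0]] := @span_dependent _ _ tau J v (fun i => x i * D).
    have [i0 xi] := ndP i.
    have [B [_ vB]] := vst ((nd i).1 * \prod_(j | j != i) (nd j).2).
    exists (B j0); rewrite -vB v0 mulr1 rmorphM rmorph_prod /D (bigD1 i) //= xi.
    by rewrite mulrA divfK.
  exists p; split=> //; apply: (mulIf D0); rewrite mul0r mulr_suml -[RHS]sum0.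
  by apply: eq_bigr => i _; rewrite mulrA.
have [psi [psi0 psi_ker psiC]] := place_expansion placeG tau_inj G_tau dep piG.
exists psi; split=> // [c|p /pi_ker/psi_ker //|P /psi_ker/pie //].
by apply: psiC; rewrite /tau /= sgC etaC.
Qed.

End GoingDown.

(** Curve selection. If [f] does not vanish at the point, the constant arc will do.
    Otherwise a multiple [F] of [f] in the polynomial ring vanishes at the image [pt] of
    the point, and the line joins [pt] to a point [q] where [F] does not vanish. *)
Theorem power_series_arc (f : M) : zeta f != 0 ->
  exists psi : {rmorphism M -> powser k},
  [/\ forall c, psi c%:MP = powserC c, forall p, pcoef (psi p) 0 = a p,
      forall p, zeta p = 0 -> psi p = 0 & psi f != 0].
Proof.
move=> zf; have [af|af] := eqVneq (a f) 0; last first.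
  exists (@powserC k \o a); split=> [c|p|p /za p0|] /=.
  - by rewrite aC.
  - by [].
  - by rewrite p0 rmorph0.
  - by apply: contraNneq af => /(congr1 (fun s => pcoef s 0)) /= /eqP.
have [d [eta [etaC eta_inj eta_int]]] := noether_normalization zeta.
have [F [b [F0 Ffb]]] : exists F b, F != 0 /\ zeta (eta F) = zeta (f * b).
  have [P monP rootP] := eta_int f.
  have [F [Q [F0 FQ]]] := integral_multiple (monic_neq0 monP) rootP zf.
  exists F, (map_poly eta Q).[f]; split=> //.
  by rewrite [LHS]FQ rmorphM -horner_map -map_poly_comp.
pose pt i := a (eta 'X_i).
have evpt P : P.@[pt] = a (eta P).
  apply: (@mpoly_hom_ext _ _ _ (meval pt) (a \o eta)) => [c|i] /=.
    by rewrite mevalC etaC aC.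
  by rewrite mevalXU.
have [q Fq] := mpoly_nonroot F0.
have [i0 qi0] : exists i, q i != pt i.
  apply: contrapT => no; move/negP: Fq; apply.
  rewrite (@meval_eq _ _ _ pt) => [|i]; last first.
    by apply/eqP; apply: contraT => qi; case: no; exists i.
  have : zeta (eta F - f * b) = 0 by rewrite rmorphB Ffb subrr.
  by move=> /za; rewrite evpt rmorphB rmorphM af mul0r subr0 => ->.
have [e [eC eX]] := @mpoly_hom k {poly k} d polyC
  (fun i => (pt i)%:P + (q i - pt i)%:P * 'X).
have e0 P : (e P).[0] = a (eta P).
  rewrite -evpt; apply: (@mpoly_hom_ext _ _ _ (horner_eval 0 \o e) (meval pt)) => [c|i] /=.
    by rewrite eC mevalC /horner_eval hornerC.
  by rewrite eX mevalXU /horner_eval !hornerE.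
have e1 P : (e P).[1] = P.@[q].
  apply: (@mpoly_hom_ext _ _ _ (horner_eval 1 \o e) (meval q)) => [c|i] /=.
    by rewrite eC mevalC /horner_eval hornerC.
  by rewrite eX mevalXU /horner_eval hornerD hornerM !hornerC hornerX mulr1 addrC subrK.
have eF : e F != 0 by apply: contraNneq Fq => eF; rewrite -e1 eF horner0.
pose w : {mpoly k[d]} := ((q i0 - pt i0)^-1)%:MP * ('X_i0 - (pt i0)%:MP).
have ew : e w = 'X.
  rewrite rmorphM rmorphB !eC eX [X in _ * X]addrC addKr mulrA -polyCM mulVf ?subr_eq0 //.
  by rewrite mul1r.
pose sg : {rmorphism {poly k} -> {mpoly k[d]}} := horner_eval w \o map_poly (@mpolyC d k).
have sgC c : sg c%:P = c%:MP by rewrite /sg /= map_polyC /horner_eval hornerC.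
have eK p : e (sg p) = p.
  rewrite /sg /= /horner_eval -horner_map ew -map_poly_comp.
  by rewrite (eq_map_poly eC) -[RHS]comp_polyXr.
have [psi [psiC psi0 psi_ker psi_e]] := curve_arc etaC eta_inj eta_int e0 sgC eK.
exists psi; split=> //; apply: contraNneq eF => psif.
apply/eqP/psi_e; have : zeta (eta F - f * b) = 0 by rewrite rmorphB Ffb subrr.
by move=> /psi_ker; rewrite rmorphB rmorphM psif mul0r subr0.
Qed.

End Arc.

(** * Structure constants *)

Section Bracket.
Variables (R : comNzRingType) (n : nat).
Implicit Types (mu : 'I_n -> 'I_n -> 'rV[R]_n) (u v : 'rV[R]_n).

Definition br mu u v : 'rV[R]_n := \sum_a \sum_b (u 0 a * v 0 b) *: mu a b.

Lemma br_suml I (r : seq I) mu (c : I -> R) (x : I -> 'rV[R]_n) v :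
  br mu (\sum_(i <- r) c i *: x i) v = \sum_(i <- r) c i *: br mu (x i) v.
Proof.
rewrite /br; under [RHS]eq_bigr do rewrite scaler_sumr.
rewrite [RHS]exchange_big; apply: eq_bigr => a _.
under [RHS]eq_bigr do rewrite scaler_sumr.
rewrite [RHS]exchange_big; apply: eq_bigr => b _.
rewrite summxE mulr_suml scaler_suml; apply: eq_bigr => i _.
by rewrite mxE scalerA mulrA.
Qed.

Lemma br_sumr I (r : seq I) mu (c : I -> R) (x : I -> 'rV[R]_n) u :
  br mu u (\sum_(i <- r) c i *: x i) = \sum_(i <- r) c i *: br mu u (x i).
Proof.
rewrite /br; under [RHS]eq_bigr do rewrite scaler_sumr.
rewrite [RHS]exchange_big; apply: eq_bigr => a _.
under [RHS]eq_bigr do rewrite scaler_sumr.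
rewrite [RHS]exchange_big; apply: eq_bigr => b _.
rewrite summxE mulr_sumr scaler_suml; apply: eq_bigr => i _.
by rewrite mxE scalerA mulrCA.
Qed.

Lemma br_linearl mu v : linear (br mu ^~ v).
Proof.
move=> c x y; have := br_suml [:: (c, x); (1, y)] mu fst snd v.
by rewrite !big_cons !big_nil !addr0 !scale1r.
Qed.

Lemma br_linearr mu u : linear (br mu u).
Proof.
move=> c x y; have := br_sumr [:: (c, x); (1, y)] mu fst snd u.
by rewrite !big_cons !big_nil !addr0 !scale1r.
Qed.

Lemma brZl mu c u v : br mu (c *: u) v = c *: br mu u v.
Proof. by have := br_suml [:: u] mu (fun=> c) id v; rewrite !big_seq1. Qed.

Lemma brZr mu c u v : br mu u (c *: v) = c *: br mu u v.
Proof. by have := br_sumr [:: v] mu (fun=> c) id u; rewrite !big_seq1. Qed.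

Lemma br_mulmx mu u v (A : 'M[R]_n) :
  br mu (u *m A) (v *m A) = \sum_i \sum_j (u 0 i * v 0 j) *: br mu (row i A) (row j A).
Proof.
rewrite !mulmx_sum_row br_suml; apply: eq_bigr => i _.
by rewrite br_sumr scaler_sumr; apply: eq_bigr => j _; rewrite scalerA.
Qed.

Lemma br_mulr mu u v (A : 'M[R]_n) :
  br mu u v *m A = \sum_i \sum_j (u 0 i * v 0 j) *: (mu i j *m A).
Proof.
rewrite /br mulmx_suml; apply: eq_bigr => i _; rewrite mulmx_suml.
by apply: eq_bigr => j _; rewrite scalemxAl.
Qed.

Lemma br_delta mu i j : br mu (delta_mx 0 i) (delta_mx 0 j) = mu i j.
Proof.
rewrite /br (bigD1 i) //= (bigD1 j) //= !mxE !eqxx mul1r scale1r.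
rewrite big1 => [|b /negPf bj]; last by rewrite !mxE bj andbF mulr0 scale0r.
rewrite big1 ?addr0 // => a /negPf ai; apply: big1 => b _.
by rewrite !mxE ai andbF mul0r scale0r.
Qed.

End Bracket.

Lemma map_br (R S : comNzRingType) (f : {rmorphism R -> S}) n
    (mu : 'I_n -> 'I_n -> 'rV[R]_n) u v :
  map_mx f (br mu u v) = br (fun i j => map_mx f (mu i j)) (map_mx f u) (map_mx f v).
Proof.
rewrite /br map_mx_sum; apply: eq_bigr => a _; rewrite map_mx_sum; apply: eq_bigr => b _.
by rewrite map_mxZ rmorphM !mxE.
Qed.

(** ** Bases of modules *)

Section Basis.
Variables (R : comNzRingType) (X : lmodType R) (n : nat).
Implicit Type b : 'I_n -> X.

Definition lin b (u : 'rV[R]_n) : X := \sum_i u 0 i *: b i.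

Lemma lin_linear b : linear (lin b).
Proof.
move=> c u v; rewrite /lin scaler_sumr -big_split; apply: eq_bigr => i _.
by rewrite !mxE scalerDl scalerA.
Qed.

HB.instance Definition _ b := GRing.isLinear.Build R 'rV[R]_n X _ (lin b) (lin_linear b).

Lemma lin_delta b i : lin b (delta_mx 0 i) = b i.
Proof.
rewrite /lin (bigD1 i) //= mxE !eqxx scale1r big1 ?addr0 // => j /negPf ji.
by rewrite mxE ji andbF scale0r.
Qed.

Definition is_basis b : Prop := bijective (lin b).

Lemma basis_coordinates b : is_basis b ->
  exists c : {linear X -> 'rV[R]_n}, cancel (lin b) c /\ cancel c (lin b).
Proof.
move=> [c linK cK].
have clin : linear c by move=> a x y; apply: (can_inj linK); rewrite cK linearP /= !cK.
pose C : {linear X -> 'rV[R]_n} := HB.pack c (GRing.isLinear.Build _ _ _ _ c clin).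
by exists C.
Qed.

(** The abbreviation sc stands for structure constants. *)
Definition has_sc (brk : X -> X -> X) b (mu : 'I_n -> 'I_n -> 'rV[R]_n) : Prop :=
  is_basis b /\ forall u v, brk (lin b u) (lin b v) = lin b (br mu u v).

Lemma bilinear_has_sc (brk : X -> X -> X) b mu : is_basis b ->
  (forall y, linear (brk ^~ y)) -> (forall x, linear (brk x)) ->
  (forall i j, brk (b i) (b j) = lin b (mu i j)) -> has_sc brk b mu.
Proof.
move=> bb linl linr sc; split=> // u v.
have suml y (F : 'I_n -> X) : brk (\sum_i u 0 i *: F i) y = \sum_i u 0 i *: brk (F i) y.
  pose g : {linear X -> X} := HB.pack (brk ^~ y) (GRing.isLinear.Build _ _ _ _ _ (linl y)).
  rewrite -[LHS]/(g _) linear_sum; apply: eq_bigr => i _.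
  by rewrite linearZ.
have sumr x (F : 'I_n -> X) : brk x (\sum_i v 0 i *: F i) = \sum_i v 0 i *: brk x (F i).
  pose g : {linear X -> X} := HB.pack (brk x) (GRing.isLinear.Build _ _ _ _ _ (linr x)).
  rewrite -[LHS]/(g _) linear_sum; apply: eq_bigr => i _.
  by rewrite linearZ.
rewrite {1 2}/lin suml /br [RHS]linear_sum; apply: eq_bigr => i _.
rewrite sumr [RHS]linear_sum scaler_sumr; apply: eq_bigr => j _.
by rewrite sc [RHS]linearZ /= scalerA.
Qed.

Lemma bilinear_sc_exists (brk : X -> X -> X) b : is_basis b ->
  (forall y, linear (brk ^~ y)) -> (forall x, linear (brk x)) ->
  exists mu, has_sc brk b mu.
Proof.
move=> bb linl linr; have [c _ linK] := bb.
by exists (fun i j => c (brk (b i) (b j))); apply: bilinear_has_sc => // i j; rewrite linK.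
Qed.

End Basis.

Lemma lie_sc_exists (R : comNzRingType) (L : lieAlgType R) n (b : 'I_n -> L) :
  is_basis b -> exists mu, has_sc (@lie_bracket R L) b mu.
Proof.
by move=> bb; apply: bilinear_sc_exists => // x; [apply: lie_linearl | apply: lie_linearr].
Qed.

Lemma vect_basis (k : fieldType) (V : vectType k) n : \dim {:V} = n ->
  exists b : 'I_n -> V, is_basis b.
Proof.
move=> <-; exists (fun i => (vbasis {:V})`_i).
have bV := vbasisP {:V}.
exists (fun x => \row_i coord (vbasis {:V}) i x) => [u|x].
  by apply/rowP => i; rewrite mxE /lin coord_sum_free ?(basis_free bV).
rewrite {2}(coord_vbasis (memvf x)) /lin; apply: eq_bigr => i _.
by rewrite mxE.
Qed.

(** ** Isomorphisms in terms of structure constants *)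

Section Isomorphism.
Variables (R : comUnitRingType) (n : nat).
Implicit Types mu nu : 'I_n -> 'I_n -> 'rV[R]_n.

Definition sc_iso (A : 'M[R]_n) mu nu : Prop :=
  A \in unitmx /\ forall u v, br nu (u *m A) (v *m A) = br mu u v *m A.

Lemma sc_iso_rows A mu nu : A \in unitmx ->
  (forall i j, br nu (row i A) (row j A) = mu i j *m A) -> sc_iso A mu nu.
Proof.
move=> uA rowA; split=> // u v; rewrite br_mulmx br_mulr.
by apply: eq_bigr => i _; apply: eq_bigr => j _; rewrite rowA.
Qed.

Lemma sc_iso_row A mu nu i j : sc_iso A mu nu ->
  br nu (row i A) (row j A) = mu i j *m A.
Proof. by move=> [_ /(_ (delta_mx 0 i) (delta_mx 0 j))]; rewrite -!rowE br_delta. Qed.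

Lemma sc_iso_inv A mu nu : sc_iso A mu nu -> sc_iso (invmx A) nu mu.
Proof.
move=> [uA isoA]; split; first by rewrite unitmx_inv.
move=> u v; apply: (can_inj (mulmxK uA)).
by rewrite -isoA !mulmxKV.
Qed.

Lemma sc_isoP (X Y : lmodType R) brk brk' (b : 'I_n -> X) (b' : 'I_n -> Y) mu nu :
  has_sc brk b mu -> has_sc brk' b' nu ->
  (exists f : {linear X -> Y}, bijective f /\ forall x y, f (brk x y) = brk' (f x) (f y))
  <-> exists A, sc_iso A mu nu.
Proof.
move=> [bb sc] [[c' linK' cK'] sc'].
have [c [linK cK]] := basis_coordinates bb; split=> [[f [[g fK gK] fbrk]]|[A [uA isoA]]].
- pose A := \matrix_i c' (f (b i)).
  have fA u : f (lin b u) = lin b' (u *m A).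
    rewrite {1}/lin linear_sum mulmx_sum_row linear_sum; apply: eq_bigr => i _.
    by rewrite !linearZ /= rowK cK'.
  pose B := \matrix_i c (g (b' i)).
  have BA : B *m A = 1%:M.
    apply/row_matrixP => i; rewrite row_mul rowK row1 -[LHS]linK' -fA cK gK.
    by rewrite -[RHS]linK' lin_delta.
  have uA : A \in unitmx by case: (mulmx1_unit BA).
  exists A; split=> // u v; apply: (can_inj linK').
  by rewrite -sc' -fA -!fA -fbrk sc.
- exists (lin b' \o mulmxr A \o c); split=> [|x y].
    exists (fun y => lin b (c' y *m invmx A)) => [x|y] /=.
      by rewrite linK' mulmxK // cK.
    by rewrite linK mulmxKV // cK'.
  rewrite /= -[x in LHS]cK -[y in LHS]cK sc !linK.
  by rewrite -isoA -sc'.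
Qed.

(** The action of the general linear group: the structure constants, in the basis given
    by the rows of [B], of the bracket [br mu]. *)
Definition act (B : 'M[R]_n) mu i j : 'rV[R]_n :=
  br mu (row i B) (row j B) *m invmx B.

Lemma sc_iso_act B mu : B \in unitmx -> sc_iso B (act B mu) mu.
Proof. by move=> uB; apply: sc_iso_rows => // i j; rewrite mulmxKV. Qed.

Lemma act_sc_iso B mu nu i j : sc_iso B nu mu -> nu i j = act B mu i j.
Proof. by move=> isoB; rewrite /act (sc_iso_row _ _ isoB) mulmxK //; case: isoB. Qed.

End Isomorphism.

(** ** Extension of scalars *)

(** The coordinates in the basis of pure tensors come from the universal property. *)
Lemma extension_has_sc (R S : comNzRingType) (f : {rmorphism R -> S}) (L : lieAlgType R) n
    (b : 'I_n -> L) mu : has_sc (@lie_bracket R L) b mu ->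
  has_sc (@lie_bracket S (extension f L)) (fun i => tens f (b i) 1)
    (fun i j => map_mx f (mu i j)).
Proof.
move=> [bb0 sc]; have [C [linK cK]] := basis_coordinates bb0.
pose D x : 'rV[S]_n := map_mx f (C x).
have Dadd : zmod_morphism D by move=> x y; rewrite /D linearB map_mxB.
pose D' : {additive L -> 'rV[S]_n} := HB.pack D (GRing.isZmodMorphism.Build _ _ D Dadd).
have [|H [[Hlin Ht] _]] := @tensor_universal R S f L 'rV[S]_n D'.
  by move=> r x; rewrite /= /D linearZ map_mxZ.
have tens1 x s : tens f x s = s *: tens f x 1 by rewrite tensZr mulr1.
have linD x : lin (fun i => tens f (b i) 1) (D x) = tens f x 1.
  rewrite -[x in RHS]cK /lin.
  transitivity (\sum_i tens f (C x 0 i *: b i) 1).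
    by apply: eq_bigr => i _; rewrite mxE tensZl mulr1 -tens1.
  by elim/big_rec2: _ => [|i y z _ ->]; rewrite ?tens0l ?tensDl.
have bb : is_basis (fun i => tens f (b i) 1 : extension f L).
  have HD x y : H (x + y) = H x + H y by have := Hlin 1 x y; rewrite !scale1r.
  have H0 : H 0 = 0 by apply: (addrI (H 0)); rewrite -HD !addr0.
  have HZ a x : H (a *: x) = a *: H x by have := Hlin a x 0; rewrite !addr0 H0 addr0.
  exists H => [u|].
    rewrite /lin (big_morph H HD H0) {2}(row_sum_delta u); apply: eq_bigr => i _.
    rewrite HZ Ht scale1r; congr (_ *: _); rewrite /= /D /= -(lin_delta b) linK.
    by rewrite map_delta_mx.
  elim/tensor_ind => [|x s z IHz]; first by rewrite H0 linear0.
  by rewrite HD linearD /= IHz Ht linearZ /= linD -tens1.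
apply: bilinear_has_sc => //; [exact: lie_linearl|exact: lie_linearr|].
move=> i j; rewrite [LHS]ext_bracket_tens mulr1.
rewrite -[b i](lin_delta b) -[b j](lin_delta b) sc br_delta -linD /D /= linK.
by [].
Qed.

(** * Formal deformations *)

Section PowerSeries.
Variable k : fieldType.
Implicit Types (a : powser k).
Local Notation t := (powserX k).

Definition powser_shift a : powser k := Powser (fun n => pcoef a n.+1).

Lemma pcoefXM a m : pcoef (t * a) m = if m is m'.+1 then pcoef a m' else 0.
Proof.
case: m => [|m] /=; first by rewrite big_ord1 mul0r.
rewrite big_ord_recl mul0r add0r big_ord_recl /= mul1r subSS subn0.
by rewrite big1 ?addr0 // => i _; rewrite mul0r.
Qed.

Lemma powser_split a : a = powserC (pcoef a 0) + t * powser_shift a.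
Proof.
apply: powserP => m; rewrite -[RHS]/(pcoef (powserC _) m + pcoef (t * _) m) pcoefXM /=.
by case: m => [|m] /=; rewrite ?addr0 ?add0r.
Qed.

Lemma pcoefXnM a n m : pcoef (t ^+ n * a) m = if (m < n)%N then 0 else pcoef a (m - n).
Proof.
elim: n a m => [|n IHn] a m; first by rewrite mul1r subn0.
rewrite exprS -mulrA pcoefXM; case: m => [|m]; first by [].
by rewrite IHn ltnS subSS.
Qed.

Lemma powser_divXn a n : (forall m, (m < n)%N -> pcoef a m = 0) ->
  a = t ^+ n * Powser (fun m => pcoef a (m + n)).
Proof.
move=> a0; apply: powserP => m; rewrite pcoefXnM; case: ltnP => [/a0 //|nm].
by rewrite /= subnK.
Qed.

Lemma powserX_neq0 : t != 0.
Proof.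
by apply/eqP => /(congr1 (fun a => pcoef a 1)) /eqP; rewrite /= oner_eq0.
Qed.

End PowerSeries.

Lemma injsurj_bij (A B : Type) (f : A -> B) :
  injective f -> (forall y, exists x, f x = y) -> bijective f.
Proof.
move=> inj surj; pose g y := projT1 (cid (surj y)).
have gK y : f (g y) = y by rewrite /g; case: cid.
by exists g => // x; apply: inj.
Qed.

Section SpecialFiber.
Variables (k : fieldType) (X : lieAlgType (powser k)).
Local Notation t := (powserX k).
Local Notation ev0 := (@powser_ev0 k).

Lemma special_tens (z : extension ev0 X) : exists x, z = tens ev0 x 1.
Proof.
elim/tensor_ind: z => [|x s z [y ->]]; first by exists 0; rewrite tens0l.
exists (powserC s *: x + y); rewrite tensDl tensZl mulr1.
by [].
Qed.

(** The kernel of the reduction is [t X]. The map sending a tensor of [x] and [s] to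
    [s x] respects the tensor congruence modulo [t X]. *)
Lemma special_eq0 (x : X) : tens ev0 x 1 = 0 -> exists z, x = t *: z.
Proof.
move=> /tsumP xc; pose ev (u : seq (X * k)) := \sum_(p <- u) powserC p.2 *: p.1.
suff ev_cong u v : tensor_cong ev0 u v -> exists z, ev u - ev v = t *: z.
  have [z zE] := ev_cong _ _ xc.
  by exists z; rewrite -zE /ev big_seq1 big_nil subr0 rmorph1 scale1r.
rewrite /ev; elim=> {x xc u v} [u|u v _ [z zE]|u v w _ [z zE] _ [z' zE']|
  u u' v v' _ [z zE] _ [z' zE']|u v|y|y y' s|y s s'|r y s].
- by exists 0; rewrite subrr scaler0.
- by exists (- z); rewrite scalerN -zE opprB.
- by exists (z + z'); rewrite scalerDr -zE -zE' addrA subrK.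
- by exists (z + z'); rewrite scalerDr -zE -zE' !big_cat /= opprD addrACA.
- by exists 0; rewrite !big_cat /= [X in X - _]addrC subrr scaler0.
- by exists 0; rewrite big_seq1 big_nil rmorph0 scale0r subr0 scaler0.
- by exists 0; rewrite !big_cons !big_nil /= scalerDr !addr0 subrr scaler0.
- by exists 0; rewrite !big_cons !big_nil /= rmorphD scalerDl !addr0 subrr scaler0.
- exists ((powserC s * powser_shift r) *: y); rewrite !big_seq1 /= !scalerA -scalerBl.
  congr (_ *: _); rewrite {1}(powser_split r) rmorphM /= /powser_ev0.
  by rewrite mulrDr [powserC s * powserC _]mulrC addrC addKr mulrCA.
Qed.
End SpecialFiber.

Section DeformationBasis.
Variables (k : fieldType) (h : lieAlgType k) (X : formal_deformation h) (n : nat).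
Variables (e : 'I_n -> h) (mu : 'I_n -> 'I_n -> 'rV[k]_n).
Hypothesis sc_e : has_sc (@lie_bracket k h) e mu.
Local Notation t := (powserX k).
Local Notation ev0 := (@powser_ev0 k).

(** A lift of a basis of the special fibre is a basis: it spans modulo [t], hence
    modulo all powers of [t], and a relation is divisible by all powers of [t]. *)
Theorem deformation_basis : exists (b : 'I_n -> X) c,
  has_sc (@lie_bracket _ X) b c /\ forall i j, map_mx ev0 (c i j) = mu i j.
Proof.
have [[ce linK cK] sc] := sc_e.
have [[sg sfK sgK] sfM] := special_fiber_iso X.
pose sf := special_fiber X; have lift i := special_tens (sg (e i)).
pose b i : X := projT1 (cid (lift i)).
have bE i : sf (tens ev0 (b i) 1) = e i by rewrite /b; case: cid => x /= <-.
have sfl (u : 'rV[powser k]_n) : sf (tens ev0 (lin b u) 1) = lin e (map_mx ev0 u).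
  rewrite /lin; transitivity (\sum_i sf (tens ev0 (u 0 i *: b i) 1)).
    elim/big_rec2: _ => [|i x y _ <-]; first by rewrite tens0l linear0.
    by rewrite tensDl linearD.
  apply: eq_bigr => i _; rewrite mxE tensZl -bE -linearZ /= tensZr.
  by [].
have inj_ev u : lin b u = 0 -> map_mx ev0 u = 0.
  move=> u0; apply: (can_inj linK); rewrite -sfl u0 tens0l !linear0.
  by [].
have shiftE (u : 'rV[powser k]_n) :
    u = map_mx (@powserC k) (map_mx ev0 u) + t *: map_mx (@powser_shift k) u.
  by apply/rowP => i; rewrite !mxE; apply: powser_split.
have inj0 u : lin b u = 0 -> u = 0.
  move=> u0; apply/rowP => i; rewrite mxE; apply: powserP => m /=.
  elim: m u u0 => [|m IHm] u u0.
    by have := inj_ev u u0 => /rowP/(_ i); rewrite !mxE.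
  have : t *: lin b (map_mx (@powser_shift k) u) = 0.
    by rewrite -linearZ -[RHS]u0 [in RHS](shiftE u) inj_ev // map_mx0 add0r.
  move=> /deformed_torsion_free[/eqP|/IHm]; first by rewrite (negPf (powserX_neq0 k)).
  by rewrite mxE.
have ev0C (u : 'rV[k]_n) : map_mx ev0 (map_mx (@powserC k) u) = u.
  by apply/rowP => i; rewrite !mxE.
have span x : exists u y, x = lin b (map_mx (@powserC k) u) + t *: y.
  pose u := ce (sf (tens ev0 x 1)); exists u.
  have [y yE] : exists y, x - lin b (map_mx (@powserC k) u) = t *: y.
    apply: special_eq0.
    have xu : tens ev0 x 1 = tens ev0 (lin b (map_mx (@powserC k) u)) 1.
      by apply: (can_inj sfK); rewrite sfl ev0C cK.
    by apply: (addIr (tens ev0 x 1)); rewrite {1}xu -tensDl subrK add0r.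
  by exists y; rewrite -yE addrC subrK.
have spanP x : exists uy, x = lin b (map_mx (@powserC k) uy.1) + t *: uy.2.
  by have [u [y xE]] := span x; exists (u, y).
pose digit x := (projT1 (cid (spanP x))).1; pose rest x := (projT1 (cid (spanP x))).2.
have digitE x : x = lin b (map_mx (@powserC k) (digit x)) + t *: rest x.
  by rewrite /digit /rest; case: cid.
pose C x : 'rV[powser k]_n := \row_i Powser (fun m => digit (iter m rest x) 0 i).
have CE x : C x = map_mx (@powserC k) (digit x) + t *: C (rest x).
  apply/rowP => i; rewrite !mxE [LHS]powser_split; congr (_ + _ * _).
  by apply: powserP => m /=; rewrite -iterS iterSr.
have diffE x m : x - lin b (C x) = t ^+ m *: (iter m rest x - lin b (C (iter m rest x))).
  elim: m => [|m IHm]; first by rewrite scale1r.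
  rewrite {1}IHm exprSr -scalerA; congr (_ *: _); rewrite iterS; move: (iter m rest x) => y.
  have -> : lin b (C y) = lin b (map_mx (@powserC k) (digit y)) + t *: lin b (C (rest y)).
    by rewrite CE [LHS]linearD; congr (_ + _); apply: linearZ.
  by rewrite {1}(digitE y) opprD addrACA subrr add0r scalerBr.
have bb : is_basis b.
  apply: injsurj_bij => [u v /eqP|x].
    rewrite -subr_eq0 -linearB => /eqP/inj0/eqP.
    by rewrite subr_eq0 => /eqP.
  exists (C x); apply/esym/eqP; rewrite -subr_eq0; apply/eqP.
  apply: (proj1 (deformed_complete X)) => m.
  by exists (iter m rest x - lin b (C (iter m rest x))); rewrite subr0 -diffE.
have [c [_ sc_b]] := lie_sc_exists bb.
exists b, c; split=> // i j; apply: (can_inj linK); rewrite -sfl.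
have := sc_b (delta_mx 0 i) (delta_mx 0 j); rewrite br_delta !lin_delta => <-.
have := sc (delta_mx 0 i) (delta_mx 0 j); rewrite br_delta !lin_delta => <-.
rewrite -!bE -sfM -[[Lie _, _] in RHS]/(ext_bracket _ _) ext_bracket_tens mulr1.
by [].
Qed.
End DeformationBasis.

(** ** The deformation with given structure constants *)

Section BuildDeformation.
Variables (k : fieldType) (h : lieAlgType k) (n : nat).
Variables (e : 'I_n -> h) (mu : 'I_n -> 'I_n -> 'rV[k]_n).
Hypothesis sc_e : has_sc (@lie_bracket k h) e mu.
Local Notation t := (powserX k).
Local Notation ev0 := (@powser_ev0 k).
Local Notation "V[t]" := 'rV[powser k]_n.

Lemma row_t_complete : t_complete V[t].
Proof.
have divXn m (x y : V[t]) :
    congr_tn m x y <-> forall i l, (l < m)%N -> pcoef (x 0 i) l = pcoef (y 0 i) l.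
  split=> [[z zE] i l lm|xy].
    have /rowP/(_ i) := zE; rewrite !mxE => /(congr1 (fun a => pcoef a l)).
    by rewrite pcoefXnM lm => /eqP; rewrite /= subr_eq0 => /eqP.
  exists (\row_i Powser (fun l => pcoef ((x - y) 0 i) (l + m))); apply/rowP => i.
  rewrite [RHS]mxE [in RHS]mxE; apply: powser_divXn => l lm.
  by rewrite !mxE /= xy // subrr.
split=> [x x0|u ucauchy].
  apply/rowP => i; rewrite mxE; apply: powserP => m.
  by have /divXn -> := x0 m.+1; rewrite ?mxE.
exists (\row_i Powser (fun l => pcoef (u l.+1 0 i) l)) => m; apply/divXn => i l lm.
rewrite mxE /=; elim: m lm => // m IHm; rewrite ltnS leq_eqVlt => /orP[/eqP -> //|lm].
by rewrite IHm //; apply/esym; have /divXn := ucauchy m; apply.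
Qed.

Lemma row_torsion_free : torsion_free V[t].
Proof.
by move=> a x /eqP; rewrite scalemx_eq0 => /orP[]/eqP; [left|right].
Qed.

Theorem build_deformation (c : 'I_n -> 'I_n -> V[t]) :
  (forall u, br c u u = 0) ->
  (forall u v w, br c u (br c v w) + br c v (br c w u) + br c w (br c u v) = 0) ->
  (forall i j, map_mx ev0 (c i j) = mu i j) ->
  exists (X : formal_deformation h) (b : 'I_n -> X), has_sc (@lie_bracket _ X) b c.
Proof.
move=> alt jac c0.
pose X : lieAlgType (powser k) := HB.pack V[t]
  (Lmodule_isLie.Build (powser k) V[t] (br_linearl c) (br_linearr c) alt jac).
pose b i : X := delta_mx 0 i.
have linb (u : V[t]) : lin b u = u by rewrite /lin -row_sum_delta.
have scb : has_sc (@lie_bracket _ X) b c.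
  split; first by exists id => u; apply: linb.
  by move=> u v; rewrite !linb.
have [f fiso] : exists f : {linear extension ev0 X -> h}, lie_isomorphism f.
  apply/(sc_isoP (extension_has_sc ev0 scb) sc_e); exists 1%:M.
  split=> [|u v]; first exact: unitmx1.
  by rewrite !mulmx1; congr (br _ u v); apply/funext => i; apply/funext => j.
have cX : t_complete X := row_t_complete.
have tX : torsion_free X := row_torsion_free.
by exists (FormalDeformation cX tX fiso), b.
Qed.

End BuildDeformation.

(** * Polynomials vanishing on an orbit *)

Section ActPolynomial.
Variables (k : closedFieldType) (n : nat).
Local Notation J := ('I_n * 'I_n * 'I_n)%type.
Local Notation q := #|{: J}|.

Definition pt (R : Type) (nu : 'I_n -> 'I_n -> 'rV[R]_n) (m : 'I_q) : R :=
  nu (enum_val m).1.1 (enum_val m).1.2 0 (enum_val m).2.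

Definition generic_mx : 'M[{mpoly k[n * n]}]_n := \matrix_(i, j) 'X_(mxvec_index i j).

Definition ev_mx (E : comNzRingType) (iota : {rmorphism k -> E}) (B : 'M[E]_n) :
    {rmorphism {mpoly k[n * n]} -> E} := mmap iota (fun m => mxvec B 0 m).

Lemma ev_mx_generic E iota B : map_mx (@ev_mx E iota B) generic_mx = B.
Proof. by apply/matrixP => i j; rewrite !mxE /= mmapX mmap1U mxvecE. Qed.

Lemma ev_mxC E iota B c : @ev_mx E iota B c%:MP = iota c.
Proof. by rewrite /= mmapC. Qed.

(** Up to a power of the determinant, the value of a polynomial at the structure
    constants in the basis [B] is a polynomial in the entries of [B]. *)
Lemma act_polynomial (mu : 'I_n -> 'I_n -> 'rV[k]_n) (P : {mpoly k[q]}) :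
  exists Q : {mpoly k[n * n]}, forall (E : fieldType) (iota : {rmorphism k -> E}) B,
    B \in unitmx -> ev_mx iota B Q =
      \det B ^+ msize P * mmap iota (pt (act B (fun i j => map_mx iota (mu i j)))) P.
Proof.
pose X := generic_mx; pose C := @mpolyC (n * n) k.
pose Phi i j := br (fun i j => map_mx C (mu i j)) (row i X) (row j X) *m \adj X.
exists (\sum_(m <- msupp P) (P@_m)%:MP *
  (\det X ^+ (msize P - mdeg m) * \prod_l (pt Phi l) ^+ m l)).
move=> E iota B uB; set th := ev_mx iota B.
have thPhi l : th (pt Phi l) =
    \det B * pt (act B (fun i j => map_mx iota (mu i j))) l.
  rewrite /pt /Phi; move: (enum_val l) => [[i j] m] /=.
  have -> : th ((br (fun i j => map_mx C (mu i j)) (row i X) (row j X) *m \adj X) 0 m) =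
      (map_mx th (br (fun i j => map_mx C (mu i j)) (row i X) (row j X) *m \adj X)) 0 m.
    by rewrite [RHS]mxE.
  rewrite map_mxM map_mx_adj map_br !map_row ev_mx_generic /act /invmx uB -scalemxAr.
  rewrite [in RHS]mxE mulrA divff ?mul1r; last by move: uB; rewrite unitmxE unitfE.
  congr ((br _ _ _ *m _) _ _); apply/funext => a; apply/funext => b.
  by apply/rowP => c; rewrite !mxE /th ev_mxC.
rewrite (rmorph_sum th) [in RHS]/mmap mulr_sumr !big_seq; apply: eq_bigr => m mP.
rewrite (rmorphM th) [th (P@_m)%:MP]ev_mxC mulrCA; congr (_ * _).
rewrite (rmorphM th) (rmorphXn th) -det_map_mx ev_mx_generic (rmorph_prod th).
have -> : \prod_l th (pt Phi l ^+ m l) =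
    \det B ^+ mdeg m * mmap1 (pt (act B (fun i j => map_mx iota (mu i j)))) m.
  rewrite mdegE -prodrXr -big_split; apply: eq_bigr => l _.
  by rewrite (rmorphXn th) thPhi exprMn.
rewrite mulrA -exprD subnK //.
by apply: ltnW; apply: msize_mdeg_lt.
Qed.

(** [nu] is in the Zariski closure of the orbit of [mu]. *)
Definition sc_closure (mu nu : 'I_n -> 'I_n -> 'rV[k]_n) : Prop :=
  forall P : {mpoly k[q]},
    (forall B, B \in unitmx -> P.@[pt (act B mu)] = 0) -> P.@[pt nu] = 0.

Lemma ev_mx_id (v : 'I_(n * n) -> k) (Q : {mpoly k[n * n]}) :
  ev_mx idfun (\matrix_(i, j) v (mxvec_index i j)) Q = Q.@[v].
Proof.
apply: (@mpoly_hom_ext _ _ _ (ev_mx idfun _) (meval v)) => [c|i].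
  by rewrite ev_mxC [RHS]mevalC.
rewrite [RHS]mevalXU [LHS]mmapX mmap1U.
by case/mxvec_indexP: i => i j; rewrite mxvecE mxE.
Qed.

Lemma det_generic_neq0 : \det generic_mx != 0 :> {mpoly k[n * n]}.
Proof.
apply/eqP => /(congr1 (ev_mx idfun 1%:M)).
by rewrite -det_map_mx ev_mx_generic det1 rmorph0 => /eqP; rewrite oner_eq0.
Qed.

Lemma orbit_poly_eq0 mu (P : {mpoly k[q]}) (Q : {mpoly k[n * n]}) :
  (forall B, B \in unitmx -> ev_mx idfun B Q =
      \det B ^+ msize P * P.@[pt (act B mu)]) ->
  (forall B, B \in unitmx -> P.@[pt (act B mu)] = 0) -> Q = 0.
Proof.
move=> QE P0; apply/eqP; apply: contraT => Q0.
have [v] := mpoly_nonroot (mulf_neq0 Q0 det_generic_neq0).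
rewrite -ev_mx_id; set B := \matrix_(i, j) _.
rewrite rmorphM mulf_eq0 negb_or -det_map_mx ev_mx_generic => /andP[QB dB].
have uB : B \in unitmx by rewrite unitmxE unitfE.
by rewrite QE // P0 // mulr0 eqxx in QB.
Qed.

Lemma map_mx_id_fun (mu : 'I_n -> 'I_n -> 'rV[k]_n) :
  (fun i j => map_mx idfun (mu i j)) = mu.
Proof. by apply/funext => i; apply/funext => j; apply/rowP => l; rewrite mxE. Qed.

(** The polynomial [Q] of [act_polynomial] vanishes at all invertible matrices over the
    infinite field [k], hence is zero. *)
Lemma orbit_poly_extension mu (P : {mpoly k[q]}) (E : fieldType)
    (iota : {rmorphism k -> E}) (B : 'M[E]_n) :
  (forall A, A \in unitmx -> P.@[pt (act A mu)] = 0) -> B \in unitmx ->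
  mmap iota (pt (act B (fun i j => map_mx iota (mu i j)))) P = 0.
Proof.
move=> P0 uB; have [Q QE] := act_polynomial mu P.
have Q0 : Q = 0.
  by apply: orbit_poly_eq0 P0 => A uA; rewrite QE // map_mx_id_fun.
have := QE E iota B uB; rewrite Q0 rmorph0 => /esym/eqP.
rewrite mulf_eq0 expf_eq0 => /orP[/andP[_ dB]|/eqP //].
by move: uB; rewrite unitmxE unitfE dB.
Qed.

(** The generic matrix, over any field that contains its entries, tests the vanishing on
    the orbit: [P (act X mu)] is up to a power of the determinant the image of the
    polynomial [Q], which specializes to all [P (act A mu)]. *)
Lemma generic_point mu (K : fieldType) (f : {rmorphism {mpoly k[n * n]} -> K}) P :
  injective f ->
  mmap (f \o @mpolyC (n * n) k) (pt (act (map_mx f generic_mx)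
    (fun i j => map_mx (f \o @mpolyC (n * n) k) (mu i j)))) P = 0 ->
  forall A, A \in unitmx -> P.@[pt (act A mu)] = 0.
Proof.
move=> f_inj P0 A uA; have [Q QE] := act_polynomial mu P.
have uX : map_mx f generic_mx \in unitmx.
  rewrite unitmxE unitfE det_map_mx -(rmorph0 f) (inj_eq f_inj).
  exact: det_generic_neq0.
have := QE K (f \o @mpolyC (n * n) k) _ uX; rewrite P0 mulr0.
have -> : ev_mx (f \o @mpolyC (n * n) k) (map_mx f generic_mx) Q = f Q.
  apply: (@mpoly_hom_ext _ _ _ (ev_mx _ _) f) => [c|i]; first exact: ev_mxC.
  by rewrite [LHS]mmapX mmap1U; case/mxvec_indexP: i => i j; rewrite mxvecE !mxE.
rewrite -(rmorph0 f) => /f_inj Q0.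
have := QE k idfun A uA; rewrite Q0 rmorph0 map_mx_id_fun => /esym/eqP.
rewrite mulf_eq0 expf_eq0 => /orP[/andP[_ dA]|/eqP //].
by move: uA; rewrite unitmxE unitfE dA.
Qed.

End ActPolynomial.

(** * Orbits and the variety of Lie algebra structures *)

Lemma has_sc_identities (R : comNzRingType) (L : lieAlgType R) n (b : 'I_n -> L) mu :
  has_sc (@lie_bracket R L) b mu -> (forall u, br mu u u = 0) /\
  (forall u v w, br mu u (br mu v w) + br mu v (br mu w u) + br mu w (br mu u v) = 0).
Proof.
move=> [bb sc]; have linI := bij_inj bb; split=> [u|u v w]; apply: linI.
  by rewrite -sc lie_alternating linear0.
by rewrite !linearD /= -!sc lie_jacobi linear0.
Qed.

(** The identities over [R] hold because they hold over [E], where the bracket is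
    isomorphic to [nu]. *)
Lemma sc_identities_pullback (R : comNzRingType) (E : fieldType) (f : {rmorphism R -> E}) n
    (A : 'M[E]_n) (mu : 'I_n -> 'I_n -> 'rV[R]_n) nu :
  injective f -> sc_iso A (fun i j => map_mx f (mu i j)) nu ->
  (forall u, br nu u u = 0) /\
  (forall u v w, br nu u (br nu v w) + br nu v (br nu w u) + br nu w (br nu u v) = 0) ->
  (forall u, br mu u u = 0) /\
  (forall u v w, br mu u (br mu v w) + br mu v (br mu w u) + br mu w (br mu u v) = 0).
Proof.
move=> f_inj [uA isoA] [alt jac].
have finj (u v : 'rV[R]_n) : map_mx f u *m A = map_mx f v *m A -> u = v.
  move=> /(can_inj (mulmxK uA))/rowP uv; apply/rowP => i.
  by apply: f_inj; have := uv i; rewrite !mxE.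
split=> [u|u v w]; apply: finj; rewrite map_mx0 mul0mx.
  by rewrite map_br -isoA alt.
by rewrite !map_mxD !map_br !mulmxDl -!isoA jac.
Qed.

Section Orbits.
Variables (k : closedFieldType) (V : vectType k) (n : nat) (v : 'I_n -> V).
Hypothesis bv : is_basis v.
Local Notation bilin := 'Hom(V, 'Hom(V, V)).

Lemma bilin_has_sc (psi : bilin) : exists nu, has_sc (fun x y => psi x y) v nu.
Proof.
apply: bilinear_sc_exists => // x a y z; last by rewrite linearP.
by rewrite linearP add_lfunE scale_lfunE.
Qed.

Lemma bilin_of (F : V -> V -> V) : (forall y, linear (F ^~ y)) -> (forall x, linear (F x)) ->
  exists psi : bilin, forall x y, psi x y = F x y.
Proof.
move=> linl linr.
pose F2 x : {linear V -> V} := HB.pack (F x) (GRing.isLinear.Build _ _ _ _ (F x) (linr x)).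
pose F1 x : 'Hom(V, V) := linfun (F2 x).
have lin1 : linear F1.
  move=> a x y; apply/lfunP => z.
  rewrite add_lfunE scale_lfunE !lfunE /=; exact: linl.
pose F1' : {linear V -> 'Hom(V, V)} := HB.pack F1 (GRing.isLinear.Build _ _ _ _ F1 lin1).
exists (linfun F1') => x y; have -> : linfun F1' x = F1 x by rewrite lfunE.
by rewrite lfunE.
Qed.

Lemma bilin_sc_inj (psi psi' : bilin) nu : has_sc (fun x y => psi x y) v nu ->
  has_sc (fun x y => psi' x y) v nu -> psi = psi'.
Proof.
move=> [[c linK cK] sc] [_ sc']; apply/lfunP => x; apply/lfunP => y.
by rewrite -(cK x) -(cK y) sc sc'.
Qed.

(** The bilinear maps in the orbit are those isomorphic to [L]; the two steps in the
    definition of the orbit, an isomorphism and the action of an element of [GL(V)],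
    compose to one isomorphism. *)
Lemma orbit_ofP (L : finLieAlgType k) (b : 'I_n -> L) mu (psi : bilin) nu :
  has_sc (@lie_bracket k L) b mu -> has_sc (fun x y => psi x y) v nu ->
  orbit_of L psi <-> exists A, sc_iso A mu nu.
Proof.
move=> sc_b sc_v; rewrite -(sc_isoP sc_b sc_v); split.
  move=> [phi [_ [f bf fM] [g g0 ->]]].
  exists (g \o f); split=> [|x y] /=.
    apply: bij_comp bf; exists (g^-1)%VF; [exact: lker0_lfunK|exact: lker0_lfunVK].
  by rewrite gl_actE !lker0_lfunK // fM.
move=> [f [bf fM]]; have [g fK gK] := bf; exists psi; split; last first.
- exists \1%VF; first by apply/lker0P => x y; rewrite !lfunE.
  have k1 : lker (\1%VF : 'End(V)) == 0%VS by apply/lker0P => x y; rewrite !lfunE.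
  have inv1 x : (\1^-1)%VF x = x :> V by rewrite -{2}(lker0_lfunK k1 x) lfunE.
  by apply/lfunP => x; apply/lfunP => y; rewrite gl_actE !inv1 lfunE.
- by exists f.
- split=> [u|x y z]; first by rewrite -(gK u) -fM lie_alternating linear0.
  by rewrite -(gK x) -(gK y) -(gK z) -!fM -!linearD lie_jacobi linear0.
Qed.

Lemma orbit_of_lie_variety (L : finLieAlgType k) (b : 'I_n -> L) mu (psi : bilin) :
  has_sc (@lie_bracket k L) b mu -> orbit_of L psi -> lie_variety psi.
Proof.
move=> sc_b; have [nu sc_v] := bilin_has_sc psi.
move=> /(orbit_ofP sc_b sc_v)/(sc_isoP sc_b sc_v)[f [[g fK gK] fM]].
split=> [u|x y z]; first by rewrite -(gK u) -fM lie_alternating linear0.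
by rewrite -(gK x) -(gK y) -(gK z) -!fM -!linearD lie_jacobi linear0.
Qed.
End Orbits.

Section DegenerationCoordinates.
Variables (k : closedFieldType) (V : vectType k) (n : nat).
Variables (g h : finLieAlgType k) (v : 'I_n -> V) (bg : 'I_n -> g).
Variable mu : 'I_n -> 'I_n -> 'rV[k]_n.
Hypothesis bv : is_basis v.
Hypothesis sc_g : has_sc (@lie_bracket k g) bg mu.
Local Notation bilin := 'Hom(V, 'Hom(V, V)).
Local Notation J := ('I_n * 'I_n * 'I_n)%type.
Local Notation q := #|{: J}|.

Let act_in_orbit (psi : bilin) B : B \in unitmx ->
  has_sc (fun x y => psi x y) v (act B mu) -> orbit_of g psi.
Proof.
move=> uB sc; apply/(orbit_ofP sc_g sc).
by exists (invmx B); apply: sc_iso_inv; apply: sc_iso_act.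
Qed.

Let orbit_act (psi : bilin) nu : orbit_of g psi -> has_sc (fun x y => psi x y) v nu ->
  exists2 B, B \in unitmx & nu = act B mu.
Proof.
move=> gpsi sc; have [/(_ gpsi)[A /sc_iso_inv isoA] _] := orbit_ofP sc_g sc.
exists (invmx A); first by case: isoA.
by apply/funext => i; apply/funext => j; apply: act_sc_iso.
Qed.

(** With [sc_linear_combination], this identifies the polynomial functions on the space
    of bilinear maps with the polynomials in the structure constants. *)
Lemma sc_linear_coordinates : exists lam : 'I_q -> bilin -> k,
  (forall l, linear_for *%R (lam l)) /\
  forall (psi : bilin) nu, has_sc (fun x y => psi x y) v nu -> lam^~ psi =1 pt nu.
Proof.
have [C [vK cK]] := basis_coordinates bv.
pose t (l : 'I_q) : J := enum_val l.
exists (fun l (psi : bilin) => C (psi (v (t l).1.1) (v (t l).1.2)) 0 (t l).2); split.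
  move=> l a x y; rewrite add_lfunE scale_lfunE add_lfunE scale_lfunE linearP.
  by rewrite !mxE.
move=> psi nu [_ sc] l; rewrite /pt -/(t l); move: (t l) => [[i j] m] /=.
by have := sc (delta_mx 0 i) (delta_mx 0 j); rewrite br_delta !lin_delta => ->; rewrite vK.
Qed.

Lemma sc_linear_combination : exists E : 'I_q -> bilin,
  forall nu, has_sc (fun x y => (\sum_l pt nu l *: E l) x y) v nu.
Proof.
pose t (l : 'I_q) : J := enum_val l.
pose dl l (i j : 'I_n) : 'rV[k]_n := ((i, j) == (t l).1)%:R *: delta_mx 0 (t l).2.
have exE l : exists psi : bilin, has_sc (fun x y => psi x y) v (dl l).
  have [c [vK cK]] := basis_coordinates bv.
  have [|x a y z|psi psiE] := @bilin_of _ V (fun x y => lin v (br (dl l) (c x) (c y))).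
  - by move=> y a x z; rewrite linearP br_linearl linearP.
  - by rewrite linearP br_linearr linearP.
  by exists psi; split=> // u w; rewrite psiE !vK.
exists (fun l => projT1 (cid (exE l))) => nu.
apply: bilinear_has_sc => //.
- by move=> y a x z; rewrite linearP add_lfunE scale_lfunE.
- by move=> x a y z; rewrite linearP.
move=> i j; rewrite !sum_lfunE.
transitivity (\sum_l pt nu l *: lin v (dl l i j)).
  apply: eq_bigr => l _; rewrite !scale_lfunE; congr (_ *: _); case: cid => psi /= [_ sc].
  by have := sc (delta_mx 0 i) (delta_mx 0 j); rewrite br_delta !lin_delta.
rewrite (reindex (@enum_rank {: J})) /=; last exact/onW_bij/enum_rank_bij.
transitivity (\sum_ij \sum_m pt nu (enum_rank (ij, m)) *: lin v (dl (enum_rank (ij, m)) i j)).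
  by rewrite pair_bigA; apply: eq_bigr => -[ij m] _.
rewrite (bigD1 (i, j)) //= [X in _ + X]big1 ?addr0; last first.
  move=> ij ne; apply: big1 => m _; rewrite /dl /t enum_rankK /= eq_sym (negPf ne).
  by rewrite scale0r linear0 scaler0.
apply: eq_bigr => m _; rewrite /pt /dl /t enum_rankK /= eqxx scale1r lin_delta.
by [].
Qed.

(** A polynomial in the structure constants is a polynomial in the linear coordinates
    of the space of bilinear maps, and defines a closed subset of the variety. *)
Theorem closure_of_degeneration (bh : 'I_n -> h) nu :
  has_sc (@lie_bracket k h) bh nu -> degeneration V g h -> sc_closure mu nu.
Proof.
move=> sc_h deg P P0.
have [lam [lam_lin lamE]] := sc_linear_coordinates.
have [E EP] := sc_linear_combination.
pose psi := \sum_l pt nu l *: E l.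
have hpsi : orbit_of h psi.
  apply/(orbit_ofP sc_h (EP nu)); exists 1%:M; split; first exact: unitmx1.
  by move=> x y; rewrite !mulmx1.
pose p : {mpoly k[\dim {:bilin}]} :=
  mmap (@mpolyC _ k) (fun l => \sum_(m < \dim {:bilin}) lam l (vbasis {:bilin})`_m *: 'X_m) P.
have pE w : poly_eval p w = P.@[lam^~ w].
  pose ev : {rmorphism {mpoly k[q]} -> k} :=
    meval (fun i => coord (vbasis {:bilin}) i w) \o
    mmap (@mpolyC _ k) (fun l => \sum_(m < \dim {:bilin}) lam l (vbasis {:bilin})`_m *: 'X_m).
  apply: (@mpoly_hom_ext _ _ _ ev (meval (lam^~ w))) => [a|l].
    by rewrite /= mmapC /= !mevalC.
  rewrite /= mmapX mmap1U mevalXU raddf_sum /=.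
  pose La : {linear bilin -> k^o} := HB.pack (lam l) (GRing.isLinear.Build k bilin k^o _ (lam l) (lam_lin l)).
  rewrite [in RHS](coord_vbasis (memvf w)) -[RHS]/(La _) linear_sum; apply: eq_bigr => m _.
  by rewrite mevalZ mevalXU linearZ /= mulrC.
have closed : zariski_closed_in (@lie_variety k V)
    (lie_variety (V:=V) `&` zero_locus [set p])%classic by exists [set p]%classic.
have := deg psi hpsi _ (conj closed _) => -[|_].
  move=> w gw; split; first exact: (orbit_of_lie_variety bv sc_g gw).
  move=> _ ->; rewrite pE; have [nu' sc'] := bilin_has_sc bv w.
  rewrite (meval_eq _ (lamE _ _ sc')).
  by have [B uB ->] := orbit_act gw sc'; apply: P0.
by move=> /(_ p erefl); rewrite pE (meval_eq _ (lamE _ _ (EP nu))).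
Qed.

(** It suffices to consider, for each [psi] in the orbit of [h], a basis of [h] in which
    the structure constants are those of [psi] in [v]. *)
Theorem degeneration_of_closure :
  \dim {:h} = n ->
  (forall (bh : 'I_n -> h) nu, has_sc (@lie_bracket k h) bh nu -> sc_closure mu nu) ->
  degeneration V g h.
Proof.
move=> dim_h clos psi hpsi Z [[Ps ->] gZ].
have [b bb] := vect_basis dim_h; have [mu_h sc_h] := lie_sc_exists bb.
split; first exact: (orbit_of_lie_variety bv sc_h hpsi).
move=> p pP; have [nu sc_v] := bilin_has_sc bv psi.
(* the isomorphism transports the basis v of V to a basis of h *)
have [bh sc_h'] : exists bh : 'I_n -> h, has_sc (@lie_bracket k h) bh nu.
  have [A isoA] : exists A, sc_iso A nu mu_h.
    have [/(_ hpsi)[A /sc_iso_inv isoA] _] := orbit_ofP sc_h sc_v.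
    by exists (invmx A).
  have [uA isoAE] := isoA; have [[c linK cK] scE] := sc_h.
  exists (fun i => lin b (row i A)).
  have linA u : lin (fun i => lin b (row i A)) u = lin b (u *m A).
    rewrite {1}/lin mulmx_sum_row linear_sum; apply: eq_bigr => i _.
    by rewrite linearZ.
  split; last by move=> u w; rewrite !linA scE isoAE.
  exists (fun x => c x *m invmx A) => [u|x]; first by rewrite linA linK mulmxK.
  by rewrite linA mulmxKV.
have [E EP] := sc_linear_combination.
have wE nu' (w : bilin) : has_sc (fun x y => w x y) v nu' -> w = \sum_l pt nu' l *: E l.
  by move=> scw; apply: bilin_sc_inj scw (EP nu').
pose P : {mpoly k[q]} := mmap (@mpolyC _ k)
  (fun m => \sum_l coord (vbasis {:bilin}) m (E l) *: 'X_l) p.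
have PE nu' (w : bilin) : has_sc (fun x y => w x y) v nu' -> poly_eval p w = P.@[pt nu'].
  move=> /wE ->.
  pose ev : {rmorphism {mpoly k[\dim {:bilin}]} -> k} := meval (pt nu') \o
    mmap (@mpolyC _ k) (fun m => \sum_l coord (vbasis {:bilin}) m (E l) *: 'X_l).
  apply/esym; apply: (@mpoly_hom_ext _ _ _ ev (meval _)) => [a|m].
    by rewrite /= mmapC /= !mevalC.
  rewrite /= mmapX mmap1U mevalXU raddf_sum linear_sum /=; apply: eq_bigr => l _.
  by rewrite mevalZ mevalXU linearZ /= mulrC.
rewrite (PE _ _ sc_v); apply: (clos bh nu sc_h') => B uB.
have gw := act_in_orbit uB (EP (act B mu)).
by rewrite -(PE _ _ (EP (act B mu))); case: (gZ _ gw) => _; apply.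
Qed.

End DegenerationCoordinates.

(** * Degenerations and formal deformations *)

(** The valuation is minimal at [t0]. *)
Lemma place_min (K : fieldType) (k : closedFieldType) (G : K -> k -> Prop) (T : finType)
    (y : T -> K) : place G -> (exists t, y t != 0) ->
  exists t0, y t0 != 0 /\ forall t, exists c, G (y t / y t0) c.
Proof.
move=> [hG total] [t1 yt1].
suff min (s : seq T) : t1 \in s ->
    exists t0, y t0 != 0 /\ forall t, t \in s -> exists c, G (y t / y t0) c.
  by have [t0 [y0 t0P]] := min (enum T) (mem_enum _ t1); exists t0; split=> // t;
     apply: t0P; rewrite mem_enum.
suff {t1 yt1} min : (forall t, t \in s -> y t = 0) \/
    exists t0, y t0 != 0 /\ forall t, t \in s -> exists c, G (y t / y t0) c.
  by case: min => // y0 /y0 yt; rewrite yt eqxx in yt1.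
have G1 : G 1 1 by apply: (ph_1 hG).
elim: s => [|t s [s0|[t0 [y0 t0P]]]]; first by left.
  have [yt|yt] := eqVneq (y t) 0.
    by left=> u; rewrite inE => /orP[/eqP ->|/s0].
  right; exists t; split=> // u; rewrite inE => /orP[/eqP ->|/s0 ->].
    by exists 1; rewrite divff.
  by exists 0; rewrite mul0r; apply: (ph_0 hG).
right; have [yt|yt] := eqVneq (y t) 0.
  exists t0; split=> // u; rewrite inE => /orP[/eqP ->|/t0P //].
  by exists 0; rewrite yt mul0r; apply: (ph_0 hG).
have [[c tc]|t0t] := total (y t / y t0).
  exists t0; split=> // u; rewrite inE => /orP[/eqP ->|/t0P //].
  by exists c.
rewrite invf_div in t0t; exists t; split=> // u; rewrite inE => /orP[/eqP ->|/t0P[c uc]].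
  by exists 1; rewrite divff.
exists (c * 0); have := ph_M hG uc t0t.
by rewrite mulrA divfK.
Qed.

Section DegenerationArc.
Variables (k : closedFieldType) (n : nat).
Variables mu nu : 'I_n -> 'I_n -> 'rV[k]_n.
Local Notation J := ('I_n * 'I_n * 'I_n)%type.
Local Notation q := #|{: J}|.
Local Notation T := (option ('I_n * 'I_n)).
Local Notation S := (J + T)%type.
Local Notation M := {mpoly k[#|{: S}|]}.

Let var (s : S) : M := 'X_(enum_rank s).

(** The arc is taken on the closure of the graph of the orbit map in the product of
    the space of structure constants and the projective space of matrices [(1 : X)];
    a place of the field of the generic matrix tells in which affine chart. *)
Theorem degeneration_arc : sc_closure mu nu ->
  exists (c : 'I_n -> 'I_n -> 'rV[powser k]_n) (B : 'M[laurent k]_n),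
    (forall i j, map_mx (@powser_ev0 k) (c i j) = nu i j) /\
    sc_iso B (fun i j => map_mx (powser_laurent k) (c i j))
             (fun i j => map_mx (const_laurent k) (mu i j)).
Proof.
have [K [f f_inj]] : exists (K : fieldType) (f : {rmorphism {mpoly k[n * n]} -> K}), injective f.
  exists {fraction {mpoly k[n * n]}}, (@FracField.tofrac {mpoly k[n * n]}) => x y /eqP.
  by rewrite tofrac_eq => /eqP.
move=> clos; pose iK : {rmorphism k -> K} := f \o @mpolyC (n * n) k.
pose X : 'M[K]_n := map_mx f (generic_mx k n).
have uX : X \in unitmx.
  rewrite unitmxE unitfE det_map_mx -(rmorph0 f) (inj_eq f_inj).
  exact: det_generic_neq0.
pose phi := act X (fun i j => map_mx iK (mu i j)).
pose ev_phi : {rmorphism {mpoly k[q]} -> K} := mmap iK (pt phi).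
have ev_phi_ker P : ev_phi P = 0 -> P.@[pt nu] = 0.
  by move=> P0; apply: clos; apply: (generic_point f_inj P0).
pose G0 (x : K) (c : k) := exists P, ev_phi P = x /\ P.@[pt nu] = c.
have hG0 : partial_hom G0.
  split=> [c [P [/ev_phi_ker -> ->]] //||x y c d [P [<- <-]] [Q [<- <-]]|
           x y c d [P [<- <-]] [Q [<- <-]]].
  - by exists 1; rewrite rmorph1 meval1.
  - by exists (P - Q); rewrite rmorphB mevalB.
  - by exists (P * Q); rewrite rmorphM mevalM.
have iKG0 c : G0 (iK c) c by exists c%:MP; rewrite /ev_phi /= mmapC mevalC.
have [G [placeG G0G]] := place_extension hG0 (fun c => ex_intro (G0 ^~ c) _ (iKG0 c)).
have [hG _] := placeG.
have phiG i j l : G (phi i j 0 l) (nu i j 0 l).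
  apply: G0G; exists 'X_(enum_rank ((i, j), l)).
  by rewrite /ev_phi /= mmapX mmap1U mevalXU /pt enum_rankK.
pose y (t : T) : K := if t is Some ij then X ij.1 ij.2 else 1.
have [t0 [w0 yG]] := place_min placeG (ex_intro (fun t => y t != 0) None (oner_neq0 _)).
pose w := y t0; rewrite -/w in w0.
pose cy t := projT1 (cid (yG t)).
have cyG t : G (y t / w) (cy t) by rewrite /cy; case: cid.
pose z (s : S) : K := match s with inl ijl => phi ijl.1.1 ijl.1.2 0 ijl.2 | inr t => y t / w end.
pose al (s : S) : k := match s with inl ijl => nu ijl.1.1 ijl.1.2 0 ijl.2 | inr t => cy t end.
have zG s : G (z s) (al s) by case: s => [[[i j] l]|t]; [exact: phiG|exact: cyG].
pose zeta : {rmorphism M -> K} := mmap iK (fun m => z (enum_val m)).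
pose a : {rmorphism M -> k} := meval (fun m => al (enum_val m)).
have zC c : zeta c%:MP = iK c by exact: mmapC.
have zX s : zeta (var s) = z s by rewrite [LHS]mmapX mmap1U enum_rankK.
have aC c : a c%:MP = c by exact: mevalC.
have aX s : a (var s) = al s by rewrite [LHS]mevalXU enum_rankK.
have zaG p : G (zeta p) (a p).
  apply: (@mpoly_ind_hom _ _ (fun p => G (zeta p) (a p))) => [c|i|p1 p2 g1 g2|p1 p2 g1 g2].
  - by rewrite zC aC; apply: G0G.
  - by have := zG (enum_val i); rewrite -zX -aX /var enum_valK.
  - by rewrite !rmorphD; apply: (ph_D hG).
  - by rewrite !rmorphM; apply: (ph_M hG).
have za p : zeta p = 0 -> a p = 0.
  by move=> p0; have := zaG p; rewrite p0 => /(ph_fun0 hG).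
pose Y : 'M[M]_n := \matrix_(i, j) var (inr (Some (i, j))).
pose y0 : M := var (inr None).
pose Phi i j : 'rV[M]_n := \row_l var (inl ((i, j), l)).
have zY : map_mx zeta Y = w^-1 *: X.
  by apply/matrixP => i j; rewrite [LHS]mxE [Y i j]mxE zX [RHS]mxE mulrC.
have zy0 : zeta y0 = w^-1 by rewrite zX /= div1r.
have zPhi i j : map_mx zeta (Phi i j) = phi i j.
  by apply/rowP => l; rewrite [LHS]mxE [Phi i j 0 l]mxE zX.
have zf : zeta (y0 * \det Y) != 0.
  have dX : \det X != 0 by rewrite -unitfE -unitmxE.
  have wV : w^-1 != 0 by rewrite invr_eq0.
  by rewrite rmorphM zy0 -det_map_mx zY detZ !mulf_neq0 // expf_neq0.
pose muM i j : 'rV[M]_n := map_mx (@mpolyC _ k) (mu i j).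
have zmuM : (fun i j => map_mx zeta (muM i j)) = (fun i j => map_mx iK (mu i j)).
  by apply/funext => i; apply/funext => j; apply/rowP => l; rewrite !mxE zC.
(* the equation of the graph of the orbit map, cleared of denominators *)
have graph i j : map_mx zeta (br muM (row i Y) (row j Y) - y0 *: (Phi i j *m Y)) = 0.
  rewrite map_mxB map_br zmuM !map_row zY map_mxZ map_mxM zPhi zY zy0.
  rewrite !linearZ /= brZl brZr -(mulmxKV uX (br _ _ _)) -/(act _ _ _ _) -/phi.
  by rewrite -!scalerDr subrr !scaler0.
have [psi [psiC psi0 psi_ker psif]] := power_series_arc aC za zf.
pose c i j := map_mx psi (Phi i j); pose pY := map_mx psi Y; pose py := psi y0.
have psi_graph i j : br (fun i j => map_mx (@powserC k) (mu i j)) (row i pY) (row j pY) =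
    py *: (c i j *m pY).
  apply/eqP; rewrite -subr_eq0; apply/eqP.
  have -> : (fun i j => map_mx (@powserC k) (mu i j)) = (fun i j => map_mx psi (muM i j)).
    by apply/funext => i'; apply/funext => j'; apply/rowP => l; rewrite !mxE psiC.
  rewrite -!map_row -map_br /c -map_mxM -map_mxZ -map_mxB.
  by apply/rowP => l; rewrite !mxE; apply: psi_ker; have /rowP/(_ l) := graph i j; rewrite !mxE.
have pl_inj : injective (powser_laurent k) by move=> u v /eqP; rewrite tofrac_eq => /eqP.
have pl0 u : u != 0 -> powser_laurent k u != 0 by rewrite -(rmorph0 (powser_laurent k)) (inj_eq pl_inj).
move: psif; rewrite rmorphM mulf_eq0 negb_or -det_map_mx -/pY -/py => /andP[py0 dY].
pose e := powser_laurent k py.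
exists c, (e^-1 *: map_mx (powser_laurent k) pY); split=> [i j|].
  by apply/rowP => l; rewrite !mxE /powser_ev0 psi0 aX.
apply: sc_iso_rows => [|i j].
  by rewrite unitmxE unitfE detZ det_map_mx mulf_neq0 ?expf_neq0 ?invr_eq0 ?pl0.
have muE : (fun i j => map_mx (const_laurent k) (mu i j)) =
    (fun i j => map_mx (powser_laurent k) (map_mx (@powserC k) (mu i j))).
  by apply/funext => i'; apply/funext => j'; apply/rowP => l; rewrite !mxE.
rewrite !linearZ /= brZl brZr -2!(map_row (powser_laurent k)) muE -map_br psi_graph map_mxZ -/e map_mxM.
by congr (_ *: _); rewrite scalerA mulVf ?pl0 // scale1r.
Qed.

End DegenerationArc.

Theorem theorem5p1 (k : closedFieldType) (g h : finLieAlgType k)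
  (V : vectType k) (dim_gh : \dim {:g} = \dim {:h})
  (dim_V : \dim {:V} = \dim {:g}) :
  degeneration V g h <->
  exists X : formal_deformation h,
    lie_isomorphic (extension (powser_laurent k) X)
                   (extension (const_laurent k) g).
Proof.
have [v bv] := vect_basis dim_V; have [bg bbg] := vect_basis (erefl (\dim {:g})).
have [mu sc_g] := lie_sc_exists bbg.
have sc_gE := extension_has_sc (const_laurent k) sc_g.
have pl_inj : injective (powser_laurent k) by move=> x y /eqP; rewrite tofrac_eq => /eqP.
split=> [deg|[X isoX]].
  have [bh bbh] := vect_basis (esym dim_gh); have [nu sc_h] := lie_sc_exists bbh.
  have clos := closure_of_degeneration bv sc_g sc_h deg.
  have [c [B [c0 isoB]]] := degeneration_arc clos.
  have [alt jac] := sc_identities_pullback pl_inj isoB (has_sc_identities sc_gE).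
  have [X [b sc_X]] := build_deformation sc_h alt jac c0; exists X.
  by apply/(sc_isoP (extension_has_sc (powser_laurent k) sc_X) sc_gE); exists B.
apply: (degeneration_of_closure bv sc_g (esym dim_gh)) => bh nu sc_h P P0.
have [b [c [sc_X c0]]] := deformation_basis X sc_h.
have [A isoA] : exists A, sc_iso A (fun i j => map_mx (powser_laurent k) (c i j))
    (fun i j => map_mx (const_laurent k) (mu i j)).
  by apply/(sc_isoP (extension_has_sc (powser_laurent k) sc_X) sc_gE).
have [uA _] := isoA.
have := orbit_poly_extension (const_laurent k) P0 uA.
have <- : (fun i j => map_mx (powser_laurent k) (c i j)) =
    act A (fun i j => map_mx (const_laurent k) (mu i j)).
  by apply/funext => i; apply/funext => j; exact: (act_sc_iso i j isoA).
pose evc : {rmorphism _ -> powser k} := mmap (@powserC k) (pt c).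
have -> : mmap (const_laurent k) (pt (fun i j => map_mx (powser_laurent k) (c i j))) P =
    powser_laurent k (evc P).
  apply: (@mpoly_hom_ext _ _ _ (mmap (const_laurent k) _) (powser_laurent k \o evc)) => [a|m].
    by rewrite /evc /= !mmapC.
  by rewrite /evc /= !mmapX !mmap1U /pt mxE.
rewrite -(rmorph0 (powser_laurent k)) => /pl_inj evc0.
transitivity (powser_ev0 (evc P)); last by rewrite evc0 rmorph0.
apply: (@mpoly_hom_ext _ _ _ (meval (pt nu)) (@powser_ev0 k \o evc)) => [a|m].
  by rewrite /evc /= mmapC mevalC.
by rewrite /evc /= mmapX mmap1U mevalXU /pt -c0 mxE.
Qed.
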